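(* For each of the submanifolds ${\rm LS}(\mathfrak m,\mathfrak p,\mathfrak r,\mu)$, built from minimal immersions $\tilde y,\tilde y_2,\tilde y_3$, the following hold: (1) the Möbius form $C$ vanishes identically; (2) the Blaschke eigenvalues $\lambda_1,\lambda_2,\lambda_3$ are distinct if and only if $m_3r_2^2\neq m_2r_3^2$; (3) the Möbius second fundamental form $B$ is parallel if and only if $$\tilde y:M_1\to\mathbb H^{m_1+p_1}\left(-\tfrac1{r_1^2}\right),\quad \tilde y_2:M_2\to\mathbb S^{m_2+p_2}(r_2)\quad\text{and}\quad \tilde y_3:M_3\to\mathbb S^{m_3+p_3}(r_3)$$ are all parallel as Riemannian submanifolds (i.e. have parallel second fundamental forms). Furthermore, if this is the case, then $\tilde y(M_1)$ is isometric to the totally geodesic hyperbolic space $\mathbb H^{m_1}\left(-\frac1{r_1^2}\right)$ and $\tilde y$ can be taken as the standard embedding of $\mathbb H^{m_1}\left(-\frac1{r_1^2}\right)$ in $\mathbb H^{m_1+p_1}\left(-\frac1{r_1^2}\right)$.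
   Context: **Spaces.** $\mathbb S^n(r)\subset\mathbb R^{n+1}$ is the standard sphere of radius $r$, $\mathbb S^n=\mathbb S^n(1)$. $\mathbb R^N_1=\mathbb R\times\mathbb R^{N-1}$ carries $\langle y,y'\rangle_1=-y_0y_0'+y_1\cdot y_1'$. For $c<0$, $\mathbb H^n(c)=\{y=(y_0,y_1)\in\mathbb R^{n+1}_1:\langle y,y\rangle_1=1/c,\ y_0>0\}$. **Möbius invariants.** Let $x:M^m\to\mathbb S^{m+p}$ be an umbilic-free immersion (the traceless part of its second fundamental form $h$ vanishes nowhere), $H=\frac1m{\rm tr}\,h$. Put $\rho=\left(\frac m{m-1}(|h|^2-m|H|^2)\right)^{1/2}$, $Y=\rho(1,x):M\to\mathbb R^{m+p+2}_1$. The Möbius metric is $g=\langle dY,dY\rangle_1=\rho^2dx\cdot dx$. With $\Delta$ the Laplacian of $g$, put $N=-\frac1m\Delta Y-\frac1{2m^2}\langle\Delta Y,\Delta Y\rangle_1Y$. The Möbius normal bundle $V$ is the orthogonal complement of $\mathbb RY\oplus\mathbb RN\oplus Y_*(TM)$ in $M\times\mathbb R^{m+p+2}_1$, with the connection $D^\perp$ obtained by projecting the flat derivative to $V$. For a local $g$-orthonormal frame $\{E_i\}$ with dual $\{\omega^i\}$, $Y_i=Y_*(E_i)$, and a local orthonormal frame $\{E_\alpha\}$ of $V$, the Blaschke tensor $A=\sum A_{ij}\omega^i\omega^j$, the Möbius second fundamental form $B=\sum B^\alpha_{ij}\omega^i\omega^jE_\alpha$ and the Möbius form $C=\sum C^\alpha_i\omega^iE_\alpha$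 are defined by $dN=\sum A_{ij}\omega^jY_i+\sum C^\alpha_i\omega^iE_\alpha$, $\ dY_i=-\sum A_{ij}\omega^jY-\omega^iN+\sum\omega_i^jY_j+\sum B^\alpha_{ij}\omega^jE_\alpha$, where $\omega_i^j$ are the Levi-Civita connection forms of $g$. The Blaschke eigenvalues are the eigenvalues of $A$ with respect to $g$. ''$B$ is parallel'' is with respect to the Levi-Civita connection of $g$ and $D^\perp$. **The submanifolds ${\rm LS}(\mathfrak m,\mathfrak p,\mathfrak r,\mu)$.** Let $\mathfrak m=(m_1,m_2,m_3)$, $\mathfrak p=(p_1,p_2,p_3)$, $\mathfrak r=(r_1,r_2,r_3)$, $\mu=(\mu_1,\mu_2,\mu_3)$ with integers $m_a\ge1$, $p_a\ge0$ and reals $r_a>0$, $r_1^2=r_2^2+r_3^2$, $\mu_a\ge0$, $\mu_1+\mu_2+\mu_3=1$. Put $m=m_1+m_2+m_3$, $p=p_1+p_2+p_3+1$. Let $\lambda_1,\lambda_2,\lambda_3$ be the unique solution of $(m+m_1)\lambda_1+m_2\lambda_2+m_3\lambda_3=-\frac{m_1}{r_1^2}$, $\ m_1\lambda_1+(m+m_2)\lambda_2+m_3\lambda_3=\frac{m_2}{r_2^2}$, $\ m_1\lambda_1+m_2\lambda_2+(m+m_3)\lambda_3=\frac{m_3}{r_3^2}$, and let $B^0_1,B^0_2,B^0_3$ be the real numbers (unique up to a common sign) with $m_1B^0_1+m_2B^0_2+m_3B^0_3=0$ and $B^0_aB^0_b=-(\lambda_a+\lambda_b)$ for $a\ne b$.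 Put $K=m_1(B^0_1)^2+m_2(B^0_2)^2+m_3(B^0_3)^2-\frac{m-1}m$. Let $\tilde y=(\tilde y_0,\tilde y_1):M_1\to\mathbb H^{m_1+p_1}(-1/r_1^2)\subset\mathbb R^{m_1+p_1+1}_1$, $\tilde y_2:M_2\to\mathbb S^{m_2+p_2}(r_2)\subset\mathbb R^{m_2+p_2+1}$, $\tilde y_3:M_3\to\mathbb S^{m_3+p_3}(r_3)\subset\mathbb R^{m_3+p_3+1}$ be minimal immersions of manifolds of dimensions $m_1,m_2,m_3$ with constant scalar curvatures $\tilde S_1=-\frac{m_1(m_1-1)}{r_1^2}+\mu_1K$, $\tilde S_2=\frac{m_2(m_2-1)}{r_2^2}+\mu_2K$, $\tilde S_3=\frac{m_3(m_3-1)}{r_3^2}+\mu_3K$, respectively (scalar curvature = trace of Ricci). Then ${\rm LS}(\mathfrak m,\mathfrak p,\mathfrak r,\mu)$ denotes the immersed submanifold $\tilde x=\left(\frac{\tilde y_1}{\tilde y_0},\frac{\tilde y_2}{\tilde y_0},\frac{\tilde y_3}{\tilde y_0}\right):M_1\times M_2\times M_3\to\mathbb S^{m+p}$. It is umbilic-free, its Möbius metric is the product of the metrics induced by $\tilde y,\tilde y_2,\tilde y_3$, and its Blaschke tensor acts as $\lambda_a$ times the metric on $TM_a$, so its Blaschke eigenvalues are $\lambda_1,\lambda_2,\lambda_3$.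
   Formalization: The last claim of (3) fails if M_1 is disconnected or not complete (e.g. an open segment of H^1). Proved instead: for connected M_1, up to an isometry of the ambient hyperbolic space, ỹ maps M_1 onto an open part of the standard H^{m_1}, and bijectively onto all of it if M_1 is complete. *)

(* Defs.v *)
From HB Require Import structures.
From mathcomp Require Import all_boot all_order all_algebra.
From mathcomp Require Import all_classical all_reals all_analysis.
Set Implicit Arguments. Unset Strict Implicit. Unset Printing Implicit Defensive.
Import Order.TTheory GRing.Theory Num.Theory.
Import numFieldNormedType.Exports.
Local Open Scope classical_set_scope.
Local Open Scope ring_scope.

(** * Scalar products and quadrics *)

Section Forms.
Variable R : realType.

Definition ip (N : nat) (J : 'M[R]_N) (u v : 'rV[R]_N) : R :=
  (u *m J *m v^T) 0 0.

Definition eucl (N : nat) : 'M[R]_N := 1%:M.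

Definition mink (n : nat) : 'M[R]_(1 + n) := block_mx (- 1%:M) 0 0 1%:M.

Definition sphere (n : nat) (r : R) : set 'rV[R]_(1 + n) :=
  [set y | ip (eucl (1 + n)) y y = r ^+ 2].

Definition hyperbolic (n : nat) (c : R) : set 'rV[R]_(1 + n) :=
  [set y | ip (mink n) y y = c^-1 /\ 0 < y 0 ord0].

(* Time-orientation preserving Lorentz maps, i.e. the isometries of the
   hyperbolic spaces of [R^{1+n}_1]; they act on row vectors. *)
Definition hyperbolic_isometry (n : nat) (L : 'M[R]_(1 + n)) : Prop :=
  L *m mink n *m L^T = mink n /\
  forall (c : R) y, c < 0 -> @hyperbolic n c y -> @hyperbolic n c (y *m L).

(* Standard totally geodesic H^n(c) in H^{n+q}(c); [1 + n + q] and
   [1 + (n + q)] are convertible. *)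
Definition hyperbolic_incl (n q : nat) (z : 'rV[R]_(1 + n)) :
  'rV[R]_(1 + (n + q)) := row_mx z (0 : 'rV[R]_q).

(* Projection onto the [J]-orthogonal complement of the row space of [E]
   (the Gram matrix of the rows of [E] being invertible). *)
Definition nproj (k N : nat) (J : 'M[R]_N) (E : 'M[R]_(k, N))
  (v : 'rV[R]_N) : 'rV[R]_N :=
  v - v *m J *m E^T *m invmx (E *m J *m E^T) *m E.

End Forms.

Arguments sphere {R} n r.
Arguments hyperbolic {R} n c.

(** * Smooth manifolds *)

Section Manifolds.
Variable R : realType.

Definition pd (m : nat) (V : normedModType R) (i : 'I_m)
  (f : 'rV[R]_m -> V) : 'rV[R]_m -> V := fun u => 'D_(delta_mx 0 i) f u.

(* On an open set [D]: all iterated partial derivatives exist and are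
   differentiable, i.e. f is C^infinity. *)
Definition smooth_on (m : nat) (V : normedModType R) (D : set 'rV[R]_m)
  (f : 'rV[R]_m -> V) : Prop :=
  forall (s : seq 'I_m) u, D u -> differentiable (foldr (@pd m V) f s) u.

(* [cinv] is only meaningful on [chart_im], and [cmap] on [cdom]. *)
Record chart (T : Type) (m : nat) := Chart {
  cdom : set T;
  cmap : T -> 'rV[R]_m;
  cinv : 'rV[R]_m -> T }.

Definition chart_im (T : Type) (m : nat) (c : chart T m) : set 'rV[R]_m :=
  cmap c @` cdom c.

Definition chart_axiom (T : topologicalType) (m : nat) (c : chart T m) :
  Prop :=
  [/\ open (cdom c), open (chart_im c),
      (forall q, cdom c q -> cinv c (cmap c q) = q),
      (forall q, cdom c q -> {for q, continuous (cmap c)}) &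
      (forall u, chart_im c u -> {for u, continuous (cinv c)})].

Definition smooth_manifold (T : topologicalType) (m : nat)
  (A : set (chart T m)) : Prop :=
  [/\ hausdorff_space T, @second_countable T,
      (forall c, A c -> chart_axiom c),
      (forall q, exists2 c, A c & cdom c q) &
      (forall c c', A c -> A c' ->
         smooth_on (cmap c @` (cdom c `&` cdom c')) (cmap c' \o cinv c))].

Definition prod_chart (T T' : Type) (m m' : nat) (c : chart T m)
  (c' : chart T' m') : chart (T * T') (m + m') :=
  Chart (cdom c `*` cdom c')
        (fun q => row_mx (cmap c q.1) (cmap c' q.2))
        (fun u => (cinv c (lsubmx u), cinv c' (rsubmx u))).

Definition prod_atlas (T T' : Type) (m m' : nat) (A : set (chart T m))
  (A' : set (chart T' m')) : set (chart (T * T') (m + m')) :=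
  [set c | exists c1 c2, [/\ A c1, A' c2 & c = prod_chart c1 c2]].

(* A pointwise property of the coordinate expressions of a map [x]. *)
Definition in_charts (T : Type) (m N : nat) (A : set (chart T m))
  (x : T -> 'rV[R]_N) (P : ('rV[R]_m -> 'rV[R]_N) -> 'rV[R]_m -> Prop) :
  Prop :=
  forall c u, A c -> chart_im c u -> P (x \o cinv c) u.

Definition immersion (T : Type) (m N : nat) (A : set (chart T m))
  (x : T -> 'rV[R]_N) : Prop :=
  (forall c, A c -> smooth_on (chart_im c) (x \o cinv c)) /\
  in_charts A x (fun f u => row_free (jacobian f u)).

End Manifolds.

(** * Riemannian geometry in local coordinates *)

Section Riemannian.
Variable R : realType.
Variable m : nat.
Implicit Types (G : 'rV[R]_m -> 'M[R]_m) (i j k l : 'I_m) (u : 'rV[R]_m).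

Definition christoffel G k i j u : R :=
  2^-1 * \sum_l invmx (G u) k l *
    (pd i (fun w => G w j l) u + pd j (fun w => G w i l) u
     - pd l (fun w => G w i j) u).

Definition laplacian (V : normedModType R) G (F : 'rV[R]_m -> V) u : V :=
  \sum_i \sum_j invmx (G u) i j *:
    (pd i (pd j F) u - \sum_k christoffel G k i j u *: pd k F u).

Definition ricci G i j u : R :=
  \sum_k (pd k (christoffel G k i j) u - pd j (christoffel G k i k) u
    + \sum_l (christoffel G k k l u * christoffel G l i j u
              - christoffel G k j l u * christoffel G l i k u)).

Definition scalar_curvature G u : R :=
  \sum_i \sum_j invmx (G u) i j * ricci G i j u.

Variable N : nat.
Implicit Types (J : 'M[R]_N) (f : 'rV[R]_m -> 'rV[R]_N).

Definition induced_metric J f u : 'M[R]_m :=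
  jacobian f u *m J *m (jacobian f u)^T.

(* The normal connection is the projection of the flat derivative, the normal
   space at [u] being the [J]-complement of the row space of [E u]; [B] is a
   2-tensor with values in the normal bundle. *)
Definition nabla_normal (d : nat) J (E : 'rV[R]_m -> 'M[R]_(d, N)) G
  (B : 'I_m -> 'I_m -> 'rV[R]_m -> 'rV[R]_N) k i j u : 'rV[R]_N :=
  nproj J (E u) (pd k (B i j) u)
  - \sum_l (christoffel G l k i u *: B l j u
            + christoffel G l k j u *: B i l u).

(* Submanifolds of a quadric [<y, y> = const]: the position vector spans the
   normal line of the quadric, so the normal space of [f] inside the quadric is
   the complement of the position vector and of the tangent space. *)
Definition quadric_frame f u : 'M[R]_(1 + m, N) :=
  col_mx (f u) (jacobian f u).

Definition sff J f i j u : 'rV[R]_N :=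
  nproj J (quadric_frame f u) (pd i (pd j f) u).

Definition mean_curvature J f u : 'rV[R]_N :=
  m%:R^-1 *: \sum_i \sum_j invmx (induced_metric J f u) i j *: sff J f i j u.

Definition sff_norm2 J f u : R :=
  \sum_i \sum_j \sum_k \sum_l
    invmx (induced_metric J f u) i k * invmx (induced_metric J f u) j l *
    ip J (sff J f i j u) (sff J f k l u).

Definition nabla_sff J f k i j u : 'rV[R]_N :=
  nabla_normal J (quadric_frame f) (induced_metric J f) (sff J f) k i j u.

End Riemannian.

Section Submanifolds.
Variables (R : realType) (T : Type) (m N : nat).
Implicit Types (A : set (chart R T m)) (J : 'M[R]_N) (y : T -> 'rV[R]_N).

Definition minimal A J y : Prop :=
  in_charts A y (fun f u => mean_curvature J f u = 0).

Definition parallel A J y : Prop :=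
  in_charts A y (fun f u => forall k i j, nabla_sff J f k i j u = 0).

Definition has_scalar_curvature A J y (s : R) : Prop :=
  in_charts A y (fun f u => scalar_curvature (induced_metric J f) u = s).

End Submanifolds.

Section Completeness.
Variables (R : realType) (T : topologicalType) (m N : nat).
Implicit Types (A : set (chart R T m)) (J : 'M[R]_N) (y : T -> 'rV[R]_N).

Definition geodesic A J y (gamma : R -> T) : Prop :=
  continuous gamma /\
  forall c t, A c -> cdom c (gamma t) ->
    let G := induced_metric J (y \o cinv c) in
    let w : R -> 'rV[R]_m := cmap c \o gamma in
    [/\ derivable w t 1, derivable (derive1 w) t 1 &
        derive1 (derive1 w) t + \row_k (\sum_i \sum_j
          christoffel G k i j (w t) * derive1 w t 0 i * derive1 w t 0 j) = 0].

(* Every initial velocity is realised by a geodesic defined on all of R: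
   geodesic completeness of the metric induced by [y]. *)
Definition complete_metric A J y : Prop :=
  forall c q (v : 'rV[R]_m), A c -> cdom c q ->
    exists gamma, [/\ geodesic A J y gamma, gamma 0 = q &
                      derive1 (cmap c \o gamma) 0 = v].

End Completeness.

(** * Moebius invariants *)

(* [f : 'rV_m -> 'rV_N] is the coordinate expression of an immersion into the
   unit sphere of R^N. *)
Section Moebius.
Variable R : realType.
Variables m N : nat.
Implicit Types (f : 'rV[R]_m -> 'rV[R]_N) (i j k : 'I_m) (u : 'rV[R]_m).

Definition moebius_rho f u : R :=
  Num.sqrt (m%:R / (m%:R - 1) *
    (sff_norm2 (eucl R N) f u
     - m%:R * ip (eucl R N) (mean_curvature (eucl R N) f u)
                            (mean_curvature (eucl R N) f u))).

Definition moebius_Y f u : 'rV[R]_(1 + N) :=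
  moebius_rho f u *: row_mx (1%:M : 'rV[R]_1) (f u).

Definition moebius_metric f : 'rV[R]_m -> 'M[R]_m :=
  induced_metric (mink R N) (moebius_Y f).

Definition moebius_N f u : 'rV[R]_(1 + N) :=
  let LY := laplacian (moebius_metric f) (moebius_Y f) u in
  - (m%:R^-1 *: LY)
  - ((2 * m%:R ^+ 2)^-1 * ip (mink R N) LY LY) *: moebius_Y f u.

(* The Moebius normal bundle is the complement of its row space. *)
Definition moebius_frame f u : 'M[R]_(1 + (1 + m), 1 + N) :=
  col_mx (moebius_Y f u)
    (col_mx (moebius_N f u) (jacobian (moebius_Y f) u)).

(* [A], [B], [C] are given by their components in the coordinate frame
   [d_i] instead of an orthonormal frame [E_i]: since [Y_j] is orthogonal to
   [Y], [N] and the normal bundle, the structure equations read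
   [A(X, Z) = <dN(X), Y_* Z>], [C(X) = (dN(X))^normal] and
   [B(X, Z) = (d(Y_* Z)(X))^normal]. *)
Definition blaschke f u : 'M[R]_m :=
  \matrix_(i, j) ip (mink R N) (pd i (moebius_N f) u) (pd j (moebius_Y f) u).

Definition moebius_form f i u : 'rV[R]_(1 + N) :=
  nproj (mink R N) (moebius_frame f u) (pd i (moebius_N f) u).

Definition moebius_sff f i j u : 'rV[R]_(1 + N) :=
  nproj (mink R N) (moebius_frame f u) (pd i (pd j (moebius_Y f)) u).

Definition blaschke_eigenvalue f u (a : R) : bool :=
  eigenvalue (blaschke f u *m invmx (moebius_metric f u)) a.

Definition nabla_moebius_sff f k i j u : 'rV[R]_(1 + N) :=
  nabla_normal (mink R N) (moebius_frame f) (moebius_metric f)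
    (moebius_sff f) k i j u.

End Moebius.

Section MoebiusGlobal.
Variables (R : realType) (T : Type) (m N : nat).
Implicit Types (A : set (chart R T m)) (x : T -> 'rV[R]_N).

Definition moebius_form_vanishes A x : Prop :=
  in_charts A x (fun f u => forall i, moebius_form f i u = 0).

Definition moebius_sff_parallel A x : Prop :=
  in_charts A x (fun f u => forall k i j, nabla_moebius_sff f k i j u = 0).

End MoebiusGlobal.

(** * The submanifolds LS(m, p, r, mu) *)

Section LS.
Variable R : realType.
Variables m1 m2 m3 : nat.
Let m := (m1 + m2 + m3)%N.

Definition LS_lambda (r1 r2 r3 l1 l2 l3 : R) : Prop :=
  [/\ (m + m1)%N%:R * l1 + m2%:R * l2 + m3%:R * l3 = - (m1%:R / r1 ^+ 2),
      m1%:R * l1 + (m + m2)%N%:R * l2 + m3%:R * l3 = m2%:R / r2 ^+ 2 &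
      m1%:R * l1 + m2%:R * l2 + (m + m3)%N%:R * l3 = m3%:R / r3 ^+ 2].

Definition LS_B0 (l1 l2 l3 b1 b2 b3 : R) : Prop :=
  [/\ m1%:R * b1 + m2%:R * b2 + m3%:R * b3 = 0,
      b1 * b2 = - (l1 + l2), b1 * b3 = - (l1 + l3) & b2 * b3 = - (l2 + l3)].

Definition LS_K (b1 b2 b3 : R) : R :=
  m1%:R * b1 ^+ 2 + m2%:R * b2 ^+ 2 + m3%:R * b3 ^+ 2 - (m%:R - 1) / m%:R.

Variables p1 p2 p3 : nat.
Variables M1 M2 M3 : Type.

Definition LS_immersion (y : M1 -> 'rV[R]_(1 + (m1 + p1)))
  (y2 : M2 -> 'rV[R]_(1 + (m2 + p2))) (y3 : M3 -> 'rV[R]_(1 + (m3 + p3)))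
  (q : M1 * M2 * M3) :
  'rV[R]_((m1 + p1) + (1 + (m2 + p2)) + (1 + (m3 + p3))) :=
  (y q.1.1 0 ord0)^-1 *:
    row_mx (row_mx (rsubmx (y q.1.1)) (y2 q.1.2)) (y3 q.2).

End LS.

(* Main.v *)
(** The lift [Y = (y, y2, y3)] takes values in the light cone of [R^{2+m+p}_1], and
    [(1, x) = Y / y_0].  The squared norm of the trace-free second fundamental form of a
    light-cone position vector scales by [phi^-2] under [Y -> phi Y]; by the Gauss equation
    and the choice of the scalar curvatures it equals [(m - 1) / m] for [Y], so [rho = y_0]
    and [Y] is the Moebius position vector.  Minimality then gives [N = sum_a lambda_a y_a],
    hence [C = 0] and a block-scalar Blaschke tensor, while [B] differs from the second
    fundamental forms of the factors by parallel terms.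

    For a parallel minimal submanifold of a hyperbolic space, commuting two covariant
    derivatives of the second fundamental form [h] and contracting with [h] (Simons) yields
    [- (m / r^2) |h_b|^2 = sum_a (|[h_a, h_b]|^2 + tr (h_a h_b)^2)], so [h = 0].  The osculating
    space is then constant, and a Lorentz map moves the submanifold into the standard
    [H^m].  Its space-like projection [zeta : M -> R^m] is a local diffeomorphism.  If the metric
    is complete, the geodesics issuing from the base point project onto the rays
    [sinh (k t) / k * e], so every ray lifts; a local diffeomorphism with this property
    onto [R^m] from a connected Hausdorff space is injective. *)
Require Import Defs.
From HB Require Import structures.
From mathcomp Require Import all_boot all_order all_algebra.
From mathcomp Require Import all_classical all_reals all_analysis.
From mathcomp Require Import ring lra.
Set Implicit Arguments. Unset Strict Implicit. Unset Printing Implicit Defensive.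
Import Order.TTheory GRing.Theory Num.Theory.
Import numFieldNormedType.Exports.
Local Open Scope classical_set_scope.
Local Open Scope ring_scope.

(** * Partial derivatives *)

(** The factor quadrics have curvatures [kap a], so [<y_a, y_a> = 1 / kap a], and
    [r1^2 = r2^2 + r3^2] says that these squared norms sum to 0, i.e. that [Y] is null. Minimality
    gives [Delta Y = - sum_a m_a kap_a y_a]; inserted in the definition of [N] this produces the
    weights [m_a kap_a / m - X / (2 m^2)] with [X = sum_a kap_a m_a^2], and these are the solution
    of the linear system for the [lambda_a]. The constant [K] enters through [|h_a|^2 = - mu_a K]:
    the trace-free norm [- K + sum_a m_a kap_a - X / m] has to be [(m - 1) / m]. All connections are
    read off from flat derivatives by orthogonal projection. In the Simons argument a normal field
    is therefore replaced by a constant vector, and commuting covariant derivatives becomes the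
    symmetry of ordinary second partial derivatives. A null position vector cannot be split off
    orthogonally; so light-cone computations use [second_form], which keeps the position direction,
    and the Moebius frame contains the pair [Y], [N]. *)

(* [pd] with its body sealed: otherwise conversion tests between different
   partial derivatives unfold down to limits of filters. *)
HB.lock Definition dpart (R : realType) (m : nat) (V : normedModType R) (i : 'I_m)
  (f : 'rV[R]_m -> V) : 'rV[R]_m -> V := pd i f.

Lemma dpartE (R : realType) (m : nat) (V : normedModType R) : @dpart R m V = @pd R m V.
Proof. by rewrite dpart.unlock. Qed.

Section Calculus.
Variables (R : realType) (m : nat) (D : set 'rV[R]_m).
Hypothesis Dop : open D.
Local Notation sm := (smooth_on D).

(** The affine expansion of [f] at [u] is also one of [g], since the two remainders agree near 0;
    [diff_unique] then identifies the differentials. *)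
Lemma near_eq_differentiable (V : normedModType R) (f g : 'rV[R]_m -> V) u :
  (\near u, f u = g u) -> differentiable f u -> differentiable g u.
Proof.
move=> fg df.
have fgu : f u = g u by exact: nbhs_singleton fg.
suff h : continuous ('d f u) /\ g \o shift u = cst (g u) + 'd f u +o_ (0 : 'rV[R]_m) id.
  have dgE : 'd g u = 'd f u :> (_ -> _) by apply: diff_unique; case: h.
  by apply/diff_locallyP; rewrite dgE.
have [cf ef] := (diff_locallyP _ _).1 df.
split=> //; rewrite -fgu.
apply/eqaddoP => e e0.
move/eqaddoP: ef => /(_ e e0) ef.
near=> h.
have -> : (g \o shift u - (cst (f u) + 'd f u)) h = (f \o shift u - (cst (f u) + 'd f u)) h.
  rewrite /= !fctE /=; congr (_ - _).
  symmetry; near: h.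
  move/nbhs_ballP: fg => [d d0 fgd]; apply/nbhs_ballP; exists d => // h.
  rewrite -!ball_normE /= sub0r normrN => hd; apply: fgd.
  by rewrite -ball_normE /= opprD addrCA subrr addr0 normrN.
by near: h.
Unshelve. all: by end_near. Qed.

Lemma onD_near (V : Type) (f g : 'rV[R]_m -> V) u : D u ->
  (forall w, D w -> f w = g w) -> \near u, f u = g u.
Proof. by move=> Du fg; apply: filterS fg _; exact: open_nbhs_nbhs. Qed.

Lemma eq_pd_on (V : normedModType R) (f g : 'rV[R]_m -> V) i u : D u ->
  (forall w, D w -> f w = g w) -> dpart i f u = dpart i g u.
Proof. by move=> Du fg; rewrite dpartE; apply/near_eq_derive/onD_near. Qed.

Lemma eq_smooth_on (V : normedModType R) (f g : 'rV[R]_m -> V) :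
  (forall w, D w -> f w = g w) -> sm f -> sm g.
Proof.
rewrite /smooth_on -dpartE => fg smf s u Du.
have fgs w : D w -> foldr (@dpart R m V) f s w = foldr (@dpart R m V) g s w.
  elim: s w => [|i s IH] w Dw /=; first exact: fg.
  exact: eq_pd_on.
by apply: near_eq_differentiable (smf s u Du); exact: onD_near.
Qed.

(** Recursion on the order instead of on sequences of indices: closure under products and inverses
    becomes an induction on [n], because one application of the Leibniz rule leads to functions of
    the previous order. *)
Fixpoint Cn (V : normedModType R) (n : nat) (f : 'rV[R]_m -> V) : Prop :=
  (forall u, D u -> differentiable f u) /\
  (if n is n'.+1 then forall i, Cn n' (dpart i f) else True).

Lemma smooth_CnP (V : normedModType R) (f : 'rV[R]_m -> V) :
  sm f <-> forall n, Cn n f.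
Proof.
rewrite /smooth_on -dpartE; split=> [smf n|cf s].
  elim: n f smf => [|n IH] f smf /=; first by split=> // u Du; exact: (smf [::]).
  split=> [u Du|i]; first exact: (smf [::]).
  (* In [foldr] the last index of the sequence is the innermost derivative, hence [rcons]. *)
  by apply: IH => s u Du; have := smf (rcons s i) u Du; rewrite -cats1 foldr_cat.
elim/last_ind: s f cf => [|s i IH] f cf u Du /=; first by have [+ _] := cf 0%N; apply.
rewrite -cats1 foldr_cat /=; apply: IH => // n.
by have [_ +] := cf n.+1; apply.
Qed.

Lemma smooth_diff (V : normedModType R) (f : 'rV[R]_m -> V) u :
  sm f -> D u -> differentiable f u.
Proof. by move=> /(_ [::]); apply. Qed.

Lemma smooth_pd (V : normedModType R) (f : 'rV[R]_m -> V) i :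
  sm f -> sm (dpart i f).
Proof.
by rewrite /smooth_on -[@pd _ _ _]dpartE => smf s u Du; have := smf (rcons s i) u Du; rewrite -cats1 foldr_cat.
Qed.

Lemma eq_Cn (V : normedModType R) n (f g : 'rV[R]_m -> V) :
  (forall w, D w -> f w = g w) -> Cn n f -> Cn n g.
Proof.
elim: n f g => [|n IH] f g fg /= [df cf].
  by split=> // u Du; apply: near_eq_differentiable (df _ Du); exact: onD_near.
split=> [u Du|i].
  by apply: near_eq_differentiable (df _ Du); exact: onD_near.
by apply: IH (cf i) => w Dw; exact: eq_pd_on.
Qed.

Lemma CnW (V : normedModType R) n (f : 'rV[R]_m -> V) : Cn n.+1 f -> Cn n f.
Proof.
elim: n f => [|n IH] f [df cf]; first by split.
by split=> // i; apply: IH; exact: (cf i).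
Qed.

Lemma Cn_diff (V : normedModType R) n (f : 'rV[R]_m -> V) u :
  Cn n f -> D u -> differentiable f u.
Proof. by case: n => [|n] [+ _]; apply. Qed.

Section Scalar.
Implicit Types f g : 'rV[R]_m -> R.

Lemma pd_cst (V : normedModType R) i (c : V) (u : 'rV[R]_m) : dpart i (fun=> c) u = 0.
Proof. by rewrite dpartE; exact: derive_cst. Qed.

Lemma Cn_cst (V : normedModType R) n (c : V) : Cn n (fun=> c).
Proof.
elim: n c => [|n IH] c /=; split=> // i.
by apply: eq_Cn (IH 0) => w _; rewrite pd_cst.
Qed.

Lemma smooth_cst (V : normedModType R) (c : V) : sm (fun=> c).
Proof. by apply/smooth_CnP => n; exact: Cn_cst. Qed.

Lemma diff_pdD (V : normedModType R) (f g : 'rV[R]_m -> V) i u :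
  differentiable f u -> differentiable g u ->
  dpart i (fun w => f w + g w) u = dpart i f u + dpart i g u.
Proof. by move=> df dg; rewrite dpartE /pd [LHS]deriveD//; exact: diff_derivable. Qed.

Lemma Cn_add (V : normedModType R) n (f g : 'rV[R]_m -> V) :
  Cn n f -> Cn n g -> Cn n (fun w => f w + g w).
Proof.
elim: n f g => [|n IH] f g [df cf] [dg cg].
  by split=> // u Du; apply: differentiableD; [exact: df|exact: dg].
split=> [u Du|i]; first by apply: differentiableD; [exact: df|exact: dg].
apply: eq_Cn (IH _ _ (cf i) (cg i)) => w Dw.
by rewrite diff_pdD//; [exact: df|exact: dg].
Qed.

Lemma diff_pdM f g i u : differentiable f u -> differentiable g u ->
  dpart i (fun w => f w * g w) u = dpart i f u * g u + f u * dpart i g u.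
Proof.
move=> df dg; rewrite dpartE /pd [LHS]deriveM; [|exact: diff_derivable..].
by rewrite addrC [X in X + _]mulrC.
Qed.

Lemma Cn_mul n f g : Cn n f -> Cn n g -> Cn n (fun w => f w * g w).
Proof.
elim: n f g => [|n IH] f g cf cg.
  have [[df _] [dg _]] := (cf, cg).
  by split=> // u Du; apply: differentiableM; [exact: df|exact: dg].
have [[df cf'] [dg cg']] := (cf, cg).
split=> [u Du|i]; first by apply: differentiableM; [exact: df|exact: dg].
apply: (@eq_Cn _ _ (fun w => dpart i f w * g w + f w * dpart i g w)) => [w Dw|].
  by rewrite diff_pdM//; [exact: df|exact: dg].
apply: Cn_add; apply: IH; [exact: cf'|exact: CnW|exact: CnW|exact: cg'].
Qed.

Lemma diff_pdV f i u : differentiable f u -> f u != 0 ->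
  dpart i (fun w => (f w)^-1) u = - (dpart i f u * ((f u)^-1 * (f u)^-1)).
Proof.
move=> df f0; rewrite dpartE /pd deriveV//; last exact: diff_derivable.
by rewrite /GRing.scale/= -exprVn expr2; ring.
Qed.

Lemma Cn_inv n f : (forall u, D u -> f u != 0) -> Cn n f -> Cn n (fun w => (f w)^-1).
Proof.
move=> f0; elim: n => [|n IH] cf.
  by split=> // u Du; apply: differentiableV; [exact: Cn_diff cf _ | exact: f0].
split=> [u Du|i].
  by apply: differentiableV; [exact: Cn_diff cf _ | exact: f0].
have [df cf'] := cf.
apply: (@eq_Cn _ _ (fun w => (-1) * (dpart i f w * ((f w)^-1 * (f w)^-1)))) => [w Dw|].
  by rewrite diff_pdV ?mulN1r//; [exact: df|exact: f0].
have cV : Cn n (fun w => (f w)^-1) by apply: IH; exact: CnW.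
apply: Cn_mul; first exact: Cn_cst.
by apply: Cn_mul; [exact: cf'|exact: Cn_mul].
Qed.

Lemma smooth_mul f g : sm f -> sm g -> sm (fun w => f w * g w).
Proof. by move=> /smooth_CnP cf /smooth_CnP cg; apply/smooth_CnP => n; exact: Cn_mul. Qed.

Lemma smooth_inv f : (forall u, D u -> f u != 0) -> sm f -> sm (fun w => (f w)^-1).
Proof. by move=> f0 /smooth_CnP cf; apply/smooth_CnP => n; exact: Cn_inv. Qed.

Lemma pd_mul f g i u : sm f -> sm g -> D u ->
  dpart i (fun w => f w * g w) u = dpart i f u * g u + f u * dpart i g u.
Proof. by move=> sf sg Du; apply: diff_pdM; exact: smooth_diff. Qed.

End Scalar.

Lemma smooth_add (V : normedModType R) (f g : 'rV[R]_m -> V) :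
  sm f -> sm g -> sm (fun w => f w + g w).
Proof. by move=> /smooth_CnP cf /smooth_CnP cg; apply/smooth_CnP => n; exact: Cn_add. Qed.

Lemma pd_add (V : normedModType R) (f g : 'rV[R]_m -> V) i u :
  sm f -> sm g -> D u -> dpart i (fun w => f w + g w) u = dpart i f u + dpart i g u.
Proof. by move=> sf sg Du; apply: diff_pdD; exact: smooth_diff. Qed.

Lemma smooth_sum (V : normedModType R) (I : Type) (s : seq I)
  (P : pred I) (f : I -> 'rV[R]_m -> V) :
  (forall k, P k -> sm (f k)) -> sm (fun w => \sum_(k <- s | P k) f k w).
Proof.
move=> sf; elim: s => [|k s IH].
  by apply: eq_smooth_on (smooth_cst 0) => w _; rewrite big_nil.
have [Pk|nPk] := boolP (P k).
  apply: eq_smooth_on (smooth_add (sf _ Pk) IH) => w _.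
  by rewrite big_cons Pk.
by apply: eq_smooth_on IH => w _; rewrite big_cons (negbTE nPk).
Qed.

Lemma pd_sum (V : normedModType R) (I : Type) (s : seq I)
  (P : pred I) (f : I -> 'rV[R]_m -> V) i u :
  (forall k, P k -> sm (f k)) -> D u ->
  dpart i (fun w => \sum_(k <- s | P k) f k w) u = \sum_(k <- s | P k) dpart i (f k) u.
Proof.
move=> sf Du; elim: s => [|k s IH].
  rewrite big_nil -[RHS](pd_cst i (0 : V) u).
  by apply: eq_pd_on => // w _; rewrite big_nil.
rewrite big_cons -IH; case: ifP => Pk.
  rewrite -pd_add//; [|exact: sf|exact: smooth_sum].
  by apply: eq_pd_on => // w _; rewrite big_cons Pk.
by apply: eq_pd_on => // w _; rewrite big_cons Pk.
Qed.

Lemma smooth_prod (I : Type) (s : seq I) (P : pred I) (f : I -> 'rV[R]_m -> R) :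
  (forall k, P k -> sm (f k)) -> sm (fun w => \prod_(k <- s | P k) f k w).
Proof.
move=> sf; elim: s => [|k s IH].
  by apply: eq_smooth_on (smooth_cst (1 : R)) => w _; rewrite big_nil.
have [Pk|nPk] := boolP (P k).
  apply: eq_smooth_on (smooth_mul (sf _ Pk) IH) => w _.
  by rewrite big_cons Pk.
by apply: eq_smooth_on IH => w _; rewrite big_cons (negbTE nPk).
Qed.

Lemma smooth_det (n : nat) (G : 'rV[R]_m -> 'M[R]_n) :
  (forall i j, sm (fun w => G w i j)) -> sm (fun w => \det (G w)).
Proof.
move=> sG; apply: smooth_sum => s _; apply: smooth_mul; first exact: smooth_cst.
by apply: smooth_prod => i _; exact: sG.
Qed.

(** By Cramer's rule an entry of the inverse is a cofactor over the determinant, and both are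
    polynomials in the entries. *)
Lemma smooth_invmx (n : nat) (G : 'rV[R]_m -> 'M[R]_n) i j :
  (forall u, D u -> G u \in unitmx) ->
  (forall i j, sm (fun w => G w i j)) -> sm (fun w => invmx (G w) i j).
Proof.
move=> uG sG.
apply: (@eq_smooth_on _ (fun w => (\det (G w))^-1 * cofactor (G w) j i)) => [w Dw|].
  by rewrite /invmx uG// !mxE.
apply: smooth_mul.
  apply: smooth_inv; last exact: smooth_det.
  by move=> u Du; have := uG u Du; rewrite unitmxE unitfE.
apply: smooth_mul; first exact: smooth_cst.
apply: smooth_det => k l.
by apply: eq_smooth_on (sG (lift j k) (lift i l)) => w _; rewrite !mxE.
Qed.

Section Vector.
Variable N : nat.
Implicit Types f g : 'rV[R]_m -> 'rV[R]_N.

Lemma differentiable_rowP f u :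
  (forall j, differentiable (fun w => f w 0 j) u) -> differentiable f u.
Proof.
move=> df.
have -> : f = \sum_(j < N) (fun w => (f w 0 j) *: (delta_mx 0 j : 'rV[R]_N)).
  apply/funext => w; rewrite fct_sumE; exact: row_sum_delta.
by apply: differentiable_sum => j; exact: differentiableZl.
Qed.

Lemma differentiable_coordr f u j :
  differentiable f u -> differentiable (fun w => f w 0 j) u.
Proof.
move=> df.
rewrite (_ : (fun w => _) = (fun v : 'rV[R]_N => v 0 j : R) \o f)//.
by apply: differentiable_comp => //; exact: differentiable_coord.
Qed.

Lemma diff_pd_coord f i j u : differentiable f u ->
  dpart i f u 0 j = dpart i (fun w => f w 0 j) u.
Proof. by move=> df; rewrite !dpartE /pd derive_mx ?mxE//; exact: diff_derivable. Qed.

Lemma smooth_rowP f : sm f <-> forall j, sm (fun w => f w 0 j).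
Proof.
split=> [/smooth_CnP cf j|cf].
  apply/smooth_CnP => n; move: f cf.
  elim: n => [|n IH] f cf.
    by split=> // u Du; apply: differentiable_coordr; exact: Cn_diff (cf 0%N) _.
  split=> [u Du|i].
    by apply: differentiable_coordr; exact: Cn_diff (cf 0%N) _.
  apply: (@eq_Cn _ _ (fun w => dpart i f w 0 j)) => [w Dw|].
    by rewrite diff_pd_coord//; exact: Cn_diff (cf 0%N) _.
  by apply: IH => k; have [_] := cf k.+1; apply.
apply/smooth_CnP => n; move: f cf.
elim: n => [|n IH] f cf.
  by split=> // u Du; apply: differentiable_rowP => j; exact: smooth_diff.
split=> [u Du|i]; first by apply: differentiable_rowP => j; exact: smooth_diff.
apply: IH => j; apply: eq_smooth_on (smooth_pd i (cf j)) => w Dw.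
rewrite diff_pd_coord//.
by apply: differentiable_rowP => k; exact: smooth_diff.
Qed.

Lemma smooth_coord f j : sm f -> sm (fun w => f w 0 j).
Proof. by move=> /smooth_rowP. Qed.

Lemma pd_coord f i j u : sm f -> D u -> dpart i f u 0 j = dpart i (fun w => f w 0 j) u.
Proof. by move=> sf Du; apply: diff_pd_coord; exact: smooth_diff. Qed.

Lemma smooth_scale (a : 'rV[R]_m -> R) f : sm a -> sm f -> sm (fun w => a w *: f w).
Proof.
move=> sa sf; apply/smooth_rowP => j.
apply: eq_smooth_on (smooth_mul sa (smooth_coord j sf)) => w _.
by rewrite !mxE.
Qed.

Lemma pd_scale (a : 'rV[R]_m -> R) f i u : sm a -> sm f -> D u ->
  dpart i (fun w => a w *: f w) u = dpart i a u *: f u + a u *: dpart i f u.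
Proof.
move=> sa sf Du; apply/rowP => j.
rewrite pd_coord//; last exact: smooth_scale.
rewrite !mxE pd_coord// -pd_mul//; last exact: smooth_coord.
by apply: eq_pd_on => // w _; rewrite !mxE.
Qed.

Lemma smooth_ip (J : 'M[R]_N) f g : sm f -> sm g -> sm (fun w => ip J (f w) (g w)).
Proof.
move=> sf sg.
apply: (@eq_smooth_on _ (fun w => \sum_j (\sum_k f w 0 k * J k j) * g w 0 j)).
  move=> w _; rewrite /ip !mxE; apply: eq_bigr => j _.
  by rewrite !mxE.
apply: smooth_sum => j _; apply: smooth_mul; last exact: smooth_coord.
apply: smooth_sum => k _; apply: smooth_mul; [exact: smooth_coord|exact: smooth_cst].
Qed.

Lemma pd_ip (J : 'M[R]_N) f g i u : sm f -> sm g -> D u ->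
  dpart i (fun w => ip J (f w) (g w)) u = ip J (dpart i f u) (g u) + ip J (f u) (dpart i g u).
Proof.
move=> sf sg Du.
have ipE (v w : 'rV[R]_N) : ip J v w = \sum_j (\sum_k v 0 k * J k j) * w 0 j.
  by rewrite /ip !mxE; apply: eq_bigr => j _; rewrite !mxE.
rewrite !ipE -big_split/=.
rewrite (@eq_pd_on _ _ (fun w => \sum_j (\sum_k f w 0 k * J k j) * g w 0 j))//.
have sfJ j : sm (fun w => \sum_k f w 0 k * J k j).
  by apply: smooth_sum => k _; apply: smooth_mul; [exact: smooth_coord|exact: smooth_cst].
rewrite pd_sum//; last by move=> j _; apply: smooth_mul => //; exact: smooth_coord.
apply: eq_bigr => j _; rewrite pd_mul//; last exact: smooth_coord.
rewrite pd_coord//; congr (_ * _ + _).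
rewrite pd_sum//; last first.
  by move=> k _; apply: smooth_mul; [exact: smooth_coord|exact: smooth_cst].
apply: eq_bigr => k _; rewrite pd_mul//; [|exact: smooth_coord|exact: smooth_cst].
by rewrite pd_cst mulr0 addr0 pd_coord.
Qed.

End Vector.

Lemma smooth_mulmxr (N n : nat) (A : 'M[R]_(N, n)) (f : 'rV[R]_m -> 'rV[R]_N) : sm f -> sm (fun w => f w *m A).
Proof.
move=> sf; apply/smooth_rowP => j.
apply: (@eq_smooth_on _ (fun w => \sum_k f w 0 k * A k j)) => [w _|]; first by rewrite mxE.
by apply: smooth_sum => k _; apply: smooth_mul; [exact: smooth_coord|exact: smooth_cst].
Qed.

Lemma pd_mulmxr (N n : nat) (A : 'M[R]_(N, n)) (f : 'rV[R]_m -> 'rV[R]_N) i u : sm f -> D u ->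
  dpart i (fun w => f w *m A) u = dpart i f u *m A.
Proof.
move=> sf Du; apply/rowP => j.
rewrite pd_coord//; last exact: smooth_mulmxr.
rewrite (@eq_pd_on _ _ (fun w => \sum_k f w 0 k * A k j))//; last by move=> w _; rewrite mxE.
rewrite pd_sum//; last first.
  by move=> k _; apply: smooth_mul; [exact: smooth_coord|exact: smooth_cst].
rewrite mxE; apply: eq_bigr => k _.
rewrite pd_mul//; [|exact: smooth_coord|exact: smooth_cst].
by rewrite pd_cst mulr0 addr0 pd_coord.
Qed.

Lemma row_jacobian (N : nat) (f : 'rV[R]_m -> 'rV[R]_N) i u : sm f -> D u -> row i (jacobian f u) = dpart i f u.
Proof.
by move=> sf Du; rewrite dpartE /pd deriveEjacobian ?rowE//; exact: smooth_diff.
Qed.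

End Calculus.

(** * Mean value theorem and symmetry of second derivatives *)

Section Analysis.
Variable R : realType.

Lemma rV_norm_le (n : nat) (x : 'rV[R]_n) (e : R) :
  0 <= e -> (forall j, `|x 0 j| <= e) -> `|x| <= e.
Proof.
move=> e0 xe; rewrite /Num.Def.normr/= mx_normrE (bigmax_le _ e0)//= => -[i j] _.
by rewrite (ord1 i).
Qed.

Lemma rV_coord_le (n : nat) (x : 'rV[R]_n) j : `|x 0 j| <= `|x|.
Proof.
rewrite [leRHS]/Num.Def.normr/= mx_normrE.
by rewrite (le_bigmax _ (fun k => `|x k.1 k.2|) (0, j)).
Qed.

Lemma MVT_line (n : nat) (F : 'rV[R]_n -> R) (w v : 'rV[R]_n) :
  (forall s : R, 0 <= s <= 1 -> differentiable F (w + s *: v)) ->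
  exists2 s : R, 0 <= s <= 1 & F (w + v) - F w = 'd F (w + s *: v) v.
Proof.
move=> dF; pose g s : R := F (w + s *: v).
have dg (s : R) : 0 <= s <= 1 -> is_derive s 1 g ('d F (w + s *: v) v).
  move=> s01.
  have dl : is_diff s (fun s : R => w + s *: v) (fun s => s *: v).
    by apply: is_diff_eq; rewrite add0r.
  have /differentiableP dFs := dF s s01.
  have := is_diff_comp dl dFs => dgs.
  split; first by apply/derivable1_diffP; exact: ex_diff.
  by rewrite deriveE; [rewrite diff_val /= scale1r|exact: ex_diff].
have [||s s01] := @MVT_segment R g (fun s => 'd F (w + s *: v) v) 0 1 ler01.
- by move=> s; rewrite in_itv/= => /andP[s0 s1]; apply: dg; rewrite !ltW.
- apply: derivable_within_continuous => s; rewrite in_itv/= => s01.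
  by have [] := dg s s01.
rewrite /g scale1r scale0r addr0 subr0 mulr1 => ->.
by exists s; rewrite // -in_itv.
Qed.

Lemma diff_sum_pd (n : nat) (V : normedModType R) (F : 'rV[R]_n -> V) u v :
  differentiable F u -> 'd F u v = \sum_i v 0 i *: dpart i F u.
Proof.
move=> dF; rewrite [in LHS](row_sum_delta v) linear_sum/=.
by apply: eq_bigr => i _; rewrite linearZ/= dpartE /pd deriveE.
Qed.

Lemma pd_shift (n : nat) (V : normedModType R) (f : 'rV[R]_n -> V) i u c :
  dpart i (fun w => f (w + c)) u = dpart i f (u + c).
Proof.
rewrite dpartE /pd /derive; set F := fun h : R => _; set G := fun h : R => _.
by have -> : F = G by apply/funext => h; rewrite /F /G /= -addrA.
Qed.

Lemma differentiable_shift (n : nat) (V : normedModType R) (f : 'rV[R]_n -> V) u c :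
  differentiable f (u + c) -> differentiable (fun w => f (w + c)) u.
Proof.
by move=> df; apply: (@differentiable_comp _ _ _ _ (fun w => w + c) f).
Qed.

Lemma MVT_pd (n : nat) (F : 'rV[R]_n -> R) (w : 'rV[R]_n) i (h : R) :
  (forall s : R, 0 <= s <= 1 -> differentiable F (w + s *: (h *: delta_mx 0 i))) ->
  exists2 s : R, 0 <= s <= 1 &
    F (w + h *: delta_mx 0 i) - F w = h * dpart i F (w + s *: (h *: delta_mx 0 i)).
Proof.
move=> dF; have [s s01 ->] := MVT_line dF; exists s => //.
by rewrite linearZ /= dpartE /pd deriveE//; exact: dF.
Qed.

(** The second difference of [f] over a small square, evaluated by the mean value theorem once in
    each direction. It is symmetric in [i] and [j], which yields [pd_comm]. *)
Lemma pd_comm_aux (n : nat) (D : set 'rV[R]_n) (f : 'rV[R]_n -> R) (u : 'rV[R]_n)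
  (i j : 'I_n) (r : R) :
  0 < r -> ball u r `<=` D -> smooth_on D f ->
  exists2 w, ball u r w &
    f (u + (r / 3) *: delta_mx 0 i + (r / 3) *: delta_mx 0 j)
    - f (u + (r / 3) *: delta_mx 0 j)
    - (f (u + (r / 3) *: delta_mx 0 i) - f u) = (r / 3) * ((r / 3) * dpart j (dpart i f) w).
Proof.
(* Displacements within the square have norm at most [2 r / 3] (attained when [i = j]), so the side
   [r / 3] keeps it inside the open ball. *)
move=> r0 uD sf; set h := r / 3; set ei := delta_mx 0 i; set ej := delta_mx 0 j.
have h0 : 0 < h by rewrite divr_gt0.
have uh (s t : R) : 0 <= s <= 1 -> 0 <= t <= 1 -> ball u r (u + s *: (h *: ei) + t *: (h *: ej)).
  move=> /andP[s0 s1] /andP[t0 t1].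
  rewrite -ball_normE /= -addrA opprD addrA subrr add0r normrN.
  apply: (@le_lt_trans _ _ (h + h)); last by rewrite /h; lra.
  apply: rV_norm_le; first by rewrite addr_ge0// ltW.
  move=> k; rewrite !mxE/=.
  have b (b : bool) (c : R) : 0 <= c <= 1 -> `|c * (h * b%:R)| <= h.
    move=> /andP[c0 c1]; rewrite normrM (ger0_norm c0) normrM (gtr0_norm h0).
    rewrite (@le_trans _ _ (1 * (h * 1)))//; last by rewrite !mul1r mulr1.
    apply: ler_pM => //; first by rewrite mulr_ge0// ltW.
    by rewrite ler_pM2l//; case: b; rewrite ?normr1// normr0.
  by rewrite (le_trans (ler_normD _ _))// lerD//; apply: b; apply/andP; split.
have le11 : 0 <= (1 : R) <= 1 by apply/andP; split.
have le00 : 0 <= (0 : R) <= 1 by apply/andP; split.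
have uh' (s : R) : 0 <= s <= 1 -> D (u + s *: (h *: ei)).
  by move=> s01; apply: uD; have := uh s 0 s01 le00; rewrite scale0r addr0.
have uh'' (s : R) : 0 <= s <= 1 -> D (u + s *: (h *: ei) + h *: ej).
  by move=> s01; apply: uD; have := uh s 1 s01 le11; rewrite scale1r.
have [|s s01] := @MVT_pd n (fun w => f (w + h *: ej) - f w) u i h.
  move=> s s01; apply: differentiableB; last exact: smooth_diff sf (uh' _ s01).
  by apply: differentiable_shift; exact: smooth_diff sf (uh'' _ s01).
have [|t t01] := @MVT_pd n (dpart i f) (u + s *: (h *: ei)) j h.
  by move=> t t01; apply: (smooth_diff (smooth_pd i sf)); apply: uD; exact: uh.
have -> : dpart i (fun w => f (w + h *: ej) - f w) (u + s *: (h *: ei)) =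
    dpart i f (u + s *: (h *: ei) + h *: ej) - dpart i f (u + s *: (h *: ei)).
  rewrite -[in RHS]pd_shift !dpartE [LHS]/pd deriveB//; apply: diff_derivable.
    by apply: differentiable_shift; exact: smooth_diff sf (uh'' _ s01).
  exact: smooth_diff sf (uh' _ s01).
rewrite -/ei -/ej => -> e2; exists (u + s *: (h *: ei) + t *: (h *: ej)); first exact: uh.
by rewrite -e2; ring.
Qed.

Lemma pd_comm (n : nat) (D : set 'rV[R]_n) (f : 'rV[R]_n -> R) (u : 'rV[R]_n) (i j : 'I_n) :
  open D -> smooth_on D f -> D u -> dpart i (dpart j f) u = dpart j (dpart i f) u.
Proof.
move=> Do sf Du.
apply/eqP; rewrite -subr_eq0 -normr_le0; apply/ler_addgt0Pl => e e0; rewrite addr0.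
have e20 : 0 < e / 2 by rewrite divr_gt0.
have c1 : {for u, continuous (dpart i (dpart j f))}.
  by apply: differentiable_continuous; exact: smooth_diff (smooth_pd _ (smooth_pd _ sf)) _.
have c2 : {for u, continuous (dpart j (dpart i f))}.
  by apply: differentiable_continuous; exact: smooth_diff (smooth_pd _ (smooth_pd _ sf)) _.
have n3 := open_nbhs_nbhs (conj Do Du).
move/cvgrPdist_lt : c1 => /(_ _ e20) n1; move/cvgrPdist_lt : c2 => /(_ _ e20) n2.
have /nbhs_ballP[r /= r0 br] : nbhs u [set w | D w /\
    (`|dpart i (dpart j f) u - dpart i (dpart j f) w| < e / 2 /\
     `|dpart j (dpart i f) u - dpart j (dpart i f) w| < e / 2)].
  by apply: filterI; [exact: n3|apply: filterI; [exact: n1|exact: n2]].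
have bD : ball u r `<=` D by move=> w /br[].
have [w1 bw1 e1] := pd_comm_aux i j r0 bD sf.
have [w2 bw2 e2] := pd_comm_aux j i r0 bD sf.
have h0 : 0 < r / 3 by rewrite divr_gt0.
move: br e1 e2; move: (dpart i (dpart j f)) (dpart j (dpart i f)) => g1 g2 br e1 e2.
(* Both values, multiplied by the square of the side, are the same second difference; continuity of
   the two mixed derivatives at [u] finishes. *)
have e12 : g2 w1 = g1 w2.
  apply: (mulfI (lt0r_neq0 h0)); apply: (mulfI (lt0r_neq0 h0)); rewrite -e1 -e2.
  by rewrite [u + _ + _]addrAC; ring.
have [_ [_ /ltW h1]] := br _ bw1; have [_ [/ltW h2 _]] := br _ bw2.
rewrite (splitr e) -(subrKA (g1 w2)).
by rewrite (le_trans (ler_normD _ _))// lerD// -e12 distrC.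
Qed.

Lemma pd_comm_rV (n N : nat) (D : set 'rV[R]_n) (f : 'rV[R]_n -> 'rV[R]_N)
    (u : 'rV[R]_n) (i j : 'I_n) :
  open D -> smooth_on D f -> D u -> dpart i (dpart j f) u = dpart j (dpart i f) u.
Proof.
move=> Do sf Du; apply/rowP => k.
rewrite (pd_coord i k (smooth_pd j sf) Du) (pd_coord j k (smooth_pd i sf) Du).
have sfk : smooth_on D (fun w => f w 0 k) by exact: smooth_coord.
rewrite (eq_pd_on Do (g := dpart j (fun w => f w 0 k)))//; last first.
  by move=> w Dw; rewrite (pd_coord _ _ sf Dw).
rewrite [RHS](eq_pd_on Do (g := dpart i (fun w => f w 0 k)))//; last first.
  by move=> w Dw; rewrite (pd_coord _ _ sf Dw).
exact: pd_comm Du.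
Qed.

End Analysis.

(** * Submanifolds of quadrics *)

Section ScalarProduct.
Variables (R : realType) (N : nat) (J : 'M[R]_N).
Implicit Types u v w : 'rV[R]_N.

Lemma ipDl u v w : ip J (u + v) w = ip J u w + ip J v w.
Proof. by rewrite /ip !mulmxDl mxE. Qed.

Lemma ipDr u v w : ip J u (v + w) = ip J u v + ip J u w.
Proof. by rewrite /ip linearD mulmxDr mxE. Qed.

Lemma ipZl a u v : ip J (a *: u) v = a * ip J u v.
Proof. by rewrite /ip -!scalemxAl mxE. Qed.

Lemma ipZr a u v : ip J u (a *: v) = a * ip J u v.
Proof. by rewrite /ip linearZ -scalemxAr mxE. Qed.

Lemma ip0l v : ip J 0 v = 0.
Proof. by rewrite -(scale0r 0) ipZl mul0r. Qed.

Lemma ip0r v : ip J v 0 = 0.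
Proof. by rewrite -(scale0r 0) ipZr mul0r. Qed.

Lemma ipNl u v : ip J (- u) v = - ip J u v.
Proof. by rewrite -scaleN1r ipZl mulN1r. Qed.

Lemma ipNr u v : ip J u (- v) = - ip J u v.
Proof. by rewrite -scaleN1r ipZr mulN1r. Qed.

Lemma ipBl u v w : ip J (u - v) w = ip J u w - ip J v w.
Proof. by rewrite ipDl ipNl. Qed.

Lemma ipBr u v w : ip J u (v - w) = ip J u v - ip J u w.
Proof. by rewrite ipDr ipNr. Qed.

Lemma ip_suml (I : Type) (s : seq I) (P : pred I) (F : I -> 'rV[R]_N) v :
  ip J (\sum_(i <- s | P i) F i) v = \sum_(i <- s | P i) ip J (F i) v.
Proof.
by elim/big_rec2: _ => [|i x y _ <-]; [exact: ip0l | rewrite ipDl].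
Qed.

Lemma ip_sumr (I : Type) (s : seq I) (P : pred I) (F : I -> 'rV[R]_N) v :
  ip J v (\sum_(i <- s | P i) F i) = \sum_(i <- s | P i) ip J v (F i).
Proof.
by elim/big_rec2: _ => [|i x y _ <-]; [exact: ip0r | rewrite ipDr].
Qed.

Lemma ipC u v : J^T = J -> ip J u v = ip J v u.
Proof.
move=> Js; rewrite /ip -[in LHS](trmxK (u *m J *m v^T)) [in LHS]mxE.
by rewrite !trmx_mul trmxK Js mulmxA.
Qed.

Lemma orth_rowsP (k : nat) (E : 'M[R]_(k, N)) w :
  (w *m J *m E^T = 0) <-> (forall i, ip J w (row i E) = 0).
Proof.
have e i : ip J w (row i E) = (w *m J *m E^T) 0 i.
  rewrite /ip !mxE; apply: eq_bigr => j _; congr (_ * _).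
  by rewrite !mxE.
split=> [h i|h]; first by rewrite e h mxE.
by apply/rowP => i; rewrite -e h mxE.
Qed.

Lemma nproj_uniq (k : nat) (E : 'M[R]_(k, N)) v w (c : 'rV[R]_k) :
  E *m J *m E^T \in unitmx -> w *m J *m E^T = 0 -> v = w + c *m E ->
  nproj J E v = w.
Proof.
move=> uE wE ->; rewrite /nproj.
have -> : (w + c *m E) *m J *m E^T = c *m (E *m J *m E^T).
  by rewrite !mulmxDl wE add0r -!mulmxA.
by rewrite mulmxK// addrK.
Qed.

Lemma nproj_orth (k : nat) (E : 'M[R]_(k, N)) v :
  E *m J *m E^T \in unitmx -> nproj J E v *m J *m E^T = 0.
Proof.
move=> uE; rewrite /nproj; set c := _ *m invmx _.
rewrite !mulmxBl -(mulmxA c) -(mulmxA c) /c mulmxKV ?subrr//.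
Qed.

Lemma nproj_def (k : nat) (E : 'M[R]_(k, N)) v :
  exists c : 'rV_k, v = nproj J E v + c *m E.
Proof.
by exists (v *m J *m E^T *m invmx (E *m J *m E^T)); rewrite /nproj subrK.
Qed.

Lemma nproj_id (k : nat) (E : 'M[R]_(k, N)) w :
  E *m J *m E^T \in unitmx -> w *m J *m E^T = 0 -> nproj J E w = w.
Proof. by move=> uE wE; apply: (@nproj_uniq _ _ _ _ 0) => //; rewrite mul0mx addr0. Qed.

Lemma nprojD (k : nat) (E : 'M[R]_(k, N)) v w :
  nproj J E (v + w) = nproj J E v + nproj J E w.
Proof. by rewrite /nproj !mulmxDl opprD addrACA. Qed.

Lemma nprojZ (k : nat) (E : 'M[R]_(k, N)) a v :
  nproj J E (a *: v) = a *: nproj J E v.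
Proof. by rewrite /nproj -!scalemxAl -scalerBr. Qed.

Lemma nproj_sum (k : nat) (E : 'M[R]_(k, N)) (n : nat) (F : 'I_n -> 'rV[R]_N) :
  nproj J E (\sum_i F i) = \sum_i nproj J E (F i).
Proof.
elim/big_rec2: _ => [|i x y _ <-]; last by rewrite nprojD.
by have := nprojZ E 0 0; rewrite !scale0r.
Qed.

Lemma nproj_row (k : nat) (E : 'M[R]_(k, N)) (c : 'rV_k) :
  E *m J *m E^T \in unitmx -> nproj J E (c *m E) = 0.
Proof.
by move=> uE; apply: (@nproj_uniq _ _ _ _ c); rewrite ?mul0mx ?add0r.
Qed.

Lemma gramE (k l : nat) (E : 'M[R]_(k, N)) (F : 'M[R]_(l, N)) i j :
  (E *m J *m F^T) i j = ip J (row i E) (row j F).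
Proof.
rewrite /ip -row_mul !mxE; apply: eq_bigr => a _.
by rewrite !mxE; congr (_ * _); apply: eq_bigr => n _; rewrite !mxE.
Qed.

End ScalarProduct.

(* Sealed copies of the tensors of Defs, for the same reason as [dpart]. *)
HB.lock Definition metric (R : realType) (m N : nat) (J : 'M[R]_N)
  (f : 'rV[R]_m -> 'rV[R]_N) (u : 'rV[R]_m) : 'M[R]_m := induced_metric J f u.

HB.lock Definition imetric (R : realType) (m N : nat) (J : 'M[R]_N)
  (f : 'rV[R]_m -> 'rV[R]_N) (u : 'rV[R]_m) : 'M[R]_m := invmx (induced_metric J f u).

HB.lock Definition gam (R : realType) (m N : nat) (J : 'M[R]_N)
  (f : 'rV[R]_m -> 'rV[R]_N) (k i j : 'I_m) (u : 'rV[R]_m) : R :=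
  christoffel (induced_metric J f) k i j u.

HB.lock Definition hsff (R : realType) (m N : nat) (J : 'M[R]_N)
  (f : 'rV[R]_m -> 'rV[R]_N) (i j : 'I_m) (u : 'rV[R]_m) : 'rV[R]_N := sff J f i j u.

Section Seals.
Variables (R : realType) (m N : nat) (J : 'M[R]_N) (f : 'rV[R]_m -> 'rV[R]_N).

Lemma induced_metricE : induced_metric J f = metric J f.
Proof. by rewrite metric.unlock. Qed.

Lemma imetricE u : invmx (metric J f u) = imetric J f u.
Proof. by rewrite metric.unlock imetric.unlock. Qed.

Lemma gamE : christoffel (metric J f) = gam J f.
Proof. by rewrite metric.unlock gam.unlock. Qed.

Lemma hsffE : sff J f = hsff J f.
Proof. by rewrite hsff.unlock. Qed.

End Seals.

(** * Levi-Civita connection of an immersion *)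

Section Immersed.
Variables (R : realType) (m N : nat) (J : 'M[R]_N) (D : set 'rV[R]_m).
Variable f : 'rV[R]_m -> 'rV[R]_N.
Hypotheses (Js : J^T = J) (Do : open D) (sf : smooth_on D f).
Local Notation G := (metric J f).
Hypothesis Gu : forall u, D u -> G u \in unitmx.
Local Notation d := (@dpart R m _).

Lemma metricE u i j : D u -> G u i j = ip J (d i f u) (d j f u).
Proof. by move=> Du; rewrite -induced_metricE /induced_metric gramE !(row_jacobian _ sf). Qed.

Lemma smooth_metric i j : smooth_on D (fun w => G w i j).
Proof.
apply: (eq_smooth_on Do (f := fun w => ip J (d i f w) (d j f w))).
  by move=> w Dw; rewrite metricE.
by apply: smooth_ip => //; exact: smooth_pd.
Qed.

Lemma metricC u i j : G u i j = G u j i.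
Proof. by rewrite -induced_metricE /induced_metric !gramE ipC. Qed.

Lemma trmx_metric u : (G u)^T = G u.
Proof. by apply/matrixP => i j; rewrite mxE metricC. Qed.

Lemma invmetricC u i j : imetric J f u i j = imetric J f u j i.
Proof. by rewrite -!imetricE -[in LHS](trmx_metric u) -trmx_inv mxE. Qed.

Lemma smooth_invmetric i j : smooth_on D (fun w => imetric J f w i j).
Proof.
apply: (eq_smooth_on Do (f := fun w => invmx (metric J f w) i j)) => [w _|].
  by rewrite imetricE.
by apply: smooth_invmx => // k l; exact: smooth_metric.
Qed.

Lemma metricK u i j : D u -> \sum_k imetric J f u i k * G u k j = (i == j)%:R.
Proof.
move=> Du; have := mulVmx (Gu Du); rewrite imetricE => /matrixP/(_ i j).
by rewrite !mxE.
Qed.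

Lemma metricVK u i j : D u -> \sum_k G u i k * imetric J f u k j = (i == j)%:R.
Proof.
move=> Du; have := mulmxV (Gu Du); rewrite imetricE => /matrixP/(_ i j).
by rewrite !mxE.
Qed.

Lemma pd_metric u k i j : D u ->
  d k (fun w => G w i j) u = ip J (d k (d i f) u) (d j f u) + ip J (d i f u) (d k (d j f) u).
Proof.
move=> Du; rewrite (eq_pd_on Do (g := fun w => ip J (d i f w) (d j f w)))//.
  by rewrite (pd_ip Do)//; exact: smooth_pd.
by move=> w Dw; rewrite metricE.
Qed.

Lemma pdC u i j : D u -> d i (d j f) u = d j (d i f) u.
Proof. by move=> Du; exact: (pd_comm_rV _ _ Do). Qed.

(** The three derivatives of the metric in the Koszul formula expand into six products. Since
    partial derivatives commute, four cancel and the other two agree. The symbols are thus the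
    tangential coefficients of the flat second derivatives. *)
Lemma christoffelE u k i j : D u ->
  gam J f k i j u = \sum_l imetric J f u k l * ip J (d i (d j f) u) (d l f u).
Proof.
move=> Du; rewrite -gamE /christoffel imetricE -dpartE mulr_sumr; apply: eq_bigr => l _.
rewrite !pd_metric// (pdC l j Du) (pdC l i Du) (pdC j i Du).
rewrite (ipC (d i f u)) // (ipC (d j f u) (d i (d l f) u))//.
by field.
Qed.

Lemma christoffelC u k i j : D u -> gam J f k i j u = gam J f k j i u.
Proof. by move=> Du; rewrite !christoffelE// pdC. Qed.

Lemma smooth_christoffel k i j : smooth_on D (gam J f k i j).
Proof.
apply: (eq_smooth_on Do (f := fun u =>
  \sum_l imetric J f u k l * ip J (d i (d j f) u) (d l f u))) => [w Dw|].
  by rewrite christoffelE.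
apply: (smooth_sum Do) => l _; apply: smooth_mul => //; first exact: smooth_invmetric.
by apply: smooth_ip => //; do ! apply: smooth_pd.
Qed.

Lemma tangent_coef u (c : 'I_m -> R) v : D u ->
  (forall l, ip J (v - \sum_k c k *: d k f u) (d l f u) = 0) ->
  forall k, \sum_l imetric J f u k l * ip J v (d l f u) = c k.
Proof.
move=> Du h k.
have h' l : ip J v (d l f u) = \sum_n c n * G u n l.
  have /eqP := h l; rewrite ipBl ip_suml subr_eq0 => /eqP ->.
  by apply: eq_bigr => n _; rewrite ipZl metricE.
under eq_bigr do rewrite h' mulr_sumr.
rewrite exchange_big/= (bigD1 k)//= [X in _ + X]big1 ?addr0.
  under eq_bigr do rewrite mulrCA metricC.
  by rewrite -mulr_sumr metricK// eqxx mulr1.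
move=> n nk; under eq_bigr do rewrite mulrCA metricC.
by rewrite -mulr_sumr metricK// eq_sym (negbTE nk) mulr0.
Qed.

Lemma christoffel_uniq u i j (c : 'I_m -> R) : D u ->
  (forall l, ip J (d i (d j f) u - \sum_k c k *: d k f u) (d l f u) = 0) ->
  forall k, gam J f k i j u = c k.
Proof. by move=> Du h k; rewrite christoffelE//; exact: tangent_coef. Qed.

Lemma christoffel_orth u i j l : D u ->
  ip J (d i (d j f) u - \sum_k gam J f k i j u *: d k f u) (d l f u) = 0.
Proof.
move=> Du; rewrite ipBl ip_suml.
under eq_bigr do rewrite ipZl christoffelE// mulr_suml.
rewrite exchange_big/= (bigD1 l)//= [X in _ - (_ + X)]big1 ?addr0.
  under eq_bigr do rewrite mulrAC -metricE// [_ * G u _ _]mulrC.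
  rewrite -mulr_suml; under eq_bigr do rewrite metricC.
  by rewrite metricVK// eqxx mul1r subrr.
move=> n nl; under eq_bigr do rewrite mulrAC -metricE// [_ * G u _ _]mulrC metricC.
by rewrite -mulr_suml metricVK// eq_sym (negbTE nl) mul0r.
Qed.

End Immersed.

(** The part of the flat second derivative orthogonal to the tangent space only. Unlike [sff] it
    retains the direction of the position vector, so it also makes sense for maps into the light
    cone, where that vector is null. *)
HB.lock Definition second_form (R : realType) (m N : nat) (J : 'M[R]_N)
  (f : 'rV[R]_m -> 'rV[R]_N) (i j : 'I_m) (u : 'rV[R]_m) : 'rV[R]_N :=
  dpart i (dpart j f) u - \sum_k gam J f k i j u *: dpart k f u.

(** * Gauss equation and Ricci curvature *)

Section Curvature.
Variables (R : realType) (m N : nat) (J : 'M[R]_N) (D : set 'rV[R]_m).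
Variable f : 'rV[R]_m -> 'rV[R]_N.
Hypotheses (Js : J^T = J) (Do : open D) (sf : smooth_on D f).
Local Notation G := (metric J f).
Hypothesis Gu : forall u, D u -> G u \in unitmx.
Local Notation d := (@dpart R m _).
Local Notation Gam := (gam J f).

Lemma second_formE i j u :
  second_form J f i j u = d i (d j f) u - \sum_k Gam k i j u *: d k f u.
Proof. by rewrite second_form.unlock. Qed.

Local Notation II := (second_form J f).

Lemma smooth_second_form i j : smooth_on D (II i j).
Proof.
apply: (eq_smooth_on Do (f := fun u => d i (d j f) u - \sum_k Gam k i j u *: d k f u)).
  by move=> w _; rewrite second_formE.
apply: smooth_add => //; first by do ! apply: smooth_pd.
apply: (eq_smooth_on Do (f := fun u => (-1) *: \sum_k Gam k i j u *: d k f u)).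
  by move=> w _; rewrite scaleN1r.
apply: smooth_scale => //; first exact: smooth_cst.
apply: smooth_sum => // k _; apply: smooth_scale => //; last exact: (smooth_pd k sf).
exact: smooth_christoffel.
Qed.

Lemma second_form_orth i j l u : D u -> ip J (II i j u) (d l f u) = 0.
Proof. by move=> Du; rewrite second_formE; apply: (christoffel_orth Js Do). Qed.

Lemma second_formC i j u : D u -> II i j u = II j i u.
Proof.
move=> Du; rewrite !second_formE (pdC Do sf i j)//; congr (_ - _).
by apply: eq_bigr => k _; rewrite (christoffelC Js Do).
Qed.

Lemma ip_second_form_dd i j k l u : D u ->
  ip J (II i j u) (d k (d l f) u) = ip J (II i j u) (II k l u).
Proof.
move=> Du; rewrite (second_formE k l) ipBr ip_sumr big1 ?subr0// => n _.
by rewrite ipZr second_form_orth// mulr0.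
Qed.

(** The Gauss formula [d_i d_j f = sum_l Gam^l_ij d_l f + II_ij] is differentiated once and its
    tangential part taken; [<d_k II_ij, d_n f> = - <II_ij, II_kn>]. In [gauss] the third derivatives
    cancel by symmetry and the products of second forms remain. *)
Lemma christoffel_third q k i j u : D u ->
  d k (Gam q i j) u + \sum_l Gam q k l u * Gam l i j u =
  (\sum_n imetric J f u q n * ip J (d k (d i (d j f)) u) (d n f u))
  + \sum_n imetric J f u q n * ip J (II i j u) (II k n u).
Proof.
move=> Du.
have sG l : smooth_on D (Gam l i j) by exact: smooth_christoffel.
have sdf l : smooth_on D (d l f) by exact: smooth_pd.
have sII := smooth_second_form i j.
have -> : d k (d i (d j f)) u = \sum_l (d k (Gam l i j) u *: d l f u)
    + \sum_l (Gam l i j u *: d k (d l f) u) + d k (II i j) u.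
  rewrite (eq_pd_on Do (g := fun w => (\sum_l Gam l i j w *: d l f w) + II i j w))//.
    have sGd l : smooth_on D (fun w => Gam l i j w *: d l f w).
      by apply: smooth_scale.
    rewrite (pd_add k (smooth_sum Do _ (fun l _ => sGd l)) sII Du); congr (_ + _).
    rewrite (pd_sum Do _ k (fun l _ => sGd l) Du) -big_split/=.
    by apply: eq_bigr => l _; rewrite (pd_scale Do k (sG l) (sdf l) Du).
  by move=> w Dw; rewrite !second_formE addrC subrK.
under [in RHS]eq_bigr do rewrite !ipDl !mulrDr.
rewrite !big_split/=; rewrite -!addrA; congr (_ + _).
  under [RHS]eq_bigr do rewrite ip_suml mulr_sumr.
  rewrite exchange_big/= (bigD1 q)//= [X in _ + X]big1 ?addr0.
    under eq_bigr do rewrite ipZl mulrCA -(metricE J sf)// (metricC f Js).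
    by rewrite -mulr_sumr (metricK Gu)// eqxx mulr1.
  move=> n nq; under eq_bigr do rewrite ipZl mulrCA -(metricE J sf)// (metricC f Js).
  by rewrite -mulr_sumr (metricK Gu)// eq_sym (negbTE nq) mulr0.
rewrite -[LHS]addr0; congr (_ + _).
  under [RHS]eq_bigr do rewrite ip_suml mulr_sumr.
  rewrite exchange_big/=; apply: eq_bigr => l _.
  rewrite (christoffelE Js Do)// mulr_suml; apply: eq_bigr => n _.
  by rewrite ipZl; ring.
rewrite -big_split/= big1// => n _; rewrite -mulrDr -ip_second_form_dd//.
rewrite -(pd_ip Do J k sII (sdf n) Du).
rewrite (eq_pd_on Do (g := fun=> 0))// ?pd_cst ?mulr0// => w Dw.
exact: second_form_orth.
Qed.

Lemma gauss q k i j u : D u ->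
  d k (Gam q i j) u - d j (Gam q i k) u
   + \sum_l (Gam q k l u * Gam l i j u - Gam q j l u * Gam l i k u) =
  \sum_n imetric J f u q n * (ip J (II i j u) (II k n u) - ip J (II i k u) (II j n u)).
Proof.
move=> Du; rewrite sumrB addrACA -opprD !christoffel_third//.
have -> : d j (d i (d k f)) u = d k (d i (d j f)) u.
  have sd := smooth_pd.
  rewrite (eq_pd_on Do (g := d k (d i f)))//; last by move=> w Dw; exact: (pdC Do sf).
  rewrite (pdC Do (smooth_pd i sf) j k Du).
  by apply: (eq_pd_on Do) => // w Dw; exact: (pdC Do sf).
rewrite opprD addrACA subrr add0r -sumrB.
by apply: eq_bigr => n _; rewrite mulrBr.
Qed.

Lemma ricciE i j u : D u ->
  ricci (induced_metric J f) i j u = \sum_k \sum_n imetric J f u k n *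
    (ip J (II i j u) (II k n u) - ip J (II i k u) (II j n u)).
Proof. by move=> Du; rewrite induced_metricE /ricci gamE -!dpartE; apply: eq_bigr => k _; exact: gauss. Qed.

End Curvature.

(** * Second fundamental form and scalar curvature in a quadric *)

Section Quadric.
Variables (R : realType) (m N : nat) (J : 'M[R]_N) (D : set 'rV[R]_m).
Variables (f : 'rV[R]_m -> 'rV[R]_N) (eps : R).
Hypotheses (Js : J^T = J) (Do : open D) (sf : smooth_on D f).
Hypotheses (eps0 : eps != 0) (feps : forall u, D u -> ip J (f u) (f u) = eps).
Local Notation G := (metric J f).
Hypothesis Gu : forall u, D u -> G u \in unitmx.
Local Notation d := (@dpart R m _).
Local Notation Gam := (gam J f).
Local Notation II := (second_form J f).
Local Notation h := (hsff J f).

Lemma quadric_ip_d i u : D u -> ip J (f u) (d i f u) = 0.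
Proof.
move=> Du; have := pd_ip Do J i sf sf Du.
rewrite (eq_pd_on Do (g := fun=> eps))// pd_cst ipC// -mulr2n => /eqP.
by rewrite eq_sym mulrn_eq0 => /eqP.
Qed.

Lemma quadric_ip_dd i j u : D u -> ip J (f u) (d i (d j f) u) = - G u i j.
Proof.
move=> Du; have := pd_ip Do J i sf (smooth_pd j sf) Du.
rewrite (eq_pd_on Do (g := fun=> 0)) ?pd_cst//; last first.
  by move=> w Dw; exact: quadric_ip_d.
by rewrite -(metricE J sf)// => /esym/eqP; rewrite addrC addr_eq0 => /eqP.
Qed.

Lemma quadric_frame_orthP u (w : 'rV[R]_N) : D u ->
  (w *m J *m (quadric_frame f u)^T = 0) <->
  (ip J w (f u) = 0 /\ forall l, ip J w (d l f u) = 0).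
Proof.
move=> Du; rewrite orth_rowsP; split=> [h|[h1 h2] i].
  split=> [|l].
    by have := h (lshift _ 0); rewrite rowKu -[X in row X _]/0 row_id.
  by have := h (rshift _ l); rewrite rowKd (row_jacobian _ sf).
case: (split_ordP i) => k ->; first by rewrite rowKu (ord1 k) row_id.
by rewrite rowKd (row_jacobian _ sf).
Qed.

Lemma quadric_frame_unit u : D u ->
  quadric_frame f u *m J *m (quadric_frame f u)^T \in unitmx.
Proof.
move=> Du.
have -> : quadric_frame f u *m J *m (quadric_frame f u)^T =
    block_mx (eps%:M : 'M[R]_1) 0 0 (induced_metric J f u).
  rewrite /quadric_frame tr_col_mx mul_col_mx mul_col_row; congr block_mx.
  - by apply/matrixP => i j; rewrite gramE !ord1 !row_id feps// mxE.
  - apply/matrixP => i j; rewrite gramE (ord1 i) row_id (row_jacobian _ sf)// mxE.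
    exact: quadric_ip_d.
  - apply/matrixP => i j; rewrite gramE (ord1 j) row_id (row_jacobian _ sf)// mxE.
    by rewrite ipC// quadric_ip_d.
rewrite unitmxE det_ublock unitrM -!unitmxE induced_metricE Gu// andbT.
by rewrite unitmxE det_scalar1 unitfE.
Qed.

Lemma sum_row_jacobian u (c : 'I_m -> R) : D u ->
  \sum_k c k *: d k f u = (\row_k c k) *m jacobian f u.
Proof.
move=> Du; rewrite mulmx_sum_row; apply: eq_bigr => k _.
by rewrite mxE (row_jacobian _ sf).
Qed.

Lemma second_form_quadric i j u : D u -> ip J (II i j u) (f u) = - G u i j.
Proof.
move=> Du; rewrite second_formE ipBl ip_suml big1 ?subr0.
  by rewrite ipC// quadric_ip_dd.
by move=> k _; rewrite ipZl ipC// quadric_ip_d// mulr0.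
Qed.

(** Differentiating [<f, d_j f> = 0] gives [<II_ij, f> = - G_ij]; since [<f, f> = eps], removing the
    position component of [II] adds [(G_ij / eps) f]. *)
Lemma sffE i j u : D u -> h i j u = II i j u + (G u i j / eps) *: f u.
Proof.
move=> Du; rewrite -hsffE /sff -!dpartE.
apply: (nproj_uniq (c := row_mx (- (G u i j / eps))%:M (\row_k Gam k i j u))).
- exact: quadric_frame_unit.
- apply/quadric_frame_orthP => //; split=> [|l].
    by rewrite ipDl second_form_quadric// ipZl feps// divfK// addNr.
  by rewrite ipDl (second_form_orth Js Do)// ipZl quadric_ip_d// mulr0 addr0.
- rewrite /quadric_frame mul_row_col mul_scalar_mx -sum_row_jacobian//.
  by rewrite !second_formE scaleNr addrA addrK subrK.
Qed.

Lemma sff_orth_pos i j u : D u -> ip J (h i j u) (f u) = 0.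
Proof.
move=> Du; rewrite sffE// ipDl second_form_quadric// ipZl feps// divfK//.
by rewrite addNr.
Qed.

Lemma sff_orth_d i j l u : D u -> ip J (h i j u) (d l f u) = 0.
Proof.
by move=> Du; rewrite sffE// ipDl (second_form_orth Js Do)// ipZl quadric_ip_d// mulr0 addr0.
Qed.

Lemma sffC i j u : D u -> h i j u = h j i u.
Proof. by move=> Du; rewrite !sffE// (second_formC Js Do sf)// (metricC f Js). Qed.

Lemma smooth_sff i j : smooth_on D (h i j).
Proof.
apply: (eq_smooth_on Do (f := fun u => II i j u + (eps^-1 * G u i j) *: f u)) => [w Dw|].
  by rewrite sffE// mulrC.
apply: smooth_add => //; first exact: smooth_second_form.
apply: smooth_scale => //; apply: smooth_mul => //; first exact: smooth_cst.
exact: smooth_metric.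
Qed.

Lemma ip_second_form i j k l u : D u ->
  ip J (II i j u) (II k l u) = ip J (h i j u) (h k l u) + G u i j * G u k l / eps.
Proof.
move=> Du.
have IIE i' j' : II i' j' u = h i' j' u - (G u i' j' / eps) *: f u by rewrite sffE// addrK.
rewrite !IIE ipBl !ipBr !ipZl !ipZr sff_orth_pos// (ipC (f u))// sff_orth_pos// feps//.
by field.
Qed.

Lemma trace_metric u : D u -> \sum_i \sum_j imetric J f u i j * G u i j = m%:R.
Proof.
move=> Du; rewrite -[m in RHS]card_ord -sumr_const; apply: eq_bigr => i _.
by under eq_bigr do rewrite (metricC f Js); rewrite (metricK Gu)// eqxx.
Qed.

(** The Gauss equation traced twice. Replacing [II] by [h] adds [m^2 / eps] to the squared trace and
    [m / eps] to the squared norm, and the trace of [h] is zero. *)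
Lemma scalar_curvature_minimal u : D u ->
  \sum_i \sum_j imetric J f u i j *: h i j u = 0 ->
  scalar_curvature (induced_metric J f) u = m%:R * (m%:R - 1) / eps - sff_norm2 J f u.
Proof.
move=> Du h0; set gi := imetric J f u.
have -> : scalar_curvature (induced_metric J f) u =
   (\sum_i \sum_j gi i j * (\sum_k \sum_n gi k n * ip J (II i j u) (II k n u)))
   - \sum_i \sum_j gi i j * (\sum_k \sum_n gi k n * ip J (II i k u) (II j n u)).
  rewrite /scalar_curvature induced_metricE imetricE -/gi -induced_metricE -sumrB; apply: eq_bigr => i _.
  rewrite -sumrB; apply: eq_bigr => j _; rewrite (ricciE Js Do)// -mulrBr.
  congr (_ * _); rewrite -sumrB; apply: eq_bigr => k _.
  by rewrite -sumrB; apply: eq_bigr => n _; rewrite mulrBr.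
have e1 i j : \sum_k \sum_n gi k n * ip J (II i j u) (II k n u) = G u i j * (m%:R / eps).
  transitivity (ip J (h i j u) (\sum_k \sum_n gi k n *: h k n u) + G u i j * (m%:R / eps)).
    rewrite ip_sumr -(trace_metric Du) mulr_suml mulr_sumr -big_split/=.
    apply: eq_bigr => k _; rewrite ip_sumr mulr_suml mulr_sumr -big_split/=.
    by apply: eq_bigr => n _; rewrite ipZr ip_second_form//; ring.
  by rewrite h0 ip0r add0r.
have e2 : \sum_i \sum_j gi i j * (\sum_k \sum_n gi k n * ip J (II i j u) (II k n u)) =
    m%:R * (m%:R / eps).
  rewrite -[X in X * _](trace_metric Du) mulr_suml; apply: eq_bigr => i _.
  by rewrite mulr_suml; apply: eq_bigr => j _; rewrite e1 mulrA.
have e3 : \sum_i \sum_j gi i j * (\sum_k \sum_n gi k n * ip J (II i k u) (II j n u)) =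
    sff_norm2 J f u + m%:R / eps.
  rewrite /sff_norm2 induced_metricE imetricE hsffE -/gi -(trace_metric Du) mulr_suml -big_split/=.
  apply: eq_bigr => i _; rewrite [in X in _ + X]mulr_suml.
  transitivity (\sum_j \sum_k \sum_n gi i j * gi k n * ip J (II i k u) (II j n u)).
    apply: eq_bigr => j _; rewrite mulr_sumr; apply: eq_bigr => k _.
    by rewrite mulr_sumr; apply: eq_bigr => n _; rewrite mulrA.
  transitivity (\sum_j \sum_k (\sum_n gi i j * gi k n * ip J (h i k u) (h j n u)
       + gi i j * (k == j)%:R * G u i k / eps)).
    apply: eq_bigr => j _; apply: eq_bigr => k _.
    rewrite -(metricK Gu k j Du) mulr_sumr !mulr_suml -big_split/=.
    apply: eq_bigr => n _; rewrite ip_second_form// (metricC f Js u j n) /gi; ring.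
  under [LHS]eq_bigr do rewrite big_split/=.
  rewrite big_split/=; congr (_ + _); first by rewrite exchange_big.
  apply: eq_bigr => j _; rewrite (bigD1 j)//= eqxx mulr1 big1 ?addr0//.
  by move=> k /negbTE ->; rewrite mulr0 !mul0r.
by rewrite e2 e3; ring.
Qed.

End Quadric.

(** * Products and conformal changes *)

Section TracelessNorm.
Variables (R : realType) (m N : nat) (J : 'M[R]_N) (gi : 'M[R]_m).

Definition tnorm2 (T : 'I_m -> 'I_m -> 'rV[R]_N) : R :=
  \sum_i \sum_j \sum_k \sum_l gi i k * gi j l * ip J (T i j) (T k l).

Definition ttrace (T : 'I_m -> 'I_m -> 'rV[R]_N) : 'rV[R]_N :=
  \sum_i \sum_j gi i j *: T i j.

(* The squared norm of [T - (tr T / m) g]. *)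
Definition tracefree2 T : R := tnorm2 T - m%:R^-1 * ip J (ttrace T) (ttrace T).

Hypotheses (Js : J^T = J) (m0 : (0 < m)%N).
Variable g : 'M[R]_m.
Hypotheses (gs : forall i j, g i j = g j i) (gis : forall i j, gi i j = gi j i).
Hypothesis gK : forall i j, \sum_k gi i k * g k j = (i == j)%:R.

Lemma trace_gi : \sum_i \sum_j gi i j * g i j = m%:R.
Proof.
rewrite -[m in RHS]card_ord -sumr_const; apply: eq_bigr => i _.
by under eq_bigr do rewrite gs; rewrite gK eqxx.
Qed.

Lemma contract_gi (c : 'I_m -> 'I_m -> R) :
  \sum_i \sum_j \sum_k \sum_l gi i k * gi j l * (g i j * c k l) =
  \sum_i \sum_j gi i j * c i j.
Proof.
transitivity (\sum_k \sum_l \sum_j (\sum_i gi k i * g i j) * (gi j l * c k l)).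
  transitivity (\sum_i \sum_k \sum_j \sum_l gi i k * gi j l * (g i j * c k l)).
    by apply: eq_bigr => i _; rewrite exchange_big.
  rewrite exchange_big/=; apply: eq_bigr => k _.
  rewrite exchange_big/=.
  under eq_bigr do rewrite exchange_big/=.
  rewrite exchange_big/=; apply: eq_bigr => l _; apply: eq_bigr => j _.
  rewrite mulr_suml; apply: eq_bigr => i _; rewrite (gis i k); ring.
apply: eq_bigr => k _; apply: eq_bigr => l _.
rewrite (bigD1 k)//= gK eqxx mul1r big1 ?addr0// => j jk.
by rewrite gK eq_sym (negbTE jk) mul0r.
Qed.

Lemma swap_sum4 (F : 'I_m -> 'I_m -> 'I_m -> 'I_m -> R) :
  \sum_i \sum_j \sum_k \sum_l F i j k l = \sum_k \sum_l \sum_i \sum_j F i j k l.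
Proof.
transitivity (\sum_i \sum_k \sum_j \sum_l F i j k l).
  by apply: eq_bigr => i _; rewrite exchange_big.
rewrite exchange_big/=; apply: eq_bigr => k _; rewrite [RHS]exchange_big/=.
by apply: eq_bigr => i _; rewrite exchange_big.
Qed.

Lemma contract_gi2 (c : 'I_m -> 'I_m -> R) :
  \sum_i \sum_j \sum_k \sum_l gi i k * gi j l * (g k l * c i j) =
  \sum_i \sum_j gi i j * c i j.
Proof.
rewrite swap_sum4 -contract_gi; apply: eq_bigr => k _; apply: eq_bigr => l _.
by apply: eq_bigr => i _; apply: eq_bigr => j _; rewrite (gis i k) (gis j l).
Qed.

Lemma tnorm2_split (S T : 'I_m -> 'I_m -> 'rV[R]_N) (c : 'I_m -> 'I_m -> 'I_m -> 'I_m -> R) :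
  (forall i j k l, ip J (T i j) (T k l) = ip J (S i j) (S k l) + c i j k l) ->
  tnorm2 T = tnorm2 S + \sum_i \sum_j \sum_k \sum_l gi i k * gi j l * c i j k l.
Proof.
move=> h; rewrite /tnorm2 -big_split; apply: eq_bigr => i _.
rewrite -big_split; apply: eq_bigr => j _; rewrite -big_split; apply: eq_bigr => k _.
by rewrite -big_split; apply: eq_bigr => l _; rewrite h mulrDr.
Qed.

Lemma ttraceD S T : ttrace (fun i j => S i j + T i j) = ttrace S + ttrace T.
Proof.
rewrite /ttrace -big_split; apply: eq_bigr => i _.
by rewrite -big_split; apply: eq_bigr => j _; rewrite scalerDr.
Qed.

Lemma ttraceZ a S : ttrace (fun i j => a *: S i j) = a *: ttrace S.
Proof.
rewrite /ttrace scaler_sumr; apply: eq_bigr => i _.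
by rewrite scaler_sumr; apply: eq_bigr => j _; rewrite !scalerA mulrC.
Qed.

Lemma ttrace_tensor (c : 'I_m -> 'I_m -> R) v :
  ttrace (fun i j => c i j *: v) = (\sum_i \sum_j gi i j * c i j) *: v.
Proof.
rewrite /ttrace scaler_suml; apply: eq_bigr => i _.
by rewrite scaler_suml; apply: eq_bigr => j _; rewrite scalerA.
Qed.

(** The algebra behind conformal invariance. The term [g w] is pure trace. For the null vector [y],
    the relation [<S, y> = - g] makes [a y] contribute [- 2 p tr a] to the squared norm and the same
    amount to the squared trace over [m], so both cancel. *)
Lemma tracefree2_shift S (a : 'I_m -> 'I_m -> R) (w y : 'rV[R]_N) (p : R) :
  (forall i j, a i j = a j i) ->
  (forall i j, ip J (S i j) y = - g i j) -> ip J y y = 0 ->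
  (forall i j, ip J (S i j) w = 0) -> ip J w y = 0 ->
  tracefree2 (fun i j => p *: S i j + (g i j *: w + a i j *: y)) = p ^+ 2 * tracefree2 S.
Proof.
move=> asym Sy yy Sw wy; set T := fun i j => _.
have mR : (m%:R : R) != 0 by rewrite pnatr_eq0 -lt0n.
set ta := \sum_i \sum_j gi i j * a i j.
have yS i j : ip J y (S i j) = - g i j by rewrite ipC.
have wS i j : ip J w (S i j) = 0 by rewrite ipC.
have yw : ip J y w = 0 by rewrite ipC.
have eT : tnorm2 T = p ^+ 2 * tnorm2 S + (m%:R * ip J w w - 2 * p * ta).
  rewrite (@tnorm2_split (fun i j => p *: S i j) T (fun i j k l =>
    g i j * (ip J w w * g k l) + (g i j * (- p * a k l) + (g k l * (- p * a i j))))).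
    congr (_ + _).
      rewrite /tnorm2 mulr_sumr; apply: eq_bigr => i _.
      rewrite mulr_sumr; apply: eq_bigr => j _; rewrite mulr_sumr; apply: eq_bigr => k _.
      by rewrite mulr_sumr; apply: eq_bigr => l _; rewrite ipZl ipZr; ring.
    transitivity (\sum_i \sum_j \sum_k \sum_l gi i k * gi j l * (g i j * (ip J w w * g k l))
      + (\sum_i \sum_j \sum_k \sum_l gi i k * gi j l * (g i j * (- p * a k l))
      + \sum_i \sum_j \sum_k \sum_l gi i k * gi j l * (g k l * (- p * a i j)))).
      rewrite -!big_split; apply: eq_bigr => i _; rewrite -!big_split; apply: eq_bigr => j _.
      rewrite -!big_split; apply: eq_bigr => k _; rewrite -!big_split; apply: eq_bigr => l _.
      by rewrite /= !mulrDr.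
    rewrite !contract_gi contract_gi2.
    have -> : \sum_i \sum_j gi i j * (ip J w w * g i j) = m%:R * ip J w w.
      rewrite -trace_gi mulr_suml; apply: eq_bigr => i _; rewrite mulr_suml.
      by apply: eq_bigr => j _; ring.
    have -> : \sum_i \sum_j gi i j * (- p * a i j) = - p * ta.
      rewrite mulr_sumr; apply: eq_bigr => i _; rewrite mulr_sumr.
      by apply: eq_bigr => j _; ring.
    by ring.
  move=> i j k l; rewrite /T !(ipDl, ipDr, ipZl, ipZr) !Sy !Sw wy yy !yS !wS yw.
  by ring.
have etr : ttrace T = p *: ttrace S + (m%:R *: w + ta *: y).
  rewrite /T ttraceD ttraceZ; congr (_ + _).
  by rewrite ttraceD !ttrace_tensor trace_gi.
have tw : ip J (ttrace S) w = 0.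
  rewrite ip_suml big1// => i _; rewrite ip_suml big1// => j _.
  by rewrite ipZl Sw mulr0.
have ty : ip J (ttrace S) y = - m%:R.
  rewrite -trace_gi -sumrN ip_suml; apply: eq_bigr => i _.
  rewrite -sumrN ip_suml; apply: eq_bigr => j _.
  by rewrite ipZl Sy mulrN.
have wt : ip J w (ttrace S) = 0 by rewrite ipC.
have yt : ip J y (ttrace S) = - m%:R by rewrite ipC.
rewrite /tracefree2 eT etr !(ipDl, ipDr, ipZl, ipZr) tw ty wy yy wt yt yw.
by field.
Qed.

End TracelessNorm.

Lemma tracefree2_scale (R : realType) (m N : nat) (J : 'M[R]_N) (gi : 'M[R]_m)
    (c : R) (T : 'I_m -> 'I_m -> 'rV[R]_N) :
  tracefree2 J (c *: gi) T = c ^+ 2 * tracefree2 J gi T.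
Proof.
rewrite /tracefree2 mulrBr; congr (_ - _).
  rewrite /tnorm2 mulr_sumr; apply: eq_bigr => i _; rewrite mulr_sumr; apply: eq_bigr => j _.
  rewrite mulr_sumr; apply: eq_bigr => k _; rewrite mulr_sumr; apply: eq_bigr => l _.
  by rewrite !mxE; ring.
have -> : ttrace (c *: gi) T = c *: ttrace gi T.
  rewrite /ttrace scaler_sumr; apply: eq_bigr => i _; rewrite scaler_sumr.
  by apply: eq_bigr => j _; rewrite mxE scalerA.
by rewrite ipZl ipZr; ring.
Qed.


(** * Composition with linear maps of the coordinates *)

Section LinearPullback.
Variables (R : realType) (m n : nat) (D : set 'rV[R]_m) (D' : set 'rV[R]_n).
Variable P : 'M[R]_(m, n).
Hypotheses (Do : open D) (Do' : open D') (DP : forall u, D u -> D' (u *m P)).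

Lemma differentiable_pullback (V : normedModType R) (F : 'rV[R]_n -> V) u :
  differentiable F (u *m P) -> differentiable (fun w => F (w *m P)) u.
Proof.
move=> dF; apply: (@differentiable_comp _ _ _ _ (fun w => w *m P) F) => //.
apply: differentiable_rowP => j.
have : smooth_on setT (fun w : 'rV[R]_m => w *m P).
  apply: (smooth_mulmxr openT) => s v _.
  have h0 k : Cn setT k (@idfun 'rV[R]_m).
    case: k => [|k]; split=> // i.
    apply: (@eq_Cn _ _ _ openT _ k (fun=> delta_mx 0 i)); last exact: Cn_cst openT _ _ _.
    by move=> w _; rewrite dpartE /pd derive_id.
  by have /smooth_CnP := h0; apply.
by move=> sP; exact: (smooth_diff (smooth_coord openT j sP)).
Qed.

Lemma pd_pullback (V : normedModType R) (F : 'rV[R]_n -> V) j u :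
  differentiable F (u *m P) ->
  dpart j (fun w => F (w *m P)) u = \sum_i P j i *: dpart i F (u *m P).
Proof.
move=> dF.
have e : dpart j (fun w => F (w *m P)) u = 'd F (u *m P) (delta_mx 0 j *m P).
  rewrite dpartE /pd -deriveE// /derive.
  set A := fun h : R => _; set B := fun h : R => _.
  by have -> : A = B by apply/funext => h; rewrite /A /B /= mulmxDl -scalemxAl.
rewrite e diff_sum_pd//; apply: eq_bigr => i _.
by rewrite -rowE mxE.
Qed.

Lemma smooth_pullback_scal (F : 'rV[R]_n -> R) :
  smooth_on D' F -> smooth_on D (fun w => F (w *m P)).
Proof.
move=> /smooth_CnP cF; apply/smooth_CnP => k.
elim: k F cF => [|k IH] F cF.
  by split=> // u Du; apply: differentiable_pullback => //; exact: Cn_diff (cF 0%N) (DP Du).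
split=> [u Du|j].
  by apply: differentiable_pullback => //; exact: Cn_diff (cF 0%N) (DP Du).
apply: (eq_Cn Do (f := fun u => \sum_i P j i * dpart i F (u *m P))).
  by move=> w Dw; rewrite pd_pullback//; exact: Cn_diff (cF 0%N) (DP Dw).
have cs : forall s : seq 'I_n, Cn D k (fun u => \sum_(i <- s) P j i * dpart i F (u *m P)).
  elim=> [|i s IHs].
    apply: (eq_Cn Do (f := fun=> 0)); last exact: Cn_cst.
    by move=> w _; rewrite big_nil.
  apply: (eq_Cn Do (f := fun u => P j i * dpart i F (u *m P) +
    \sum_(i <- s) P j i * dpart i F (u *m P))).
    by move=> w _; rewrite big_cons.
  apply: Cn_add => //; apply: Cn_mul => //; first exact: Cn_cst.
  by apply: IH => l; have [_] := cF l.+1; apply.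
exact: cs.
Qed.

Lemma smooth_pullback (N : nat) (F : 'rV[R]_n -> 'rV[R]_N) :
  smooth_on D' F -> smooth_on D (fun w => F (w *m P)).
Proof.
move=> sF; apply/(smooth_rowP Do) => j.
by apply: (smooth_pullback_scal (F := fun w => F w 0 j)); exact: smooth_coord.
Qed.

End LinearPullback.

(** * Orthogonal sums of three maps depending on separate coordinates *)

Section Product.
Variables (R : realType) (m N : nat) (J : 'M[R]_N) (D : set 'rV[R]_m).
Variables (Y : 'rV[R]_m -> 'rV[R]_N) (Yc : 'I_3 -> 'rV[R]_m -> 'rV[R]_N).
Variables (blk : 'I_m -> 'I_3) (kap : 'I_3 -> R).
Hypotheses (Js : J^T = J) (Do : open D) (sY : smooth_on D Y).
Hypothesis sYc : forall a, smooth_on D (Yc a).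
Local Notation d := (@dpart R m _).
Hypothesis YE : forall u, D u -> Y u = \sum_a Yc a u.
Hypothesis dYc0 : forall i a u, D u -> blk i != a -> d i (Yc a) u = 0.
Hypothesis kap0 : forall a, kap a != 0.
Hypothesis ipYc : forall a b u, D u ->
  ip J (Yc a u) (Yc b u) = (a == b)%:R / kap a.
Local Notation G := (metric J Y).
Local Notation Gi := (imetric J Y).
Hypothesis Gu : forall u, D u -> G u \in unitmx.
Local Notation Gam := (gam J Y).
Local Notation II := (second_form J Y).

Lemma pd_total i u : D u -> d i Y u = d i (Yc (blk i)) u.
Proof.
move=> Du; rewrite (eq_pd_on Do (g := fun w => \sum_a Yc a w))//.
rewrite (pd_sum Do _ _ (fun a _ => sYc a) Du) (bigD1 (blk i))//= big1 ?addr0//.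
by move=> a ai; rewrite dYc0// eq_sym.
Qed.

Lemma ip_pd_part i a b u : D u -> ip J (d i (Yc a) u) (Yc b u) = 0.
Proof.
move=> Du; have [bi|bi] := eqVneq (blk i) a; last by rewrite dYc0// ip0l.
have := pd_ip Do J i (sYc a) (sYc b) Du.
rewrite (eq_pd_on Do (g := fun=> (a == b)%:R / kap a))//; last by move=> w Dw; exact: ipYc.
rewrite pd_cst; have [ab|ab] := eqVneq a b.
  rewrite -ab (ipC (Yc a u))// -mulr2n => /eqP.
  by rewrite eq_sym mulrn_eq0 => /eqP.
by rewrite (dYc0 Du (a := b)) ?bi// ip0r addr0 => <-.
Qed.

Lemma ddYc0 i j a u : D u -> (blk i != a) || (blk j != a) -> d i (d j (Yc a)) u = 0.
Proof.
move=> Du /orP[ia|ja].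
  rewrite (pdC Do (sYc a))// (eq_pd_on Do (g := fun=> 0)) ?pd_cst// => w Dw.
  exact: dYc0.
by rewrite (eq_pd_on Do (g := fun=> 0)) ?pd_cst// => w Dw; exact: dYc0.
Qed.

Lemma ip_pd_pd i j a b u : D u -> a != b -> ip J (d i (Yc a) u) (d j (Yc b) u) = 0.
Proof.
move=> Du ab; have [jb|jb] := eqVneq (blk j) b; last by rewrite (dYc0 Du jb) ip0r.
have := pd_ip Do J j (smooth_pd i (sYc a)) (sYc b) Du.
rewrite (eq_pd_on Do (g := fun=> 0)) ?pd_cst//; last by move=> w Dw; exact: ip_pd_part.
by rewrite ddYc0 ?ip0l ?add0r// jb eq_sym ab.
Qed.

Lemma metric_total i j u : D u -> G u i j = ip J (d i (Yc (blk i)) u) (d j (Yc (blk j)) u).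
Proof. by move=> Du; rewrite (metricE J sY)// !pd_total. Qed.

Lemma metric_off i j u : D u -> blk i != blk j -> G u i j = 0.
Proof. by move=> Du ij; rewrite metric_total// ip_pd_pd. Qed.

(** By uniqueness of inverses: the inverse metric with its off-diagonal blocks set to zero is still
    a left inverse of the block-diagonal metric. *)
Lemma imetric_off i j u : D u -> blk i != blk j -> Gi u i j = 0.
Proof.
move=> Du.
have <- : (\matrix_(k, l) if blk k == blk l then Gi u k l else 0) = Gi u.
  rewrite -imetricE; apply: (can_inj (mulmxK (Gu Du))); rewrite mulVmx ?Gu// imetricE.
  apply/matrixP => k l; rewrite !mxE.
  have [kl|kl] := eqVneq (blk k) (blk l).
    rewrite -(metricK Gu k l Du); apply: eq_bigr => n _; rewrite mxE.
    by case: ifPn => // kn; rewrite metric_off ?mulr0// -kl eq_sym.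
  rewrite [in RHS](_ : (k == l) = false); last first.
    by apply/negbTE; apply: contraNneq kl => ->.
  rewrite big1// => n _; rewrite mxE; case: ifP => [/eqP kn|]; last by rewrite mul0r.
  by rewrite metric_off ?mulr0// -kn.
by rewrite mxE => /negbTE ->.
Qed.

Lemma pd_pd_total i j u : D u -> d i (d j Y) u = d i (d j (Yc (blk j))) u.
Proof. by move=> Du; rewrite (eq_pd_on Do (g := d j (Yc (blk j))))// => w Dw; exact: pd_total. Qed.

Lemma pd_pd_off i j u : D u -> blk i != blk j -> d i (d j Y) u = 0.
Proof. by move=> Du ij; rewrite pd_pd_total// ddYc0// ij. Qed.

Lemma ip_pd_pd_d i j l u : D u -> blk j != blk l ->
  ip J (d i (d j Y) u) (d l Y u) = 0.
Proof.
move=> Du jl; have [ij|ij] := eqVneq (blk i) (blk j); last first.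
  by rewrite pd_pd_off// ip0l.
rewrite pd_pd_total// pd_total//.
have := pd_ip Do J i (smooth_pd j (sYc (blk j))) (smooth_pd l (sYc (blk l))) Du.
rewrite (eq_pd_on Do (g := fun=> 0)) ?pd_cst//; last first.
  by move=> w Dw; exact: ip_pd_pd.
by rewrite (ddYc0 (i := i) (j := l)) ?ip0r ?addr0// ij jl.
Qed.

Lemma gam_off k i j u : D u -> (blk i != blk j) || (blk k != blk j) -> Gam k i j u = 0.
Proof.
move=> Du h; rewrite (christoffelE Js Do)// big1// => l _.
have [jl|jl] := eqVneq (blk j) (blk l); last by rewrite ip_pd_pd_d ?mulr0.
case/orP: h => h; first by rewrite pd_pd_off// ip0l mulr0.
by rewrite imetric_off ?mul0r// -jl.
Qed.

(** Removes from [II] its component along [Yc (blk i)], whose squared norm is [1 / kap]. On indices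
    of one factor this is the second fundamental form of that factor in its quadric (see
    [block_form_factor]); on mixed indices it vanishes. *)
Definition block_form i j u : 'rV[R]_N :=
  II i j u + (kap (blk i) * G u i j) *: Yc (blk i) u.
Local Notation hh := block_form.

Lemma second_form_off i j u : D u -> blk i != blk j -> II i j u = 0.
Proof.
move=> Du ij; rewrite second_formE pd_pd_off// sub0r big1 ?oppr0// => k _.
by rewrite gam_off ?ij// scale0r.
Qed.

Lemma block_form_off i j u : D u -> blk i != blk j -> hh i j u = 0.
Proof.
by move=> Du ij; rewrite /block_form second_form_off// metric_off// mulr0 scale0r addr0.
Qed.

Lemma second_form_part i j b u : D u ->
  ip J (II i j u) (Yc b u) = - ((blk i == b)%:R * G u i j).
Proof.
move=> Du; have [ij|ij] := eqVneq (blk i) (blk j); last first.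
  by rewrite second_form_off// ip0l metric_off// mulr0 oppr0.
rewrite second_formE ipBl ip_suml big1 ?subr0; last first.
  by move=> k _; rewrite ipZl pd_total// ip_pd_part// mulr0.
have := pd_ip Do J i (smooth_pd j (sYc (blk j))) (sYc b) Du.
rewrite (eq_pd_on Do (g := fun=> 0)) ?pd_cst//; last by move=> w Dw; exact: ip_pd_part.
rewrite -pd_pd_total// => /esym/eqP; rewrite addr_eq0 => /eqP ->; congr (- _).
have [ib|ib] := eqVneq (blk i) b; last by rewrite (dYc0 Du ib) ip0r mul0r.
by rewrite mul1r -ib metric_total// ij ipC.
Qed.

Lemma block_form_part i j b u : D u -> ip J (hh i j u) (Yc b u) = 0.
Proof.
move=> Du; rewrite ipDl second_form_part// ipZl ipYc//.
by field.
Qed.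

Lemma block_form_d i j l u : D u -> ip J (hh i j u) (d l Y u) = 0.
Proof.
move=> Du; rewrite ipDl (second_form_orth Js Do)// add0r ipZl pd_total//.
by rewrite ipC// ip_pd_part// mulr0.
Qed.

Lemma ip_block_form i j k l u : D u ->
  ip J (II i j u) (II k l u) =
  ip J (hh i j u) (hh k l u) + (blk i == blk k)%:R * kap (blk i) * G u i j * G u k l.
Proof.
move=> Du.
have IIE i' j' : II i' j' u = hh i' j' u - (kap (blk i') * G u i' j') *: Yc (blk i') u.
  by rewrite addrK.
rewrite !IIE ipBl !ipBr !ipZl !ipZr block_form_part// (ipC (Yc _ u))// block_form_part//.
rewrite ipYc//; have [->|_] := eqVneq (blk i) (blk k); first by field.
by rewrite /= mulr0n; ring.
Qed.

Lemma trace_second_form u : D u ->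
  \sum_i \sum_j Gi u i j *: II i j u =
  (\sum_i \sum_j Gi u i j *: hh i j u) - \sum_i kap (blk i) *: Yc (blk i) u.
Proof.
move=> Du; rewrite -sumrB; apply: eq_bigr => i _.
have -> : kap (blk i) *: Yc (blk i) u =
    \sum_j (Gi u i j * G u j i) *: (kap (blk i) *: Yc (blk i) u).
  by rewrite -scaler_suml (metricK Gu)// eqxx scale1r.
rewrite -sumrB; apply: eq_bigr => j _.
rewrite /block_form (scalerDr _ (II i j u)) !scalerA (metricC Y Js u j i).
have -> : Gi u i j * G u i j * kap (blk i) = Gi u i j * (kap (blk i) * G u i j) by ring.
by rewrite addrK.
Qed.

Lemma norm_second_form u : D u ->
  \sum_i \sum_j \sum_k \sum_l Gi u i k * Gi u j l * ip J (II i j u) (II k l u) =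
  (\sum_i \sum_j \sum_k \sum_l Gi u i k * Gi u j l * ip J (hh i j u) (hh k l u))
  + \sum_i kap (blk i).
Proof.
move=> Du; rewrite -big_split/=; apply: eq_bigr => i _.
have -> : kap (blk i) = \sum_j Gi u i j * G u j i * kap (blk i).
  by rewrite -mulr_suml (metricK Gu)// eqxx mul1r.
have -> : \sum_j Gi u i j * G u j i * kap (blk i) =
    \sum_j \sum_k Gi u i k * (j == k)%:R * ((blk i == blk k)%:R * kap (blk i) * G u i j).
  apply: eq_bigr => j _; rewrite (bigD1 j)//= big1 ?addr0; last first.
    by move=> k /negbTE; rewrite eq_sym => ->; rewrite mulr0 mul0r.
  rewrite eqxx (metricC Y Js u j i); have [ij|ij] := eqVneq (blk i) (blk j).
    by rewrite /= mulr1n; ring.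
  by rewrite metric_off// !mulr0 mul0r.
rewrite -big_split/=; apply: eq_bigr => j _.
rewrite -big_split/=; apply: eq_bigr => k _.
rewrite -(metricK Gu j k Du) mulr_sumr mulr_suml -big_split/=; apply: eq_bigr => l _.
by rewrite ip_block_form// (metricC Y Js u l k); ring.
Qed.

Variable lam : 'I_3 -> R.
Hypothesis sum_kap : \sum_a (kap a)^-1 = 0.
Hypothesis sum_lam : \sum_a lam a / kap a = 1.

Definition conormal u : 'rV[R]_N := \sum_a lam a *: Yc a u.
Local Notation Nf := conormal.
Definition cone_frame u : 'M[R]_(1 + (1 + m), N) :=
  col_mx (Y u) (col_mx (Nf u) (jacobian Y u)).

Lemma smooth_conormal : smooth_on D Nf.
Proof.
apply: smooth_sum => // a _; apply: smooth_scale => //; exact: smooth_cst.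
Qed.

Lemma pd_part k a u : D u -> d k (Yc a) u = (blk k == a)%:R *: d k Y u.
Proof.
move=> Du; have [<-|ka] := eqVneq (blk k) a; first by rewrite scale1r pd_total.
by rewrite scale0r dYc0.
Qed.

Lemma pd_conormal k u : D u -> d k Nf u = lam (blk k) *: d k Y u.
Proof.
move=> Du; have sl a : smooth_on D (fun w => lam a *: Yc a w).
  by apply: smooth_scale => //; exact: smooth_cst.
rewrite (pd_sum Do _ _ (fun a _ => sl a) Du) (bigD1 (blk k))//= big1.
  rewrite addr0 (pd_scale Do k (smooth_cst Do (lam (blk k))) (sYc _) Du) pd_cst.
  by rewrite scale0r add0r pd_total.
move=> a ak; rewrite (pd_scale Do k (smooth_cst Do (lam a)) (sYc _) Du) pd_cst.
by rewrite scale0r add0r dYc0 ?scaler0// eq_sym.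
Qed.

Lemma ip_part_total a u : D u -> ip J (Yc a u) (Y u) = (kap a)^-1.
Proof.
move=> Du; rewrite YE// ip_sumr (bigD1 a)//= ipYc// eqxx mul1r big1 ?addr0// => b ba.
by rewrite ipYc// eq_sym (negbTE ba) mul0r.
Qed.

Lemma ip_total u : D u -> ip J (Y u) (Y u) = 0.
Proof.
move=> Du; rewrite {1}YE// ip_suml -[RHS]sum_kap; apply: eq_bigr => a _.
exact: ip_part_total.
Qed.

Lemma ip_part_conormal a u : D u -> ip J (Yc a u) (Nf u) = lam a / kap a.
Proof.
move=> Du; rewrite ip_sumr (bigD1 a)//= ipZr ipYc// eqxx mul1r big1 ?addr0// => b ba.
by rewrite ipZr ipYc// eq_sym (negbTE ba) mul0r mulr0.
Qed.

Lemma ip_conormal_total u : D u -> ip J (Nf u) (Y u) = 1.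
Proof.
move=> Du; rewrite ip_suml -[RHS]sum_lam; apply: eq_bigr => a _.
by rewrite ipZl ip_part_total.
Qed.

(** The squared norm of [conormal]. It is 0 for the Moebius weights; here its value is carried along
    as a constant. *)
Let cN := \sum_a lam a * (lam a / kap a).

Lemma ip_conormal u : D u -> ip J (Nf u) (Nf u) = cN.
Proof.
by move=> Du; rewrite ip_suml; apply: eq_bigr => a _; rewrite ipZl ip_part_conormal.
Qed.

Lemma ip_total_d l u : D u -> ip J (Y u) (d l Y u) = 0.
Proof.
move=> Du; rewrite pd_total// YE// ip_suml big1// => a _.
by rewrite ipC// ip_pd_part.
Qed.

Lemma ip_part_d a l u : D u -> ip J (Yc a u) (d l Y u) = 0.
Proof. by move=> Du; rewrite pd_total// ipC// ip_pd_part. Qed.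

Lemma ip_conormal_d l u : D u -> ip J (Nf u) (d l Y u) = 0.
Proof.
move=> Du; rewrite ip_suml big1// => a _.
by rewrite ipZl ip_part_d// mulr0.
Qed.

Lemma cone_frame_orthP u (w : 'rV[R]_N) : D u ->
  (w *m J *m (cone_frame u)^T = 0) <->
  [/\ ip J w (Y u) = 0, ip J w (Nf u) = 0 & forall l, ip J w (d l Y u) = 0].
Proof.
move=> Du; rewrite orth_rowsP; split=> [h|[h1 h2 h3] i].
  split=> [||l].
  - by have := h (lshift _ 0); rewrite rowKu row_id.
  - by have := h (rshift _ (lshift _ 0)); rewrite rowKd rowKu row_id.
  - by have := h (rshift _ (rshift _ l)); rewrite !rowKd (row_jacobian _ sY).
case: (split_ordP i) => k ->; first by rewrite rowKu (ord1 k) row_id.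
rewrite rowKd; case: (split_ordP k) => l ->; first by rewrite rowKu (ord1 l) row_id.
by rewrite rowKd (row_jacobian _ sY).
Qed.

Lemma cone_frame_comb u (a b : R) (c : 'I_m -> R) : D u ->
  row_mx a%:M (row_mx b%:M (\row_k c k)) *m cone_frame u =
  a *: Y u + (b *: Nf u + \sum_k c k *: d k Y u).
Proof.
by move=> Du; rewrite /cone_frame !mul_row_col !mul_scalar_mx (sum_row_jacobian sY).
Qed.

(** The Gram matrix is triangular up to order: for a kernel vector [(a, b, c)], pairing with the
    null [Y] gives [b = 0], pairing with [conormal] then gives [a = 0], and pairing with the tangent
    vectors leaves [c G = 0]. *)
Lemma cone_frame_unit u : D u -> cone_frame u *m J *m (cone_frame u)^T \in unitmx.
Proof.
move=> Du; rewrite -row_free_unit -kermx_eq0; apply/eqP/row_matrixP => i.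
rewrite row0; set K := kermx _; have := row_mul i K (cone_frame u *m J *m (cone_frame u)^T).
rewrite mulmx_ker row0 => /esym; move: (row i K) => v {i K}.
rewrite -(hsubmxK v) -(hsubmxK (rsubmx v)) [lsubmx v]mx11_scalar.
rewrite [lsubmx (rsubmx v)]mx11_scalar.
move: (lsubmx v 0 0) (lsubmx (rsubmx v) 0 0) (rsubmx (rsubmx v)) => a b c {v}.
have -> : c = \row_k c 0 k by apply/rowP => k; rewrite mxE.
rewrite !mulmxA cone_frame_comb// => /(cone_frame_orthP _ Du)[].
rewrite !ipDl !ipZl ip_total// ip_conormal_total// ip_suml big1 ?addr0; last first.
  by move=> k _; rewrite ipZl ipC// ip_total_d// mulr0.
rewrite mulr0 add0r mulr1 => b0; rewrite b0 mul0r add0r.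
rewrite (ipC (Y u))// ip_conormal_total// ip_suml big1 ?addr0 ?mulr1; last first.
  by move=> k _; rewrite ipZl ipC// ip_conormal_d// mulr0.
move=> a0 c0; have : c *m G u = 0.
  apply/rowP => l; have := c0 l; rewrite a0 ?b0 !scale0r !add0r ip_suml !mxE => h.
  by rewrite -[RHS]h; apply: eq_bigr => k _; rewrite ipZl (metricE J sY).
move=> /(congr1 (mulmx^~ (invmx (G u)))); rewrite mulmxK ?Gu// mul0mx => cz.
rewrite a0 ?b0; have -> : \row_k c 0 k = 0 by apply/rowP => k; rewrite cz !mxE.
by rewrite !raddf0 !row_mx0.
Qed.

(** The projection of [Yc a] to the Moebius normal space: the two coefficients solve [<W, Y> = 0]
    and [<W, N> = 0]. Its derivatives are multiples of those of [Y], so it is a parallel section of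
    the normal bundle. *)
Definition umbilic_part a u : 'rV[R]_N :=
  Yc a u - ((lam a - cN) / kap a) *: Y u - (kap a)^-1 *: Nf u.
Local Notation W := umbilic_part.

Definition cone_sff i j u : 'rV[R]_N :=
  hh i j u - (kap (blk i) * G u i j) *: W (blk i) u.

Lemma umbilic_part_orth a u : D u -> W a u *m J *m (cone_frame u)^T = 0.
Proof.
move=> Du; apply/cone_frame_orthP => //; split=> [||l].
- rewrite !ipBl !ipZl ip_part_total// ip_total// ip_conormal_total//.
  by field.
- rewrite !ipBl !ipZl ip_part_conormal// (ipC (Y u))// ip_conormal_total// ip_conormal//.
  by field.
- by rewrite !ipBl !ipZl ip_part_d// ip_total_d// ip_conormal_d// !mulr0 !subr0.
Qed.

Lemma block_form_orth i j u : D u -> hh i j u *m J *m (cone_frame u)^T = 0.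
Proof.
move=> Du; apply/cone_frame_orthP => //; split=> [||l]; last exact: block_form_d.
  by rewrite YE// ip_sumr big1// => a _; exact: block_form_part.
by rewrite ip_sumr big1// => a _; rewrite ipZr block_form_part// mulr0.
Qed.

Lemma nproj_pd_pd i j u : D u ->
  nproj J (cone_frame u) (d i (d j Y) u) = cone_sff i j u.
Proof.
move=> Du; pose a := blk i; pose s := kap a * G u i j.
apply: (nproj_uniq (c := row_mx (- s * ((lam a - cN) / kap a))%:M
   (row_mx (- s * (kap a)^-1)%:M (\row_k Gam k i j u)))).
- exact: cone_frame_unit.
- rewrite /cone_sff !mulmxBl -!scalemxAl umbilic_part_orth// scaler0 subr0.
  exact: block_form_orth.
- rewrite cone_frame_comb// /cone_sff /block_form /umbilic_part second_formE -/a -/s.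
  move: (\sum_k _ *: _) (d i (d j Y) u) => S V.
  by apply/rowP => k; rewrite !mxE; ring.
Qed.

Lemma smooth_block_form i j : smooth_on D (hh i j).
Proof.
apply: smooth_add => //; first exact: smooth_second_form.
apply: smooth_scale => //; apply: smooth_mul => //; first exact: smooth_cst.
exact: smooth_metric.
Qed.

Lemma smooth_umbilic_part a : smooth_on D (W a).
Proof.
apply: (eq_smooth_on Do (f := fun u => Yc a u + (- ((lam a - cN) / kap a)) *: Y u
  + (- (kap a)^-1) *: Nf u)) => [w _|]; first by rewrite /umbilic_part !scaleNr.
apply: smooth_add => //; first apply: smooth_add => //.
  by apply: smooth_scale => //; exact: smooth_cst.
by apply: smooth_scale => //; [exact: smooth_cst|exact: smooth_conormal].
Qed.

Lemma nproj_pd k u : D u -> nproj J (cone_frame u) (d k Y u) = 0.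
Proof.
move=> Du; rewrite -[RHS](nproj_row (row_mx 0%:M (row_mx 0%:M (\row_l (l == k)%:R)))
  (cone_frame_unit Du)) cone_frame_comb// !scale0r !add0r; congr (nproj _ _ _).
by rewrite (bigD1 k)//= eqxx scale1r big1 ?addr0// => l /negbTE ->; rewrite scale0r.
Qed.

Lemma nproj_pd_umbilic a k u : D u -> nproj J (cone_frame u) (d k (W a) u) = 0.
Proof.
move=> Du.
have -> : d k (W a) u = ((blk k == a)%:R - (lam a - cN) / kap a - (kap a)^-1 * lam (blk k))
    *: d k Y u.
  have s1 : smooth_on D (fun u => (- ((lam a - cN) / kap a)) *: Y u).
    by apply: smooth_scale => //; exact: smooth_cst.
  have s2 : smooth_on D (fun u => (- (kap a)^-1) *: Nf u).
    by apply: smooth_scale => //; [exact: smooth_cst|exact: smooth_conormal].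
  rewrite (eq_pd_on Do (g := fun u => Yc a u + (- ((lam a - cN) / kap a)) *: Y u
    + (- (kap a)^-1) *: Nf u))//; last by move=> w _; rewrite /umbilic_part !scaleNr.
  rewrite (pd_add k (smooth_add Do (sYc a) s1) s2 Du) (pd_add k (sYc a) s1 Du).
  rewrite (pd_scale Do k (smooth_cst Do _) sY Du) (pd_scale Do k (smooth_cst Do _) smooth_conormal Du).
  by rewrite !pd_cst !scale0r !add0r pd_conormal// pd_part// scalerA -!scalerDl mulNr.
by rewrite nprojZ nproj_pd// scaler0.
Qed.

Lemma lower_gam i j k u : D u -> \sum_l Gam l i j u * G u l k = ip J (d i (d j Y) u) (d k Y u).
Proof.
move=> Du; have := christoffel_orth Js Do sY Gu i j k Du.
rewrite ipBl ip_suml => /eqP; rewrite subr_eq0 => /eqP ->.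
by apply: eq_bigr => l _; rewrite ipZl (metricE J sY).
Qed.

(** The correction is the sum over [a] of [kap a] times the metric of factor [a] times
    [umbilic_part a]; each of these metrics is parallel for the product connection, and each
    [umbilic_part] is parallel in the normal bundle. *)
Lemma nabla_cone_sff k i j u : D u ->
  nproj J (cone_frame u) (d k (cone_sff i j) u)
  - \sum_l (Gam l k i u *: cone_sff l j u + Gam l k j u *: cone_sff i l u) =
  nproj J (cone_frame u) (d k (hh i j) u)
  - \sum_l (Gam l k i u *: hh l j u + Gam l k j u *: hh i l u).
Proof.
move=> Du; pose s w := - (kap (blk i) * G w i j).
have ss : smooth_on D s.
  apply: (eq_smooth_on Do (f := fun w => - kap (blk i) * G w i j)) => [w _|].
    by rewrite mulNr.
  by apply: smooth_mul => //; [exact: smooth_cst|exact: smooth_metric].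
have sW := smooth_umbilic_part (blk i).
have -> : d k (cone_sff i j) u = d k (hh i j) u +
    (d k s u *: W (blk i) u + s u *: d k (W (blk i)) u).
  rewrite (eq_pd_on Do (g := fun w => hh i j w + s w *: W (blk i) w))//; last first.
    by move=> w _; rewrite /cone_sff /s scaleNr.
  rewrite (pd_add k (smooth_block_form i j) (smooth_scale Do ss sW) Du).
  by rewrite (pd_scale Do k ss sW Du).
rewrite !nprojD !nprojZ nproj_pd_umbilic// scaler0 addr0.
rewrite (nproj_id (cone_frame_unit Du) (umbilic_part_orth _ Du)).
have -> : d k s u = - kap (blk i) * (ip J (d k (d i Y) u) (d j Y u)
    + ip J (d k (d j Y) u) (d i Y u)).
  rewrite (eq_pd_on Do (g := fun w => - kap (blk i) * G w i j))//; last first.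
    by move=> w _; rewrite mulNr.
  rewrite (pd_mul k (smooth_cst Do _) (smooth_metric J Do sY i j) Du) pd_cst mul0r add0r.
  by rewrite (pd_metric J Do sY)// (ipC (d i Y u)).
have -> : \sum_l (Gam l k i u *: cone_sff l j u + Gam l k j u *: cone_sff i l u) =
    \sum_l (Gam l k i u *: hh l j u + Gam l k j u *: hh i l u)
    - ((ip J (d k (d i Y) u) (d j Y u) * kap (blk j)) *: W (blk j) u
      + (ip J (d k (d j Y) u) (d i Y u) * kap (blk i)) *: W (blk i) u).
  rewrite -!lower_gam// !mulr_suml !scaler_suml -big_split/= -sumrB.
  apply: eq_bigr => l _; rewrite /cone_sff (scalerBr _ (hh l j u)) (scalerBr _ (hh i l u)) !scalerA (metricC Y Js u i l).
  have -> : (Gam l k i u * (kap (blk l) * G u l j)) *: W (blk l) u =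
            (Gam l k i u * G u l j * kap (blk j)) *: W (blk j) u.
    have [->|lj] := eqVneq (blk l) (blk j); first by congr (_ *: _); ring.
    by rewrite metric_off// mulr0 !mulr0 mul0r !scale0r.
  have -> : Gam l k j u * (kap (blk i) * G u l i) = Gam l k j u * G u l i * kap (blk i) by ring.
  by rewrite opprD addrACA.
rewrite opprB addrA; congr (_ - _).
have [ij|ij] := eqVneq (blk i) (blk j).
  by rewrite ij; apply/rowP => l; rewrite !mxE; ring.
by rewrite !ip_pd_pd_d// 1?eq_sym// !mul0r addr0 mulr0 !scale0r !addr0.
Qed.

(** * Comparison of the product with one of its factors *)

Section Factor.
Variables (n N' : nat) (J' : 'M[R]_N') (D' : set 'rV[R]_n) (y : 'rV[R]_n -> 'rV[R]_N').
Variables (P : 'M[R]_(m, n)) (io : 'I_n -> 'I_m) (E : 'M[R]_(N', N)) (a : 'I_3).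
Hypotheses (Js' : J'^T = J') (Do' : open D') (sy : smooth_on D' y).
Hypothesis Gu' : forall v, D' v -> metric J' y v \in unitmx.
Hypothesis y_eps : forall v, D' v -> ip J' (y v) (y v) = (kap a)^-1.
Hypothesis DP : forall u, D u -> D' (u *m P).
Hypothesis Pio : forall i j, P (io i) j = (i == j)%:R.
Hypotheses (blk_io : forall i, blk (io i) = a) (io_onto : forall k, blk k = a -> exists i, k = io i).
Hypothesis EJE : E *m J *m E^T = J'.
Hypothesis YcE : forall u, D u -> Yc a u = y (u *m P) *m E.
Hypothesis E_orth : forall b u, b != a -> D u -> E *m J *m (Yc b u)^T = 0.
Local Notation d' := (@dpart R n _).

Let io_inj : injective io.
Proof.
move=> i j ij; have := Pio i j; rewrite ij Pio eqxx.
by have [//|_] := eqVneq i j; move=> /eqP; rewrite oner_eq0.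
Qed.

Let sum_block (V : nmodType) (F : 'I_m -> V) :
  \sum_(k | blk k == a) F k = \sum_i F (io i).
Proof.
rewrite (eq_bigl (mem (io @: setT))); last first.
  move=> k; apply/eqP/imsetP => [/io_onto[i ->]|[i _ ->]]; first by exists i; rewrite ?in_setT.
  exact: blk_io.
rewrite big_imset/=; last by move=> i j _ _ /io_inj.
by apply: eq_bigl => i; rewrite in_setT.
Qed.

Let sum_block0 (V : nmodType) (F : 'I_m -> V) :
  (forall k, blk k != a -> F k = 0) -> \sum_k F k = \sum_i F (io i).
Proof.
by move=> F0; rewrite (bigID (fun k => blk k == a))/= [X in _ + X]big1// addr0 sum_block.
Qed.

Let ipE v w : ip J (v *m E) (w *m E) = ip J' v w.
Proof. by rewrite /ip trmx_mul !mulmxA -(mulmxA v) -(mulmxA v) EJE. Qed.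

Let pd_lift (k : nat) (F : 'rV[R]_n -> 'rV[R]_k) i u : smooth_on D' F -> D u ->
  d (io i) (fun w => F (w *m P)) u = d' i F (u *m P).
Proof.
move=> sF Du; rewrite pd_pullback//; last exact: smooth_diff sF (DP Du).
rewrite (bigD1 i)//= Pio eqxx scale1r big1 ?addr0// => j ji.
by rewrite Pio eq_sym (negbTE ji) scale0r.
Qed.

Let pd_liftE (F : 'rV[R]_n -> 'rV[R]_N') i u : smooth_on D' F -> D u ->
  d (io i) (fun w => F (w *m P) *m E) u = d' i F (u *m P) *m E.
Proof.
move=> sF Du.
by rewrite (pd_mulmxr Do E _ (smooth_pullback Do Do' DP sF) Du) pd_lift.
Qed.

Let dY i u : D u -> d (io i) Y u = d' i y (u *m P) *m E.
Proof.
move=> Du; rewrite pd_total// blk_io (eq_pd_on Do (g := fun w => y (w *m P) *m E))//.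
exact: pd_liftE.
Qed.

Let ddY i j u : D u -> d (io i) (d (io j) Y) u = d' i (d' j y) (u *m P) *m E.
Proof.
move=> Du; rewrite (eq_pd_on Do (g := fun w => d' j y (w *m P) *m E)); [|by []|by move=> w /dY].
by apply: pd_liftE => //; exact: smooth_pd.
Qed.

Lemma metric_factor i j u : D u -> G u (io i) (io j) = metric J' y (u *m P) i j.
Proof.
move=> Du; rewrite (metricE J sY)// !dY// ipE (metricE J' sy)//; exact: DP.
Qed.

Lemma imetric_factor i j u : D u -> Gi u (io i) (io j) = imetric J' y (u *m P) i j.
Proof.
move=> Du.
have <- : (\matrix_(k, l) Gi u (io k) (io l)) = imetric J' y (u *m P).
  rewrite -(imetricE J' y); apply: (can_inj (mulmxK (Gu' (DP Du)))).
  rewrite mulVmx; last exact: Gu' (DP Du).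
  apply/matrixP => k l; rewrite !mxE.
  transitivity (\sum_n Gi u (io k) n * G u n (io l)).
    rewrite sum_block0; last by move=> q qa; rewrite metric_off ?mulr0// blk_io.
    by apply: eq_bigr => q _; rewrite mxE metric_factor.
  by rewrite (metricK Gu)// (inj_eq io_inj).
by rewrite mxE.
Qed.

Lemma gam_factor k i j u : D u -> Gam (io k) (io i) (io j) u = gam J' y k i j (u *m P).
Proof.
move=> Du; rewrite (christoffelE Js Do)// (christoffelE Js' Do' sy)//; last exact: DP.
rewrite sum_block0; last by move=> l la; rewrite imetric_off ?mul0r// blk_io eq_sym.
by apply: eq_bigr => l _; rewrite imetric_factor// ddY// dY// ipE.
Qed.

Lemma second_form_factor i j u : D u ->
  II (io i) (io j) u = second_form J' y i j (u *m P) *m E.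
Proof.
move=> Du; rewrite !second_formE mulmxBl ddY//; congr (_ - _).
rewrite sum_block0; last first.
  by move=> k ka; rewrite gam_off ?scale0r// !blk_io ka orbT.
rewrite mulmx_suml; apply: eq_bigr => k _.
by rewrite gam_factor// dY// scalemxAl.
Qed.

Let eps0 : (kap a)^-1 != 0.
Proof. by rewrite invr_neq0. Qed.

Lemma block_form_factor i j u : D u ->
  hh (io i) (io j) u = hsff J' y i j (u *m P) *m E.
Proof.
move=> Du; rewrite /block_form second_form_factor// blk_io metric_factor//.
rewrite (sffE Js' Do' sy eps0 y_eps Gu' _ _ (DP Du)) invrK mulmxDl -scalemxAl -YcE//.
by rewrite [_ * kap a]mulrC.
Qed.

Lemma trace_factor u : D u ->
  \sum_(i | blk i == a) \sum_j Gi u i j *: hh i j u =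
  ttrace (imetric J' y (u *m P)) (fun i j => hsff J' y i j (u *m P)) *m E.
Proof.
move=> Du; rewrite sum_block /ttrace mulmx_suml; apply: eq_bigr => i _.
rewrite sum_block0; last by move=> k ka; rewrite block_form_off ?scaler0// blk_io eq_sym.
rewrite mulmx_suml; apply: eq_bigr => j _.
by rewrite imetric_factor// block_form_factor// scalemxAl.
Qed.

Lemma norm_factor u : D u ->
  \sum_(i | blk i == a) \sum_j \sum_k \sum_l Gi u i k * Gi u j l * ip J (hh i j u) (hh k l u) =
  sff_norm2 J' y (u *m P).
Proof.
move=> Du; rewrite sum_block /sff_norm2 induced_metricE imetricE hsffE; apply: eq_bigr => i _.
rewrite sum_block0; last first.
  move=> j ja; rewrite big1// => k _; rewrite big1// => l _.
  by rewrite block_form_off ?ip0l ?mulr0// blk_io eq_sym.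
apply: eq_bigr => j _; rewrite sum_block0; last first.
  by move=> k ka; rewrite big1// => l _; rewrite imetric_off ?mul0r// blk_io eq_sym.
apply: eq_bigr => k _; rewrite sum_block0; last first.
  by move=> l la; rewrite (imetric_off Du (i := io j)) ?mulr0 ?mul0r// blk_io eq_sym.
by apply: eq_bigr => l _; rewrite !imetric_factor// !block_form_factor// ipE.
Qed.

Let E_orth_part b u v : b != a -> D u -> ip J (v *m E) (Yc b u) = 0.
Proof. by move=> ba Du; rewrite /ip -(mulmxA v) -mulmxA E_orth// mulmx0 mxE. Qed.

Let E_orth_d k u v : blk k != a -> D u -> ip J (v *m E) (d k Y u) = 0.
Proof.
move=> ka Du; rewrite pd_total//.
have := pd_ip Do J k (smooth_cst Do (v *m E)) (sYc (blk k)) Du.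
rewrite (eq_pd_on Do (g := fun=> (0 : R)))//; last by move=> w Dw; exact: E_orth_part.
by rewrite !pd_cst ip0l add0r.
Qed.

Let lift_orth u (w : 'rV[R]_N') : D u -> w *m J' *m (quadric_frame y (u *m P))^T = 0 ->
  w *m E *m J *m (cone_frame u)^T = 0.
Proof.
move=> Du /(quadric_frame_orthP J' sy _ (DP Du))[wy wd].
have wYc b : ip J (w *m E) (Yc b u) = 0.
  by have [->|ba] := eqVneq b a; [rewrite YcE// ipE|exact: E_orth_part].
apply/cone_frame_orthP => //; split=> [||k].
- by rewrite YE// ip_sumr big1.
- by rewrite ip_sumr big1// => b _; rewrite ipZr wYc mulr0.
- have [/io_onto[l ->]|ka] := eqVneq (blk k) a; last exact: E_orth_d.
  by rewrite dY// ipE.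
Qed.

(** The two sides project to different normal spaces, the complement of [cone_frame] and that of
    [quadric_frame]. The derivative of [h] on the factor splits into a normal part, which [E]
    carries into the complement of [cone_frame], a tangential part, which both projections kill, and
    a position part, which is shown to be zero. *)
Lemma nabla_factor k i j u : D u ->
  nproj J (cone_frame u) (d (io k) (hh (io i) (io j)) u)
  - \sum_l (Gam l (io k) (io i) u *: hh l (io j) u + Gam l (io k) (io j) u *: hh (io i) l u) =
  nabla_sff J' y k i j (u *m P) *m E.
Proof.
move=> Du; pose v := u *m P; have D'v : D' v := DP Du.
have sh := smooth_sff Js' Do' sy eps0 y_eps Gu' i j.
rewrite /nabla_sff /nabla_normal induced_metricE gamE hsffE -dpartE mulmxBl; congr (_ - _).
  rewrite (eq_pd_on Do (g := fun w => hsff J' y i j (w *m P) *m E)); [|by []|]; last first.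
    by move=> w Dw; exact: block_form_factor.
  rewrite pd_liftE// -/v; set V := d' k _ v.
  have uF := quadric_frame_unit Js' Do' sy eps0 y_eps Gu' D'v.
  have [c VE] := nproj_def J' (quadric_frame y v) V; have wF := nproj_orth V uF.
  set w := nproj _ _ V in VE wF *; clearbody w.
  move: VE; rewrite -(hsubmxK c) [lsubmx c]mx11_scalar /quadric_frame mul_row_col mul_scalar_mx.
  have -> : rsubmx c = \row_q rsubmx c 0 q by apply/rowP => q; rewrite mxE.
  rewrite -(sum_row_jacobian sy)//; move: (lsubmx c 0 0) (fun q => rsubmx c 0 q) => c0 c1 VE.
  (* A component along [y] would not be removed on the product side, since only the combinations [Y]
     and [conormal] of the positions lie in [cone_frame]. It is zero because [h] is orthogonal to
     [y] and to the derivatives of [y]. *)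
  have c00 : c0 = 0.
    have : ip J' V (y v) = 0.
      have := pd_ip Do' J' k sh sy D'v.
      rewrite (eq_pd_on Do' (g := fun=> (0 : R)))// ?pd_cst; last first.
        by move=> q Dq; exact: (sff_orth_pos Js' Do' sy eps0 y_eps Gu').
      by rewrite (sff_orth_d Js' Do' sy eps0 y_eps Gu')// addr0.
    have [wy wd] := (quadric_frame_orthP J' sy w D'v).1 wF.
    rewrite VE !ipDl ipZl wy y_eps// ip_suml big1 ?addr0 ?add0r; last first.
      by move=> q _; rewrite ipZl ipC// (quadric_ip_d Js' Do' sy y_eps)// mulr0.
    by move=> /eqP; rewrite mulf_eq0 (negbTE eps0) orbF => /eqP.
  rewrite VE c00 scale0r add0r mulmxDl nprojD.
  rewrite (nproj_id (cone_frame_unit Du) (lift_orth Du wF)) mulmx_suml nproj_sum.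
  rewrite big1 ?addr0// => q _; rewrite -scalemxAl -dY// nprojZ.
  by rewrite nproj_pd// scaler0.
rewrite sum_block0; last first.
  move=> l la; rewrite !gam_off ?scale0r ?addr0// !blk_io la orbT//.
rewrite mulmx_suml; apply: eq_bigr => l _.
by rewrite !gam_factor// !block_form_factor// mulmxDl !scalemxAl.
Qed.

(** Deduces the nondegeneracy of the product metric from that of its factors, one block of
    coordinates at a time. *)
Lemma metric_factor_ker u (v : 'rV[R]_m) i : D u -> v *m G u = 0 -> v 0 (io i) = 0.
Proof.
move=> Du vG; have : (\row_k v 0 (io k)) *m metric J' y (u *m P) = 0.
  apply/rowP => j; have /rowP/(_ (io j)) := vG; rewrite !mxE => h; rewrite -[RHS]h.
  rewrite sum_block0; last by move=> k ka; rewrite metric_off ?mulr0// blk_io.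
  by apply: eq_bigr => k _; rewrite mxE metric_factor.
move=> /(congr1 (mulmx^~ (invmx (metric J' y (u *m P))))).
rewrite mulmxK; last exact: Gu' (DP Du).
by rewrite mul0mx => /rowP/(_ i); rewrite !mxE.
Qed.

Hypothesis Poff : forall k j, blk k != a -> P k j = 0.

Lemma pd_block_form_off k i j u : D u -> blk k != a -> d k (hh (io i) (io j)) u = 0.
Proof.
move=> Du ka.
rewrite (eq_pd_on Do (g := fun w => hsff J' y i j (w *m P) *m E)); [|by []|]; last first.
  by move=> w Dw; exact: block_form_factor.
have sh := smooth_sff Js' Do' sy eps0 y_eps Gu' i j.
rewrite (pd_mulmxr Do E k (smooth_pullback Do Do' DP sh) Du) pd_pullback; last first.
  exact: smooth_diff sh (DP Du).
by rewrite big1 ?mul0mx// => l _; rewrite Poff// scale0r.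
Qed.

End Factor.

(** In each product of a Christoffel symbol and a form, one of the two has indices in different
    blocks and vanishes. The remaining derivative is that of a zero form, or that of the form of one
    factor along another factor, which is the case covered by the last premise. *)
Lemma nabla_mixed k i j u : D u -> ~~ ((blk i == blk j) && (blk k == blk i)) ->
  (forall b, blk k != b -> blk i = b -> blk j = b -> d k (hh i j) u = 0) ->
  nproj J (cone_frame u) (d k (hh i j) u)
  - \sum_l (Gam l k i u *: hh l j u + Gam l k j u *: hh i l u) = 0.
Proof.
move=> Du nb d0.
have np0 : nproj J (cone_frame u) 0 = 0.
  by have := nprojZ J (cone_frame u) 0 0; rewrite !scale0r.
have [ij|ij] := eqVneq (blk i) (blk j).
  move: nb; rewrite ij eqxx /= => kj.
  rewrite (d0 (blk j))// np0 sub0r big1 ?oppr0// => l _.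
  by rewrite !gam_off ?ij ?kj// !scale0r addr0.
rewrite (eq_pd_on Do (g := fun=> 0))//; last by move=> w Dw; exact: block_form_off.
rewrite pd_cst np0 sub0r big1 ?oppr0// => l _.
have [li|li] := eqVneq (blk l) (blk i); last first.
  rewrite (gam_off Du (k := l) (i := k) (j := i)) ?li ?orbT// scale0r add0r.
  have [lj|lj] := eqVneq (blk l) (blk j); last by rewrite gam_off ?lj ?orbT// scale0r.
  by rewrite block_form_off ?scaler0// lj.
rewrite (block_form_off (i := l)) ?li// scaler0 add0r.
by rewrite gam_off ?scale0r// li ij orbT.
Qed.

End Product.

(** * Rescaling of maps into the light cone *)

Section LightCone.
Variables (R : realType) (m N : nat) (J : 'M[R]_N) (D : set 'rV[R]_m).
Variables (Y : 'rV[R]_m -> 'rV[R]_N) (phi : 'rV[R]_m -> R).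
Hypotheses (Js : J^T = J) (Do : open D) (sY : smooth_on D Y) (sphi : smooth_on D phi).
Hypotheses (phi0 : forall u, D u -> phi u != 0) (YY : forall u, D u -> ip J (Y u) (Y u) = 0).
Hypothesis m0 : (0 < m)%N.
Local Notation G := (metric J Y).
Local Notation Gi := (imetric J Y).
Hypothesis Gu : forall u, D u -> G u \in unitmx.
Local Notation d := (@dpart R m _).
Local Notation II := (second_form J Y).

Definition rescaled : 'rV[R]_m -> 'rV[R]_N := fun u => phi u *: Y u.
Local Notation X := rescaled.

Lemma smooth_rescaled : smooth_on D X.
Proof. exact: smooth_scale. Qed.
Local Notation sX := smooth_rescaled.

Lemma cone_ip_d i u : D u -> ip J (Y u) (d i Y u) = 0.
Proof.
move=> Du; have := pd_ip Do J i sY sY Du.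
rewrite (eq_pd_on Do (g := fun=> 0))// pd_cst ipC// -mulr2n => /eqP.
by rewrite eq_sym mulrn_eq0 => /eqP.
Qed.

Lemma cone_second_form i j u : D u -> ip J (II i j u) (Y u) = - G u i j.
Proof.
move=> Du; rewrite second_formE ipBl ip_suml big1 ?subr0; last first.
  by move=> k _; rewrite ipZl ipC// cone_ip_d// mulr0.
have := pd_ip Do J i sY (smooth_pd j sY) Du.
rewrite (eq_pd_on Do (g := fun=> 0)) ?pd_cst//; last first.
  by move=> w Dw; exact: cone_ip_d.
by rewrite -(metricE J sY)// (ipC (Y u))// => /esym/eqP; rewrite addrC addr_eq0 => /eqP.
Qed.

Lemma pd_rescaled i u : D u -> d i X u = d i phi u *: Y u + phi u *: d i Y u.
Proof. by move=> Du; exact: (pd_scale Do i sphi sY Du). Qed.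

Lemma metric_rescaled u : D u -> metric J X u = phi u ^+ 2 *: G u.
Proof.
move=> Du; apply/matrixP => i j; rewrite mxE (metricE J sX)// (metricE J sY)//.
rewrite !pd_rescaled// !ipDl !ipDr !ipZl !ipZr YY// cone_ip_d// ipC// cone_ip_d//.
by ring.
Qed.

Lemma metric_rescaled_unit u : D u -> metric J X u \in unitmx.
Proof.
move=> Du; rewrite metric_rescaled// unitmxZ ?Gu// unitfE expf_neq0//.
exact: phi0.
Qed.

Lemma imetric_rescaled u : D u -> imetric J X u = (phi u ^+ 2)^-1 *: Gi u.
Proof.
move=> Du; rewrite -!imetricE metric_rescaled// invmxZ//.
by rewrite -metric_rescaled// metric_rescaled_unit.
Qed.

Definition cone_grad u : 'rV[R]_N :=
  \sum_k (\sum_l Gi u k l * d l phi u) *: d k Y u.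

Lemma raise_index (c : 'I_m -> R) n u : D u ->
  \sum_k (\sum_l Gi u k l * c l) * G u k n = c n.
Proof.
move=> Du; transitivity (\sum_l (\sum_k Gi u l k * G u k n) * c l).
  under eq_bigr do rewrite mulr_suml.
  rewrite exchange_big/=; apply: eq_bigr => l _; rewrite mulr_suml.
  by apply: eq_bigr => k _; rewrite (invmetricC Y Js u k l); ring.
rewrite (bigD1 n)//= (metricK Gu)// eqxx mul1r big1 ?addr0// => l /negbTE ln.
by rewrite (metricK Gu)// ln mul0r.
Qed.

Lemma cone_grad_d l u : D u -> ip J (cone_grad u) (d l Y u) = d l phi u.
Proof.
move=> Du; rewrite ip_suml -[RHS](raise_index (fun l => d l phi u) l Du).
by apply: eq_bigr => k _; rewrite ipZl -(metricE J sY).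
Qed.

Lemma cone_grad_pos u : D u -> ip J (cone_grad u) (Y u) = 0.
Proof.
move=> Du; rewrite ip_suml big1// => k _.
by rewrite ipZl ipC// cone_ip_d// mulr0.
Qed.

(** The Christoffel symbols of the conformal metric [phi^2 G], written in terms of those of [G]. *)
Definition cone_gam u i j k : R := gam J Y k i j u
  + ((k == j)%:R * d i phi u + (k == i)%:R * d j phi u
     - G u i j * \sum_l Gi u k l * d l phi u) / phi u.

(** The Hessian of [phi] with respect to the rescaled metric. *)
Definition cone_coef i j u : R := d i (d j phi) u - \sum_k cone_gam u i j k * d k phi u.

Lemma second_form_rescaled_aux i j u : D u ->
  d i (d j X) u - \sum_k cone_gam u i j k *: d k X u =
  phi u *: II i j u + (G u i j *: cone_grad u + cone_coef i j u *: Y u).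
Proof.
move=> Du.
have -> : d i (d j X) u = d i (d j phi) u *: Y u + d j phi u *: d i Y u
    + (d i phi u *: d j Y u + phi u *: d i (d j Y) u).
  rewrite (eq_pd_on Do (g := fun w => d j phi w *: Y w + phi w *: d j Y w))//; last first.
    by move=> w Dw; exact: pd_rescaled.
  have s1 : smooth_on D (fun w => d j phi w *: Y w).
    by apply: smooth_scale => //; exact: smooth_pd.
  have s2 : smooth_on D (fun w => phi w *: d j Y w).
    by apply: smooth_scale => //; exact: smooth_pd.
  rewrite (pd_add i s1 s2 Du) (pd_scale Do i (smooth_pd j sphi) sY Du).
  by rewrite (pd_scale Do i sphi (smooth_pd j sY) Du).
have -> : \sum_k cone_gam u i j k *: d k X u =
    (\sum_k cone_gam u i j k * d k phi u) *: Y u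
    + (phi u *: (\sum_k gam J Y k i j u *: d k Y u)
    + (d i phi u *: d j Y u + d j phi u *: d i Y u - G u i j *: cone_grad u)).
  have delta n (c : R) : c *: d n Y u = \sum_k ((k == n)%:R * c) *: d k Y u.
    rewrite (bigD1 n)//= eqxx mul1r big1 ?addr0// => k /negbTE ->.
    by rewrite mul0r scale0r.
  rewrite (delta j) (delta i) /cone_grad !scaler_sumr scaler_suml -sumrN -!big_split/=.
  apply: eq_bigr => k _; rewrite pd_rescaled// scalerDr !scalerA; congr (_ + _).
  rewrite -scaleNr -!scalerDl; congr (_ *: _).
  by rewrite /cone_gam; field; exact: phi0.
rewrite /cone_coef second_formE.
move: (\sum_k _ * _) (\sum_k _ *: _) (cone_grad u) => s1 s2 w.
apply/rowP => l; rewrite !mxE; ring.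
Qed.

(** By [christoffel_uniq] the remainder in [second_form_rescaled_aux] only has to be orthogonal to
    [d_l X = phi_l Y + phi d_l Y]: the product of [phi II] with [phi_l Y] is [- phi phi_l G], and
    that of [G cone_grad] with [phi d_l Y] is its opposite. *)
Lemma gam_rescaled k i j u : D u -> gam J X k i j u = cone_gam u i j k.
Proof.
move=> Du; apply: (christoffel_uniq Js Do sX metric_rescaled_unit Du) => l.
rewrite second_form_rescaled_aux// pd_rescaled//.
rewrite !(ipDl, ipDr, ipZl, ipZr) cone_second_form// (second_form_orth Js Do)//.
rewrite cone_grad_pos// cone_grad_d// YY// cone_ip_d//.
by ring.
Qed.

Lemma second_form_rescaled i j u : D u -> second_form J X i j u =
  phi u *: II i j u + (G u i j *: cone_grad u + cone_coef i j u *: Y u).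
Proof.
move=> Du; rewrite -second_form_rescaled_aux// second_formE; congr (_ - _).
by apply: eq_bigr => k _; rewrite gam_rescaled.
Qed.

Lemma cone_coefC i j u : D u -> cone_coef i j u = cone_coef j i u.
Proof.
move=> Du; rewrite /cone_coef (pd_comm i j Do sphi Du); congr (_ - _).
apply: eq_bigr => k _; rewrite /cone_gam (christoffelC Js Do)// (metricC Y Js u i j).
by congr ((_ + _ / _) * _); ring.
Qed.

(** The two inverse metrics contribute [phi^-4] and [tracefree2_shift], with [w] the gradient of
    [phi] and [y] the null position vector, contributes [phi^2]. *)
Lemma tracefree2_rescaled u : D u ->
  tracefree2 J (imetric J X u) (fun i j => second_form J X i j u) =
  (phi u ^+ 2)^-1 * tracefree2 J (Gi u) (fun i j => II i j u).
Proof.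
move=> Du; rewrite imetric_rescaled// tracefree2_scale.
have -> : (fun i j => second_form J X i j u) = (fun i j =>
    phi u *: II i j u + (G u i j *: cone_grad u + cone_coef i j u *: Y u)).
  by apply/funext => i; apply/funext => j; exact: second_form_rescaled.
rewrite (tracefree2_shift Js m0 (g := G u)).
- by field; exact: phi0.
- by move=> i j; exact: metricC.
- by move=> i j; exact: invmetricC.
- by move=> i j; exact: (metricK Gu).
- by move=> i j; exact: cone_coefC.
- by move=> i j; exact: cone_second_form.
- exact: YY.
- move=> i j; rewrite ip_sumr big1// => k _.
  by rewrite ipZr (second_form_orth Js Do)// mulr0.
- exact: cone_grad_pos.
Qed.

End LightCone.

(** * Moebius invariants of a product *)

Section MinkowskiForm.
Variable R : realType.

Lemma eucl_sym (N : nat) : (eucl R N)^T = eucl R N.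
Proof. exact: trmx1. Qed.

Lemma mink_sym (N : nat) : (mink R N)^T = mink R N.
Proof. by rewrite /mink tr_block_mx !trmx0 raddfN/= !trmx1. Qed.

Lemma ip_eucl (N : nat) (v w : 'rV[R]_N) : ip (eucl R N) v w = \sum_k v 0 k * w 0 k.
Proof. by rewrite /ip mulmx1 mxE; apply: eq_bigr => k _; rewrite mxE. Qed.

Lemma ip_mink (N : nat) (v w : 'rV[R]_(1 + N)) :
  ip (mink R N) v w = - (v 0 ord0 * w 0 ord0) + ip (eucl R N) (rsubmx v) (rsubmx w).
Proof.
rewrite ip_eucl /ip -{1}(hsubmxK v) -{1}(hsubmxK w) /mink tr_row_mx.
rewrite mul_row_block mul_row_col !mulmx0 addr0 add0r mulmx1 mulmxN mulmx1 mulNmx.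
rewrite !mxE big_ord1 !mxE; congr (- (v 0 _ * w 0 _) + _); try exact: val_inj.
by apply: eq_bigr => k _; rewrite !mxE.
Qed.

Lemma row_mx_ord0 (N : nat) (a : 'rV[R]_1) (b : 'rV[R]_N) : row_mx a b 0 ord0 = a 0 0.
Proof. by rewrite -(row_mxEl a b 0 0); congr (row_mx a b 0 _); exact: val_inj. Qed.

Definition space_part (N : nat) : 'M[R]_(1 + N, N) := col_mx 0 1%:M.

Lemma space_partE (N : nat) (v : 'rV[R]_(1 + N)) : v *m space_part N = rsubmx v.
Proof. by rewrite -{1}(hsubmxK v) mul_row_col mulmx0 mulmx1 add0r. Qed.

Lemma ip_space_part (N : nat) (v w : 'rV[R]_(1 + N)) : v 0 ord0 = 0 ->
  ip (eucl R N) (v *m space_part N) (w *m space_part N) = ip (mink R N) v w.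
Proof. by move=> v0; rewrite ip_mink !space_partE v0 mul0r oppr0 add0r. Qed.

End MinkowskiForm.

(** * The factor rho of a spherical immersion with a given null lift *)

Section MoebiusRho.
Variables (R : realType) (m N : nat) (D : set 'rV[R]_m).
Variables (Z : 'rV[R]_m -> 'rV[R]_(1 + N)) (phi : 'rV[R]_m -> R) (x : 'rV[R]_m -> 'rV[R]_N).
Local Notation J := (mink R N).
Local Notation Je := (eucl R N).
Local Notation K := (space_part R N).
Local Notation d := (@dpart R m _).
Hypotheses (Do : open D) (sZ : smooth_on D Z) (sphi : smooth_on D phi).
Hypotheses (phi_gt0 : forall u, D u -> 0 < phi u) (m1 : (1 < m)%N).
Hypothesis ZZ : forall u, D u -> ip J (Z u) (Z u) = 0.
Hypothesis Gu : forall u, D u -> metric J Z u \in unitmx.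
Hypothesis xE : forall u, D u -> phi u *: Z u = row_mx 1%:M (x u).
Local Notation X := (rescaled Z phi).

Let Js := mink_sym R N.
Let Jes := eucl_sym R N.
Let m0 : (0 < m)%N := ltnW m1.
Let phi0 u (Du : D u) : phi u != 0 := lt0r_neq0 (phi_gt0 Du).
Let sX : smooth_on D X := smooth_rescaled Do sZ sphi.

Let xXK u : D u -> x u = X u *m K.
Proof. by move=> Du; rewrite space_partE /rescaled xE// row_mxKr. Qed.

Let sx : smooth_on D x.
Proof.
apply: (eq_smooth_on Do (f := fun u => X u *m K)); first by move=> w /xXK.
exact: smooth_mulmxr.
Qed.

Let dx i u : D u -> d i x u = d i X u *m K.
Proof.
move=> Du; rewrite (eq_pd_on Do (g := fun w => X w *m K))//.
exact: (pd_mulmxr Do K i sX Du).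
Qed.

Let ddx i j u : D u -> d i (d j x) u = d i (d j X) u *m K.
Proof.
move=> Du; rewrite (eq_pd_on Do (g := fun w => d j X w *m K)); [|by []|by move=> w /dx].
exact: (pd_mulmxr Do K i (smooth_pd j sX) Du).
Qed.

Let dX0 i u : D u -> d i X u 0 ord0 = 0.
Proof.
move=> Du; rewrite (pd_coord i ord0 sX Du) (eq_pd_on Do (g := fun=> (1 : R))) ?pd_cst// => w Dw.
by rewrite /rescaled xE// row_mx_ord0 mxE.
Qed.

Let ddX0 i j u : D u -> d i (d j X) u 0 ord0 = 0.
Proof.
move=> Du; rewrite (pd_coord i ord0 (smooth_pd j sX) Du).
by rewrite (eq_pd_on Do (g := fun=> (0 : R))) ?pd_cst// => w Dw; exact: dX0.
Qed.

Let metric_x u : D u -> metric Je x u = metric J X u.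
Proof.
move=> Du; apply/matrixP => i j; rewrite (metricE _ sx)// (metricE _ sX)// !dx//.
by rewrite ip_space_part// dX0.
Qed.

Let metric_x_unit u : D u -> metric Je x u \in unitmx.
Proof. by move=> Du; rewrite metric_x//; exact: (metric_rescaled_unit Js Do sZ sphi phi0 ZZ Gu). Qed.

Let metric_X_unit u : D u -> metric J X u \in unitmx.
Proof. by move=> Du; exact: (metric_rescaled_unit Js Do sZ sphi phi0 ZZ Gu). Qed.

Let second_form_X0 i j u : D u -> second_form J X i j u 0 ord0 = 0.
Proof.
move=> Du; rewrite second_formE !mxE ddX0// sub0r summxE big1 ?oppr0// => k _.
by rewrite mxE dX0// mulr0.
Qed.

Let second_form_xK i j u : D u ->
  d i (d j x) u - \sum_k gam J X k i j u *: d k x u = second_form J X i j u *m K.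
Proof.
move=> Du; rewrite second_formE mulmxBl ddx//; congr (_ - _).
by rewrite mulmx_suml; apply: eq_bigr => k _; rewrite dx// scalemxAl.
Qed.

Let second_form_x i j u : D u -> second_form Je x i j u = second_form J X i j u *m K.
Proof.
move=> Du; rewrite -second_form_xK// second_formE; congr (_ - _).
apply: eq_bigr => k _; congr (_ *: _).
apply: (christoffel_uniq Jes Do sx metric_x_unit (c := fun k => gam J X k i j u) Du) => l.
rewrite second_form_xK// dx// ip_space_part ?second_form_X0//.
exact: (second_form_orth Js Do sX metric_X_unit).
Qed.

Let xx u : D u -> ip Je (x u) (x u) = 1.
Proof.
move=> Du; have : ip J (X u) (X u) = 0 by rewrite ipZl ipZr ZZ// !mulr0.
rewrite ip_mink -!space_partE -xXK// /rescaled xE//.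
by rewrite row_mx_ord0 mxE mulr1 => /eqP; rewrite addrC subr_eq0 => /eqP.
Qed.

(** [X = (1, x)] has constant time coordinate, so the derivatives of [X] and [x] have the same
    scalar products and their second forms have the same trace-free norm. Passing to the second
    fundamental form inside the unit sphere adds a multiple of the metric, which changes the trace
    part only. *)
Lemma sphere_tracefree2 u : D u ->
  sff_norm2 Je x u - m%:R * ip Je (mean_curvature Je x u) (mean_curvature Je x u) =
  (phi u ^+ 2)^-1 * tracefree2 J (imetric J Z u) (fun i j => second_form J Z i j u).
Proof.
move=> Du.
have mR : (m%:R : R) != 0 by rewrite pnatr_eq0 -lt0n.
rewrite -(tracefree2_rescaled Js Do sZ sphi phi0 ZZ m0 Gu Du).
pose T i j := second_form Je x i j u; pose h i j := hsff Je x i j u.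
pose gi := imetric Je x u; pose g := metric Je x u.
have gs i j : g i j = g j i by exact: metricC.
have gis i j : gi i j = gi j i by exact: invmetricC.
have gK i j : \sum_k gi i k * g k j = (i == j)%:R by exact: (metricK metric_x_unit).
have n10 : (1 : R) != 0 by exact: oner_neq0.
have e1 : tnorm2 Je gi T = tnorm2 Je gi h + m%:R.
  rewrite (@tnorm2_split _ _ _ Je gi h T (fun i j k l => g i j * g k l)).
    by rewrite (contract_gi gis gK) (trace_gi gs gK).
  move=> i j k l.
  by rewrite /T (ip_second_form Jes Do sx n10 xx metric_x_unit)// divr1.
have e2 : ttrace gi h = ttrace gi T + m%:R *: x u.
  rewrite -(trace_gi gs gK) -ttrace_tensor -ttraceD; congr ttrace.
  apply/funext => i; apply/funext => j.
  by rewrite /h (sffE Jes Do sx n10 xx metric_x_unit)// divr1.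
have e3 : ip Je (ttrace gi T) (x u) = - m%:R.
  rewrite -(trace_gi gs gK) -sumrN ip_suml; apply: eq_bigr => i _.
  rewrite -sumrN ip_suml; apply: eq_bigr => j _.
  by rewrite ipZl (second_form_quadric Jes Do sx xx)// mulrN.
have -> : sff_norm2 Je x u = tnorm2 Je gi h.
  by rewrite /sff_norm2 induced_metricE imetricE hsffE.
have -> : mean_curvature Je x u = m%:R^-1 *: ttrace gi h.
  by rewrite /mean_curvature induced_metricE imetricE hsffE.
have -> : tracefree2 J (imetric J X u) (fun i j => second_form J X i j u) = tracefree2 Je gi T.
  have ipT i j k l : ip Je (T i j) (T k l) =
      ip J (second_form J X i j u) (second_form J X k l u).
    by rewrite /T !second_form_x// ip_space_part// second_form_X0.
  have -> : imetric J X u = gi by rewrite /gi -!imetricE metric_x.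
  rewrite /tracefree2; congr (_ - _ * _).
    rewrite /tnorm2; apply: eq_bigr => i _; apply: eq_bigr => j _; apply: eq_bigr => k _.
    by apply: eq_bigr => l _; rewrite ipT.
  rewrite /ttrace !ip_suml; apply: eq_bigr => i _; rewrite !ip_suml; apply: eq_bigr => j _.
  rewrite !ip_sumr; apply: eq_bigr => k _; rewrite !ip_sumr; apply: eq_bigr => l _.
  by rewrite !ipZl !ipZr ipT.
rewrite /tracefree2 e1 e2 !(ipDl, ipDr, ipZl, ipZr) xx// e3 (ipC (x u))// e3.
by field.
Qed.

Lemma moebius_rhoE u : D u ->
  tracefree2 J (imetric J Z u) (fun i j => second_form J Z i j u) = (m%:R - 1) / m%:R ->
  moebius_rho x u = (phi u)^-1.
Proof.
move=> Du tf; rewrite /moebius_rho sphere_tracefree2// tf.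
have mR : (m%:R : R) != 0 by rewrite pnatr_eq0 -lt0n.
have m1R : (m%:R - 1 : R) != 0 by rewrite subr_eq0 pnatr_eq1 neq_ltn m1 orbT.
have -> : m%:R / (m%:R - 1) * ((phi u ^+ 2)^-1 * ((m%:R - 1) / m%:R)) = (phi u)^-1 ^+ 2.
  by field; rewrite phi0// mR m1R.
by rewrite sqrtr_sqr ger0_norm// invr_ge0 ltW// phi_gt0.
Qed.

Lemma moebius_YE u : D u ->
  tracefree2 J (imetric J Z u) (fun i j => second_form J Z i j u) = (m%:R - 1) / m%:R ->
  moebius_Y x u = Z u.
Proof.
move=> Du tf; rewrite /moebius_Y moebius_rhoE// -xE// scalerA mulVf ?scale1r//.
exact: phi0.
Qed.

End MoebiusRho.

Lemma eigenvalue_diag (F : fieldType) (m : nat) (d : 'rV[F]_m) (a : F) :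
  eigenvalue (diag_mx d) a <-> exists i, a = d 0 i.
Proof.
split=> [/eigenvalueP[v va vn0]|[i ->]].
  have [i vi] : exists i, v 0 i != 0.
    apply/existsP; apply: contraNT vn0; rewrite negb_exists => /forallP h.
    by apply/eqP/rowP => i; rewrite mxE; apply/eqP; have := h i; rewrite negbK.
  exists i; have := congr1 (fun M : 'rV_m => M 0 i) va.
  rewrite mul_mx_diag !mxE [RHS]mulrC => /(mulfI vi) ->.
  by [].
apply/eigenvalueP; exists (delta_mx 0 i).
  apply/rowP => j; rewrite mul_mx_diag !mxE /= mulrC.
  by have [->|] := eqVneq j i; rewrite ?mulr0.
apply/eqP => /rowP/(_ i); rewrite !mxE !eqxx => /eqP.
by rewrite oner_eq0.
Qed.

(** * Moebius form, Blaschke tensor and derivative of B for a product *)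

Section MoebiusProduct.
Variables (R : realType) (m N : nat) (D : set 'rV[R]_m) (x : 'rV[R]_m -> 'rV[R]_N).
Variables (Yc : 'I_3 -> 'rV[R]_m -> 'rV[R]_(1 + N)) (blk : 'I_m -> 'I_3).
Variables (kap lam : 'I_3 -> R) (phi : 'rV[R]_m -> R) (S : R).
Local Notation J := (mink R N).
Local Notation d := (@dpart R m _).
Hypotheses (Do : open D) (sYc : forall a, smooth_on D (Yc a)) (m1 : (1 < m)%N).
Hypothesis dYc0 : forall i a u, D u -> blk i != a -> d i (Yc a) u = 0.
Hypothesis kap0 : forall a, kap a != 0.
Hypothesis ipYc : forall a b u, D u ->
  ip J (Yc a u) (Yc b u) = (a == b)%:R / kap a.
Hypothesis sum_kap : \sum_a (kap a)^-1 = 0.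
Hypothesis sum_lam : \sum_a lam a / kap a = 1.
Hypotheses (sphi : smooth_on D phi) (phi_gt0 : forall u, D u -> 0 < phi u).
Hypothesis xE : forall u, D u -> phi u *: (\sum_a Yc a u) = row_mx 1%:M (x u).
Let Y0 u := \sum_a Yc a u.
Hypothesis Gu0 : forall u, D u -> metric J Y0 u \in unitmx.
(** Quantified over [Y] because it is applied to [Y0] and to [moebius_Y x], two functions that are
    shown to agree on [D] only. *)
Hypothesis trace0 : forall Y u, smooth_on D Y -> (forall u, D u -> Y u = Y0 u) ->
  (forall u, D u -> metric J Y u \in unitmx) -> D u ->
  \sum_i \sum_j imetric J Y u i j *: block_form J Y Yc blk kap i j u = 0.
Hypothesis normS : forall u, D u -> \sum_i \sum_j \sum_k \sum_l
  imetric J Y0 u i k * imetric J Y0 u j l *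
    ip J (block_form J Y0 Yc blk kap i j u) (block_form J Y0 Yc blk kap k l u) = S.
Let ma a : R := #|[pred i | blk i == a]|%:R.
(** The left side is the trace-free norm of the second form of [Y0], by [norm_second_form] and the
    squared norm of its trace; this value makes [moebius_rho] equal to [1 / phi]. *)
Hypothesis S_eq : S + \sum_a ma a * kap a - m%:R^-1 * \sum_a kap a * ma a ^+ 2 =
  (m%:R - 1) / m%:R.
(** The coefficients that the definition of [N] yields once the Laplacian of [Y] is
    [- sum_a ma a * kap a * Yc a]. *)
Hypothesis lam_eq : forall a,
  lam a = m%:R^-1 * (ma a * kap a) - (2 * m%:R ^+ 2)^-1 * \sum_b kap b * ma b ^+ 2.

Let Js := mink_sym R N.

Let sum_blk (F : 'I_3 -> R) : \sum_i F (blk i) = \sum_a ma a * F a.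
Proof.
rewrite (partition_big blk xpredT)//=; apply: eq_bigr => a _.
rewrite (eq_bigr (fun=> F a)); last by move=> i /eqP ->.
by rewrite sumr_const -mulr_natl.
Qed.

Let sum_blkv (F : 'I_3 -> 'rV[R]_(1 + N)) : \sum_i F (blk i) = \sum_a ma a *: F a.
Proof.
rewrite (partition_big blk xpredT)//=; apply: eq_bigr => a _.
rewrite (eq_bigr (fun=> F a)); last by move=> i /eqP ->.
by rewrite sumr_const scaler_nat.
Qed.

Let nY u := \sum_a (ma a * kap a) *: Yc a u.

Let traceII Y u : smooth_on D Y -> (forall u, D u -> Y u = Y0 u) ->
  (forall u, D u -> metric J Y u \in unitmx) -> D u ->
  \sum_i \sum_j imetric J Y u i j *: second_form J Y i j u = - nY u.
Proof.
move=> sY YE Gu Du; rewrite (trace_second_form Yc blk kap Js Gu Du) (trace0 sY YE Gu Du) sub0r.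
rewrite (sum_blkv (fun a => kap a *: Yc a u)); congr (- _).
by apply: eq_bigr => a _; rewrite scalerA.
Qed.

Let ip_nY u : D u -> ip J (nY u) (nY u) = \sum_a kap a * ma a ^+ 2.
Proof.
move=> Du; rewrite ip_suml; apply: eq_bigr => a _.
rewrite ip_sumr (bigD1 a)//= ipZl ipZr ipYc// eqxx big1 ?addr0.
  by rewrite /= ?mulr1n; move: (ma a) (kap0 a) => q k0; field.
by move=> b ba; rewrite ipZl ipZr ipYc// eq_sym (negbTE ba) mul0r !mulr0.
Qed.

Let sY0 : smooth_on D Y0.
Proof. exact: smooth_sum. Qed.

Let tf u : D u ->
  tracefree2 J (imetric J Y0 u) (fun i j => second_form J Y0 i j u) = (m%:R - 1) / m%:R.
Proof.
move=> Du; rewrite /tracefree2 /ttrace (traceII sY0 (fun _ _ => erefl) Gu0 Du).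
rewrite ipNl ipNr opprK ip_nY// /tnorm2.
rewrite (norm_second_form Js Do sY0 sYc (fun _ _ => erefl) dYc0 kap0 ipYc Gu0 Du).
by rewrite normS// sum_blk.
Qed.

Local Notation Z := (moebius_Y x).

Let ZE u : D u -> Z u = Y0 u.
Proof.
move=> Du; apply: (moebius_YE Do sY0 sphi phi_gt0 m1 _ Gu0 xE Du (tf Du)) => w Dw.
exact: (ip_total (fun _ _ => erefl) ipYc sum_kap Dw).
Qed.

Let sZ : smooth_on D Z.
Proof. by apply: eq_smooth_on sY0 => // w /ZE. Qed.

Let metricZ u : D u -> metric J Z u = metric J Y0 u.
Proof.
move=> Du; apply/matrixP => i j; rewrite (metricE J sZ)// (metricE J sY0)//.
by congr ip; apply: (eq_pd_on Do).
Qed.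

Let Gu u : D u -> metric J Z u \in unitmx.
Proof. by move=> Du; rewrite metricZ ?Gu0. Qed.

Let NE u : D u -> moebius_N x u = conormal Yc lam u.
Proof.
move=> Du; rewrite /moebius_N /moebius_metric.
have -> : laplacian (induced_metric J Z) Z u = - nY u.
  rewrite -(traceII sZ ZE Gu Du) /laplacian induced_metricE imetricE gamE -dpartE.
  by apply: eq_bigr => i _; apply: eq_bigr => j _; rewrite second_formE.
rewrite ipNl ipNr opprK ip_nY// scalerN opprK ZE// /Y0 /nY /conormal !scaler_sumr -sumrB.
by apply: eq_bigr => a _; rewrite scalerA -scalerBl lam_eq.
Qed.

Let sN : smooth_on D (moebius_N x).
Proof. by apply: eq_smooth_on (smooth_conormal Do sYc lam) => // w /NE. Qed.

Let pdN i u : D u -> d i (moebius_N x) u = lam (blk i) *: d i Z u.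
Proof.
move=> Du; rewrite (eq_pd_on Do (g := conormal Yc lam))//.
exact: (pd_conormal Do sYc ZE dYc0).
Qed.

Let frameE u : D u -> moebius_frame x u = cone_frame Z Yc lam u.
Proof. by move=> Du; rewrite /moebius_frame NE. Qed.

Lemma moebius_form0 i u : D u -> moebius_form x i u = 0.
Proof.
move=> Du; rewrite /moebius_form frameE// -dpartE pdN// nprojZ.
rewrite (nproj_pd Js Do sZ sYc ZE dYc0 ipYc Gu sum_kap sum_lam _ Du).
by rewrite scaler0.
Qed.

Lemma blaschke_eigenvalueE u a : D u ->
  blaschke_eigenvalue x u a <-> exists i, a = lam (blk i).
Proof.
move=> Du; rewrite /blaschke_eigenvalue.
have -> : blaschke x u *m invmx (moebius_metric x u) = diag_mx (\row_i lam (blk i)).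
  have -> : blaschke x u = diag_mx (\row_i lam (blk i)) *m metric J Z u.
    apply/matrixP => i j; rewrite mul_diag_mx /blaschke -!dpartE !mxE pdN// ipZl.
    by rewrite (metricE J sZ).
  by rewrite /moebius_metric induced_metricE mulmxK ?Gu.
rewrite eigenvalue_diag; split=> -[i ->]; exists i; by rewrite mxE.
Qed.

Lemma moebius_sffE i j u : D u -> moebius_sff x i j u = cone_sff J Z Yc blk kap lam i j u.
Proof.
move=> Du; rewrite /moebius_sff frameE// -dpartE.
exact: (nproj_pd_pd Js Do sZ sYc ZE dYc0 kap0 ipYc Gu sum_kap sum_lam).
Qed.

Lemma nabla_moebius_sffE k i j u : D u ->
  nabla_moebius_sff x k i j u =
  nproj J (cone_frame Z Yc lam u) (d k (block_form J Z Yc blk kap i j) u)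
  - \sum_l (gam J Z l k i u *: block_form J Z Yc blk kap l j u
            + gam J Z l k j u *: block_form J Z Yc blk kap i l u).
Proof.
move=> Du.
rewrite -(nabla_cone_sff Js Do sZ sYc ZE dYc0 kap0 ipYc Gu sum_kap sum_lam _ _ _ Du).
rewrite /nabla_moebius_sff /nabla_normal frameE// -dpartE /moebius_metric induced_metricE gamE.
rewrite (eq_pd_on Do (g := cone_sff J Z Yc blk kap lam i j)); [|by []|]; last first.
  by move=> w Dw; exact: moebius_sffE.
congr (_ - _); by apply: eq_bigr => l _; rewrite !moebius_sffE.
Qed.

Lemma moebius_Y_product :
  [/\ smooth_on D Z, forall u, D u -> Z u = Y0 u & forall u, D u -> metric J Z u \in unitmx].
Proof. by split. Qed.

End MoebiusProduct.

(** * The submanifolds LS *)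

Section ThreeBlocks.
Definition o0 : 'I_3 := @Ordinal 3 0 isT.
Definition o1 : 'I_3 := @Ordinal 3 1 isT.
Definition o2 : 'I_3 := @Ordinal 3 2 isT.

Lemma forall3 (P : 'I_3 -> Prop) : P o0 -> P o1 -> P o2 -> forall a, P a.
Proof.
move=> P0 P1 P2 [[|[|[|//]]] h].
- by rewrite (_ : Ordinal h = o0)//; exact: val_inj.
- by rewrite (_ : Ordinal h = o1)//; exact: val_inj.
- by rewrite (_ : Ordinal h = o2)//; exact: val_inj.
Qed.

Lemma sum3 (V : nmodType) (F : 'I_3 -> V) : \sum_a F a = F o0 + F o1 + F o2.
Proof.
rewrite !big_ord_recl big_ord0 addr0 addrA.
by congr (F _ + F _ + F _); exact: val_inj.
Qed.

Definition sel3 (T : Type) (x y z : T) (a : 'I_3) : T :=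
  match val a with 0%N => x | 1%N => y | _ => z end.

Variables m1 m2 m3 : nat.
Local Notation m := (m1 + m2 + m3)%N.

Definition blk3 (k : 'I_m) : 'I_3 :=
  match fintype.split k with
  | inl k' => if fintype.split k' is inl _ then o0 else o1
  | inr _ => o2
  end.

Definition io1 (i : 'I_m1) : 'I_m := lshift m3 (lshift m2 i).
Definition io2 (i : 'I_m2) : 'I_m := lshift m3 (rshift m1 i).
Definition io3 (i : 'I_m3) : 'I_m := rshift (m1 + m2) i.

Lemma blk_io1 i : blk3 (io1 i) = o0.
Proof. by rewrite /blk3 (unsplitK (inl (lshift m2 i))) (unsplitK (inl i)). Qed.
Lemma blk_io2 i : blk3 (io2 i) = o1.
Proof. by rewrite /blk3 (unsplitK (inl (rshift m1 i))) (unsplitK (inr i)). Qed.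
Lemma blk_io3 i : blk3 (io3 i) = o2.
Proof. by rewrite /blk3 (unsplitK (inr i)). Qed.

Lemma blk3P (P : 'I_m -> Prop) : (forall i, P (io1 i)) -> (forall i, P (io2 i)) ->
  (forall i, P (io3 i)) -> forall k, P k.
Proof.
move=> h1 h2 h3 k; case: (split_ordP k) => [k' ->|i ->]; last exact: h3.
by case: (split_ordP k') => i ->; [exact: h1|exact: h2].
Qed.

Lemma onto_io1 k : blk3 k = o0 -> exists i, k = io1 i.
Proof.
move: k; apply: blk3P => i; [by exists i|by rewrite blk_io2|by rewrite blk_io3].
Qed.
Lemma onto_io2 k : blk3 k = o1 -> exists i, k = io2 i.
Proof.
move: k; apply: blk3P => i; [by rewrite blk_io1|by exists i|by rewrite blk_io3].
Qed.
Lemma onto_io3 k : blk3 k = o2 -> exists i, k = io3 i.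
Proof.
move: k; apply: blk3P => i; [by rewrite blk_io1|by rewrite blk_io2|by exists i].
Qed.

Variable R : realType.

Lemma card_blk3 a : (#|[pred i | blk3 i == a]|)%:R = sel3 m1%:R m2%:R m3%:R a :> R.
Proof.
rewrite -sum1_card natr_sum big_mkcond/= !big_split_ord/=.
under eq_bigr do rewrite inE blk_io1.
under [X in _ + X + _]eq_bigr do rewrite inE blk_io2.
under [X in _ + X]eq_bigr do rewrite inE blk_io3.
rewrite !sumr_const !card_ord; move: a; apply: forall3 => /=;
  by rewrite ?mul0rn ?addr0 ?add0r.
Qed.

Definition pr1 : 'M[R]_(m, m1) := col_mx (col_mx 1%:M 0) 0.
Definition pr2 : 'M[R]_(m, m2) := col_mx (col_mx 0 1%:M) 0.
Definition pr3 : 'M[R]_(m, m3) := col_mx 0 1%:M.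

Lemma mul_pr1 (u : 'rV[R]_m) : u *m pr1 = lsubmx (lsubmx u).
Proof.
rewrite -{1}(hsubmxK u) -{1}(hsubmxK (lsubmx u)) /pr1 !mul_row_col !mulmx0 mulmx1.
by rewrite !addr0.
Qed.
Lemma mul_pr2 (u : 'rV[R]_m) : u *m pr2 = rsubmx (lsubmx u).
Proof.
rewrite -{1}(hsubmxK u) -{1}(hsubmxK (lsubmx u)) /pr2 !mul_row_col !mulmx0 mulmx1.
by rewrite add0r addr0.
Qed.
Lemma mul_pr3 (u : 'rV[R]_m) : u *m pr3 = rsubmx u.
Proof. by rewrite -{1}(hsubmxK u) /pr3 !mul_row_col !mulmx0 mulmx1 add0r. Qed.

Lemma pr1_io i j : pr1 (io1 i) j = (i == j)%:R.
Proof. by rewrite /pr1 /io1 !col_mxEu mxE. Qed.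
Lemma pr2_io i j : pr2 (io2 i) j = (i == j)%:R.
Proof. by rewrite /pr2 /io2 col_mxEu col_mxEd mxE. Qed.
Lemma pr3_io i j : pr3 (io3 i) j = (i == j)%:R.
Proof. by rewrite /pr3 /io3 col_mxEd mxE. Qed.

Lemma pr1_off k j : blk3 k != o0 -> pr1 k j = 0.
Proof.
move: k; apply: blk3P => i; rewrite ?blk_io1// => _.
  by rewrite /pr1 /io2 col_mxEu col_mxEd mxE.
by rewrite /pr1 /io3 col_mxEd mxE.
Qed.
Lemma pr2_off k j : blk3 k != o1 -> pr2 k j = 0.
Proof.
move: k; apply: blk3P => i; rewrite ?blk_io2// => _.
  by rewrite /pr2 /io1 !col_mxEu mxE.
by rewrite /pr2 /io3 col_mxEd mxE.
Qed.
Lemma pr3_off k j : blk3 k != o2 -> pr3 k j = 0.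
Proof.
by move: k; apply: blk3P => i; rewrite ?blk_io3// => _; rewrite /pr3 /io1 /io2 col_mxEu mxE.
Qed.

End ThreeBlocks.

(** * Orthogonal embeddings of the three ambient spaces; the first one carries the time direction *)

Section Embeddings.
Variables (R : realType) (n1 N2 N3 : nat).
Local Notation N := (n1 + N2 + N3)%N.

Definition em1 : 'M[R]_(1 + n1, 1 + N) :=
  row_mx (col_mx 1%:M 0) (row_mx (row_mx (col_mx 0 1%:M) 0) 0).
Definition em2 : 'M[R]_(N2, 1 + N) := row_mx 0 (row_mx (row_mx 0 1%:M) 0).
Definition em3 : 'M[R]_(N3, 1 + N) := row_mx 0 (row_mx 0 1%:M).

Lemma mul_mink (k l : nat) (a : 'M[R]_(k, 1)) (b : 'M[R]_(k, N)) (a' : 'M[R]_(l, 1)) (b' : 'M[R]_(l, N)) :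
  row_mx a b *m mink R N *m (row_mx a' b')^T = - (a *m a'^T) + b *m b'^T.
Proof.
rewrite /mink mul_row_block !mulmx0 addr0 add0r tr_row_mx mul_row_col.
by rewrite mulmxN mulmx1 mulmx1 mulNmx.
Qed.

Let trE := (tr_row_mx, tr_col_mx, trmx0, trmx1).

Lemma em11 : em1 *m mink R N *m em1^T = mink R n1.
Proof.
rewrite mul_mink !trE !mul_row_col !mulmx0 !addr0 !mul_col_row !mulmx1 !mul0mx !mulmx0.
by rewrite /mink opp_block_mx add_block_mx !oppr0 !addr0 add0r.
Qed.
Lemma em22 : em2 *m mink R N *m em2^T = eucl R N2.
Proof. by rewrite mul_mink !trE !mul_row_col !mulmx0 mulmx1 oppr0 !addr0 !add0r. Qed.
Lemma em33 : em3 *m mink R N *m em3^T = eucl R N3.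
Proof. by rewrite mul_mink !trE !mul_row_col !mulmx0 mulmx1 oppr0 !add0r. Qed.
Lemma em12 : em1 *m mink R N *m em2^T = 0.
Proof. by rewrite mul_mink !trE !mul_row_col !mulmx0 mul0mx oppr0 !addr0. Qed.
Lemma em13 : em1 *m mink R N *m em3^T = 0.
Proof. by rewrite mul_mink !trE !mul_row_col !mulmx0 mul0mx oppr0 !addr0. Qed.
Lemma em23 : em2 *m mink R N *m em3^T = 0.
Proof. by rewrite mul_mink !trE !mul_row_col !mulmx0 mul0mx oppr0 !addr0. Qed.
Lemma em21 : em2 *m mink R N *m em1^T = 0.
Proof. by rewrite -[RHS]trmx0 -em12 !trmx_mul trmxK mink_sym mulmxA. Qed.
Lemma em31 : em3 *m mink R N *m em1^T = 0.
Proof. by rewrite -[RHS]trmx0 -em13 !trmx_mul trmxK mink_sym mulmxA. Qed.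
Lemma em32 : em3 *m mink R N *m em2^T = 0.
Proof. by rewrite -[RHS]trmx0 -em23 !trmx_mul trmxK mink_sym mulmxA. Qed.

Lemma sum_em (v : 'rV[R]_(1 + n1)) (w : 'rV[R]_N2) (z : 'rV[R]_N3) :
  v *m em1 + w *m em2 + z *m em3 =
  row_mx (lsubmx v) (row_mx (row_mx (rsubmx v) w) z).
Proof.
rewrite -{1}(hsubmxK v) /em1 /em2 /em3 !mul_mx_row !mul_row_col !mulmx0 !mulmx1.
by rewrite !(add_row_mx, addr0, add0r).
Qed.

Lemma minkK (n : nat) : mink R n *m mink R n = 1%:M.
Proof.
rewrite /mink mulmx_block !mulmx0 !mul0mx !addr0 !add0r mulmxN mulmx1 opprK mulmx1.
by rewrite -scalar_mx_block.
Qed.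
End Embeddings.

Lemma continuous_mulmxr (R : realType) (m n : nat) (P : 'M[R]_(m, n)) :
  continuous (fun u : 'rV[R]_m => u *m P).
Proof.
move=> u; apply: differentiable_continuous.
by apply: (differentiable_pullback (F := fun w => w)).
Qed.

Lemma open_pullback (R : realType) (m n : nat) (P : 'M[R]_(m, n)) (D : set 'rV[R]_n) :
  open D -> open [set u : 'rV[R]_m | D (u *m P)].
Proof.
move=> Do; apply: (open_comp (f := fun u : 'rV[R]_m => u *m P)) => // u _.
exact: continuous_mulmxr.
Qed.

Lemma mulmxr_inj (R : realType) (k N : nat) (J' : 'M[R]_k) (J : 'M[R]_N) (E : 'M[R]_(k, N))
  (v : 'rV[R]_k) :
  E *m J *m E^T = J' -> J' \in unitmx -> v *m E = 0 -> v = 0.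
Proof.
move=> EJE uJ vE; have vJ : v *m J' = 0 by rewrite -EJE !mulmxA vE !mul0mx.
by rewrite -(mulmxK uJ v) vJ mul0mx.
Qed.

(** * The submanifolds LS in one product chart *)

Section LSProduct.
Variables (R : realType) (m1 m2 m3 n1 N2 N3 : nat).
Local Notation m := (m1 + m2 + m3)%N.
Local Notation N := (n1 + N2 + N3)%N.
Local Notation J := (mink R N).
Variables (r1 r2 r3 mu1 mu2 mu3 l1 l2 l3 b1 b2 b3 : R).
Variables (D1 : set 'rV[R]_m1) (D2 : set 'rV[R]_m2) (D3 : set 'rV[R]_m3).
Variables (f1 : 'rV[R]_m1 -> 'rV[R]_(1 + n1)) (f2 : 'rV[R]_m2 -> 'rV[R]_N2)
  (f3 : 'rV[R]_m3 -> 'rV[R]_N3).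
Hypotheses (hm1 : (0 < m1)%N) (hm2 : (0 < m2)%N) (hm3 : (0 < m3)%N).
Hypotheses (hr1 : 0 < r1) (hr2 : 0 < r2) (hr3 : 0 < r3) (hr : r1 ^+ 2 = r2 ^+ 2 + r3 ^+ 2).
Hypothesis hmu : mu1 + mu2 + mu3 = 1.
Hypothesis hl : LS_lambda m1 m2 m3 r1 r2 r3 l1 l2 l3.
Hypothesis hb : LS_B0 m1 m2 m3 l1 l2 l3 b1 b2 b3.
Hypotheses (Do1 : open D1) (Do2 : open D2) (Do3 : open D3).
Hypotheses (sf1 : smooth_on D1 f1) (sf2 : smooth_on D2 f2) (sf3 : smooth_on D3 f3).
Hypothesis (Gu1 : forall u, D1 u -> metric (mink R n1) f1 u \in unitmx).
Hypothesis (Gu2 : forall u, D2 u -> metric (eucl R N2) f2 u \in unitmx).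
Hypothesis (Gu3 : forall u, D3 u -> metric (eucl R N3) f3 u \in unitmx).
Hypothesis (q1 : forall u, D1 u -> ip (mink R n1) (f1 u) (f1 u) = - r1 ^+ 2).
Hypothesis (q2 : forall u, D2 u -> ip (eucl R N2) (f2 u) (f2 u) = r2 ^+ 2).
Hypothesis (q3 : forall u, D3 u -> ip (eucl R N3) (f3 u) (f3 u) = r3 ^+ 2).
Hypothesis (pos1 : forall u, D1 u -> 0 < f1 u 0 ord0).
Hypothesis (min1 : forall u, D1 u -> mean_curvature (mink R n1) f1 u = 0).
Hypothesis (min2 : forall u, D2 u -> mean_curvature (eucl R N2) f2 u = 0).
Hypothesis (min3 : forall u, D3 u -> mean_curvature (eucl R N3) f3 u = 0).
Local Notation KK := (LS_K m1 m2 m3 b1 b2 b3).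
Hypothesis (sc1 : forall u, D1 u -> scalar_curvature (induced_metric (mink R n1) f1) u =
  - (m1%:R * (m1%:R - 1) / r1 ^+ 2) + mu1 * KK).
Hypothesis (sc2 : forall u, D2 u -> scalar_curvature (induced_metric (eucl R N2) f2) u =
  m2%:R * (m2%:R - 1) / r2 ^+ 2 + mu2 * KK).
Hypothesis (sc3 : forall u, D3 u -> scalar_curvature (induced_metric (eucl R N3) f3) u =
  m3%:R * (m3%:R - 1) / r3 ^+ 2 + mu3 * KK).

Let P1 : 'M[R]_(m, m1) := pr1 m1 m2 m3 R.
Let P2 : 'M[R]_(m, m2) := pr2 m1 m2 m3 R.
Let P3 : 'M[R]_(m, m3) := pr3 m1 m2 m3 R.
Let E1 := em1 R n1 N2 N3.
Let E2 := em2 R n1 N2 N3.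
Let E3 := em3 R n1 N2 N3.
Let i1 := @io1 m1 m2 m3.
Let i2 := @io2 m1 m2 m3.
Let i3 := @io3 m1 m2 m3.
Let blk := @blk3 m1 m2 m3.
Let D : set 'rV[R]_m :=
  [set u | D1 (u *m P1)] `&` ([set u | D2 (u *m P2)] `&` [set u | D3 (u *m P3)]).
Let Yc : 'I_3 -> 'rV[R]_m -> 'rV[R]_(1 + N) :=
  sel3 (fun u => f1 (u *m P1) *m E1) (fun u => f2 (u *m P2) *m E2) (fun u => f3 (u *m P3) *m E3).
(** The sectional curvatures of the three quadrics; their inverses are the squared norms of the
    position vectors. *)
Let kap : 'I_3 -> R := sel3 (- (r1 ^+ 2)^-1) (r2 ^+ 2)^-1 (r3 ^+ 2)^-1.
Let lam : 'I_3 -> R := sel3 l1 l2 l3.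
Let phi (u : 'rV[R]_m) : R := (f1 (u *m P1) 0 ord0)^-1.
Let Y0 u := \sum_a Yc a u.
Let x (u : 'rV[R]_m) : 'rV[R]_N := (f1 (u *m P1) 0 ord0)^-1 *:
  row_mx (row_mx (rsubmx (f1 (u *m P1))) (f2 (u *m P2))) (f3 (u *m P3)).
Let Js := mink_sym R N.
Let Js1 := mink_sym R n1.
Let Js2 := eucl_sym R N2.
Let Js3 := eucl_sym R N3.
Local Notation d := (@dpart R m _).

Let Do : open D.
Proof. by apply: openI; [|apply: openI]; exact: open_pullback. Qed.

Let DP1 u : D u -> D1 (u *m P1). Proof. by case. Qed.
Let DP2 u : D u -> D2 (u *m P2). Proof. by case=> _ []. Qed.
Let DP3 u : D u -> D3 (u *m P3). Proof. by case=> _ []. Qed.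

Let sYc a : smooth_on D (Yc a).
Proof.
by move: a; apply: forall3; apply: (smooth_mulmxr Do);
  [exact: (smooth_pullback Do Do1 DP1)|exact: (smooth_pullback Do Do2 DP2)
  |exact: (smooth_pullback Do Do3 DP3)].
Qed.

Let pd_off (k n : nat) (D' : set 'rV[R]_k) (P : 'M[R]_(m, k)) (E : 'M[R]_(n, 1 + N))
    (F : 'rV[R]_k -> 'rV[R]_n) i u :
  open D' -> (forall u, D u -> D' (u *m P)) -> smooth_on D' F ->
  (forall j, P i j = 0) -> D u -> d i (fun w => F (w *m P) *m E) u = 0.
Proof.
move=> Do' DP sF P0 Du; rewrite (pd_mulmxr Do E i (smooth_pullback Do Do' DP sF) Du).
rewrite pd_pullback; last exact: smooth_diff sF (DP _ Du).
by rewrite big1 ?mul0mx// => l _; rewrite P0 scale0r.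
Qed.

Let dYc0 i a u : D u -> blk i != a -> d i (Yc a) u = 0.
Proof.
move=> Du; move: a; apply: forall3 => ia.
- by apply: (pd_off E1 Do1 DP1 sf1) => // j; exact: pr1_off.
- by apply: (pd_off E2 Do2 DP2 sf2) => // j; exact: pr2_off.
- by apply: (pd_off E3 Do3 DP3 sf3) => // j; exact: pr3_off.
Qed.

Let r10 : r1 != 0. Proof. exact: lt0r_neq0. Qed.
Let r20 : r2 != 0. Proof. exact: lt0r_neq0. Qed.
Let r30 : r3 != 0. Proof. exact: lt0r_neq0. Qed.

Let kap0 a : kap a != 0.
Proof.
by move: a; apply: forall3; rewrite /kap /sel3 /= ?oppr_eq0 invr_eq0 expf_neq0.
Qed.

Let ip_em (k l : nat) (Jk : 'M[R]_(k, l)) (E : 'M[R]_(k, 1 + N)) (F : 'M[R]_(l, 1 + N)) v w :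
  E *m J *m F^T = Jk -> ip J (v *m E) (w *m F) = (v *m Jk *m w^T) 0 0.
Proof. by move=> <-; rewrite /ip trmx_mul !mulmxA. Qed.

Let ipYc a b u : D u -> ip J (Yc a u) (Yc b u) = (a == b)%:R / kap a.
Proof.
move=> Du; move: a b; apply: forall3; apply: forall3; rewrite /Yc /sel3 /=.
- by rewrite (ip_em _ _ (em11 _ _ _ _)) mul1r invrN invrK -(q1 (DP1 Du)).
- by rewrite (ip_em _ _ (em12 _ _ _ _)) mulmx0 mul0mx mxE mul0r.
- by rewrite (ip_em _ _ (em13 _ _ _ _)) mulmx0 mul0mx mxE mul0r.
- by rewrite (ip_em _ _ (em21 _ _ _ _)) mulmx0 mul0mx mxE mul0r.
- by rewrite (ip_em _ _ (em22 _ _ _ _)) mul1r invrK -(q2 (DP2 Du)).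
- by rewrite (ip_em _ _ (em23 _ _ _ _)) mulmx0 mul0mx mxE mul0r.
- by rewrite (ip_em _ _ (em31 _ _ _ _)) mulmx0 mul0mx mxE mul0r.
- by rewrite (ip_em _ _ (em32 _ _ _ _)) mulmx0 mul0mx mxE mul0r.
- by rewrite (ip_em _ _ (em33 _ _ _ _)) mul1r invrK -(q3 (DP3 Du)).
Qed.

Let sum_kap : \sum_a (kap a)^-1 = 0.
Proof. by rewrite sum3 /kap /sel3 /= invrN !invrK hr; ring. Qed.

Let mR : (m1%:R + m2%:R + m3%:R : R) != 0.
Proof. by rewrite -!natrD pnatr_eq0 -lt0n ltn_addl. Qed.

Let X := - (m1%:R ^+ 2 / r1 ^+ 2) + m2%:R ^+ 2 / r2 ^+ 2 + m3%:R ^+ 2 / r3 ^+ 2.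
Let M : R := m1%:R + m2%:R + m3%:R.

(** With [s] the sum of the [m_a l_a], each equation reads [M l_a + s = m_a kap_a]. Adding them with
    weights [m_a] gives [2 M s = X]. *)
Let lamE : [/\ l1 = M^-1 * - (m1%:R / r1 ^+ 2) - (2 * M ^+ 2)^-1 * X,
  l2 = M^-1 * (m2%:R / r2 ^+ 2) - (2 * M ^+ 2)^-1 * X &
  l3 = M^-1 * (m3%:R / r3 ^+ 2) - (2 * M ^+ 2)^-1 * X].
Proof.
have [e1 e2 e3] := hl; move: e1 e2 e3; rewrite !natrD -/M => e1 e2 e3.
set s := m1%:R * l1 + m2%:R * l2 + m3%:R * l3.
have e1' : M * l1 = - (m1%:R / r1 ^+ 2) - s by rewrite -e1 /s; ring.
have e2' : M * l2 = m2%:R / r2 ^+ 2 - s by rewrite -e2 /s; ring.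
have e3' : M * l3 = m3%:R / r3 ^+ 2 - s by rewrite -e3 /s; ring.
have sX : s = X / (2 * M).
  have : 2 * M * s = X.
    have : M * s = m1%:R * (M * l1) + m2%:R * (M * l2) + m3%:R * (M * l3) by rewrite /s; ring.
    rewrite e1' e2' e3' => h.
    have h2 : M * s = X - M * s.
      by rewrite [LHS]h /X /M; field; rewrite r10 r20 r30.
    have -> : 2 * M * s = M * s + M * s by ring.
    by rewrite {1}h2 subrK.
  by move=> <-; field.
rewrite sX in e1' e2' e3'.
by split; apply: (mulfI mR); rewrite -/M ?e1' ?e2' ?e3'; field; rewrite ?r10 ?r20 ?r30 ?mR.
Qed.

Let mM : (m%:R : R) = M. Proof. by rewrite !natrD. Qed.

Let m_gt1 : (1 < m)%N.
Proof. by rewrite (leq_ltn_trans _ (leq_add (leq_add hm1 hm2) hm3)). Qed.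

Let maE a : #|[pred i | blk i == a]|%:R = sel3 m1%:R m2%:R m3%:R a :> R.
Proof. exact: card_blk3. Qed.

Let sum_lam : \sum_a lam a / kap a = 1.
Proof.
have [e1 e2 e3] := lamE; rewrite sum3 /lam /kap /sel3 /= invrN !invrK e1 e2 e3 hr.
have r23 : r2 ^+ 2 + r3 ^+ 2 != 0 by rewrite -hr expf_neq0.
by rewrite /M; field; rewrite mR r20 r30 r23.
Qed.

Let lam_eq a : lam a = m%:R^-1 * (#|[pred i | blk i == a]|%:R * kap a)
  - (2 * m%:R ^+ 2)^-1 * \sum_b kap b * #|[pred i | blk i == b]|%:R ^+ 2.
Proof.
have -> : \sum_b kap b * #|[pred i | blk i == b]|%:R ^+ 2 = X.
  under eq_bigr do rewrite maE.
  by rewrite sum3 /kap /sel3 /= /X; field; rewrite r10 r20 r30.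
have [e1 e2 e3] := lamE.
by rewrite maE mM; move: a; apply: forall3; rewrite /lam /kap /sel3 /= ?e1 ?e2 ?e3//; ring.
Qed.

Let S_eq : - KK + \sum_a #|[pred i | blk i == a]|%:R * kap a
  - m%:R^-1 * \sum_a kap a * #|[pred i | blk i == a]|%:R ^+ 2 = (m%:R - 1) / m%:R.
Proof.
have -> : \sum_a kap a * #|[pred i | blk i == a]|%:R ^+ 2 = X.
  under eq_bigr do rewrite maE.
  by rewrite sum3 /kap /sel3 /= /X; field; rewrite r10 r20 r30.
under eq_bigr do rewrite maE.
rewrite sum3 /kap /sel3 /= /LS_K mM.
have [c0 c12 c13 c23] := hb.
(* Multiplying [m1 b1 + m2 b2 + m3 b3 = 0] by each [b_a] trades the squares for the products
   [b_a b_b], which are given by the [l_a]; the [b_a] themselves are never solved for. *)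
have s1 : m1%:R * b1 ^+ 2 = m2%:R * (l1 + l2) + m3%:R * (l1 + l3).
  have -> : m1%:R * b1 ^+ 2 = b1 * (m1%:R * b1 + m2%:R * b2 + m3%:R * b3)
     - m2%:R * (b1 * b2) - m3%:R * (b1 * b3) by ring.
  by rewrite c0 c12 c13; ring.
have s2 : m2%:R * b2 ^+ 2 = m1%:R * (l1 + l2) + m3%:R * (l2 + l3).
  have -> : m2%:R * b2 ^+ 2 = b2 * (m1%:R * b1 + m2%:R * b2 + m3%:R * b3)
     - m1%:R * (b1 * b2) - m3%:R * (b2 * b3) by ring.
  by rewrite c0 c12 c23; ring.
have s3 : m3%:R * b3 ^+ 2 = m1%:R * (l1 + l3) + m2%:R * (l2 + l3).
  have -> : m3%:R * b3 ^+ 2 = b3 * (m1%:R * b1 + m2%:R * b2 + m3%:R * b3)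
     - m1%:R * (b1 * b3) - m2%:R * (b2 * b3) by ring.
  by rewrite c0 c13 c23; ring.
rewrite s1 s2 s3; have [e1 e2 e3] := lamE; rewrite e1 e2 e3 /X /M.
by field; rewrite mR r10 r20 r30.
Qed.

Let sphi : smooth_on D phi.
Proof.
apply: (smooth_inv Do); first by move=> u Du; apply: lt0r_neq0; exact: pos1 (DP1 Du).
apply: (smooth_coord Do ord0); exact: (smooth_pullback Do Do1 DP1).
Qed.

Let phi_gt0 u : D u -> 0 < phi u.
Proof. by move=> Du; rewrite invr_gt0; exact: pos1 (DP1 Du). Qed.

Let xE u : D u -> phi u *: (\sum_a Yc a u) = row_mx 1%:M (x u).
Proof.
move=> Du; rewrite sum3 /Yc /sel3 /= sum_em scale_row_mx; congr row_mx.
have p0 : f1 (u *m P1) 0 ord0 != 0 by apply: lt0r_neq0; exact: pos1 (DP1 Du).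
rewrite [lsubmx _]mx11_scalar scale_scalar_mx mxE /phi.
by rewrite (_ : lshift n1 0 = ord0) ?mulVf//; exact: val_inj.
Qed.

Let sY0 : smooth_on D Y0.
Proof. exact: smooth_sum. Qed.

Section AnyTotal.
Variable Y : 'rV[R]_m -> 'rV[R]_(1 + N).
Hypotheses (sY : smooth_on D Y) (YE : forall u, D u -> Y u = Y0 u).

Let y_eps1 v : D1 v -> ip (mink R n1) (f1 v) (f1 v) = (kap o0)^-1.
Proof. by move=> Dv; rewrite q1// /kap /sel3 /= invrN invrK. Qed.
Let y_eps2 v : D2 v -> ip (eucl R N2) (f2 v) (f2 v) = (kap o1)^-1.
Proof. by move=> Dv; rewrite q2// /kap /sel3 /= invrK. Qed.
Let y_eps3 v : D3 v -> ip (eucl R N3) (f3 v) (f3 v) = (kap o2)^-1.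
Proof. by move=> Dv; rewrite q3// /kap /sel3 /= invrK. Qed.

Lemma LS_metric_unit u : D u -> metric J Y u \in unitmx.
Proof.
move=> Du; rewrite -row_free_unit -kermx_eq0; apply/eqP/row_matrixP => i.
rewrite row0; set v := row i _; have vG : v *m metric J Y u = 0.
  by rewrite /v -row_mul mulmx_ker row0.
apply/rowP; apply: blk3P => j; rewrite [RHS]mxE.
- exact: (metric_factor_ker Js Do sY sYc YE dYc0 ipYc Do1 sf1 Gu1 DP1 (@pr1_io m1 m2 m3 R)
    (@blk_io1 m1 m2 m3) (@onto_io1 m1 m2 m3) (em11 R n1 N2 N3) (fun _ _ => erefl) j Du vG).
- exact: (metric_factor_ker Js Do sY sYc YE dYc0 ipYc Do2 sf2 Gu2 DP2 (@pr2_io m1 m2 m3 R)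
    (@blk_io2 m1 m2 m3) (@onto_io2 m1 m2 m3) (em22 R n1 N2 N3) (fun _ _ => erefl) j Du vG).
- exact: (metric_factor_ker Js Do sY sYc YE dYc0 ipYc Do3 sf3 Gu3 DP3 (@pr3_io m1 m2 m3 R)
    (@blk_io3 m1 m2 m3) (@onto_io3 m1 m2 m3) (em33 R n1 N2 N3) (fun _ _ => erefl) j Du vG).
Qed.
Let Gu := LS_metric_unit.

Let mean_trace (k l : nat) (Jk : 'M[R]_l) (g : 'rV[R]_k -> 'rV[R]_l) v : (0 < k)%N ->
  mean_curvature Jk g v = 0 -> ttrace (imetric Jk g v) (fun i j => hsff Jk g i j v) = 0.
Proof.
move=> k0; rewrite /mean_curvature induced_metricE imetricE hsffE => /eqP.
by rewrite scaler_eq0 invr_eq0 pnatr_eq0 eqn0Ngt k0 /= => /eqP.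
Qed.

Lemma LS_trace0 u : D u ->
  \sum_i \sum_j imetric J Y u i j *: block_form J Y Yc blk kap i j u = 0.
Proof.
move=> Du; rewrite (partition_big blk xpredT)//= sum3.
rewrite (trace_factor Js Do sY sYc YE dYc0 kap0 ipYc Gu Js1 Do1 sf1 Gu1 y_eps1 DP1
  (@pr1_io m1 m2 m3 R) (@blk_io1 m1 m2 m3) (@onto_io1 m1 m2 m3) (em11 R n1 N2 N3)
  (fun _ _ => erefl) Du) (mean_trace hm1 (min1 (DP1 Du))) mul0mx add0r.
rewrite (trace_factor Js Do sY sYc YE dYc0 kap0 ipYc Gu Js2 Do2 sf2 Gu2 y_eps2 DP2
  (@pr2_io m1 m2 m3 R) (@blk_io2 m1 m2 m3) (@onto_io2 m1 m2 m3) (em22 R n1 N2 N3)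
  (fun _ _ => erefl) Du) (mean_trace hm2 (min2 (DP2 Du))) mul0mx add0r.
by rewrite (trace_factor Js Do sY sYc YE dYc0 kap0 ipYc Gu Js3 Do3 sf3 Gu3 y_eps3 DP3
  (@pr3_io m1 m2 m3 R) (@blk_io3 m1 m2 m3) (@onto_io3 m1 m2 m3) (em33 R n1 N2 N3)
  (fun _ _ => erefl) Du) (mean_trace hm3 (min3 (DP3 Du))) mul0mx.
Qed.

Let norm_scal (k l : nat) (Jk : 'M[R]_l) (Dk : set 'rV[R]_k) (g : 'rV[R]_k -> 'rV[R]_l)
    (a : 'I_3) (s : R) v :
  (0 < k)%N -> Jk^T = Jk -> open Dk -> smooth_on Dk g ->
  (forall v, Dk v -> ip Jk (g v) (g v) = (kap a)^-1) ->
  (forall v, Dk v -> metric Jk g v \in unitmx) -> Dk v -> mean_curvature Jk g v = 0 ->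
  scalar_curvature (induced_metric Jk g) v = k%:R * (k%:R - 1) * kap a + s ->
  sff_norm2 Jk g v = - s.
Proof.
move=> k0 Jks Dok sg ge Gug Dv mg.
have eps0 : (kap a)^-1 != 0 by rewrite invr_neq0.
rewrite (scalar_curvature_minimal Jks Dok sg eps0 ge Gug Dv (mean_trace k0 mg)) invrK.
by move=> /addrI => <-; rewrite opprK.
Qed.

(** By the Gauss equation the scalar curvature of a minimal factor exceeds that of its totally
    geodesic model by [- |h_a|^2], so the prescribed curvatures mean [|h_a|^2 = - mu_a K]; the
    [mu_a] sum to 1. *)
Lemma LS_norm u : D u -> \sum_i \sum_j \sum_k \sum_l
  imetric J Y u i k * imetric J Y u j l *
    ip J (block_form J Y Yc blk kap i j u) (block_form J Y Yc blk kap k l u) = - KK.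
Proof.
move=> Du; rewrite (partition_big blk xpredT)//= sum3.
rewrite (norm_factor Js Do sY sYc YE dYc0 kap0 ipYc Gu Js1 Do1 sf1 Gu1 y_eps1 DP1
  (@pr1_io m1 m2 m3 R) (@blk_io1 m1 m2 m3) (@onto_io1 m1 m2 m3) (em11 R n1 N2 N3)
  (fun _ _ => erefl) Du).
rewrite (norm_factor Js Do sY sYc YE dYc0 kap0 ipYc Gu Js2 Do2 sf2 Gu2 y_eps2 DP2
  (@pr2_io m1 m2 m3 R) (@blk_io2 m1 m2 m3) (@onto_io2 m1 m2 m3) (em22 R n1 N2 N3)
  (fun _ _ => erefl) Du).
rewrite (norm_factor Js Do sY sYc YE dYc0 kap0 ipYc Gu Js3 Do3 sf3 Gu3 y_eps3 DP3
  (@pr3_io m1 m2 m3 R) (@blk_io3 m1 m2 m3) (@onto_io3 m1 m2 m3) (em33 R n1 N2 N3)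
  (fun _ _ => erefl) Du).
rewrite (norm_scal (a := o0) (s := mu1 * KK) hm1 Js1 Do1 sf1 y_eps1 Gu1 (DP1 Du) (min1 (DP1 Du))).
  rewrite (norm_scal (a := o1) (s := mu2 * KK) hm2 Js2 Do2 sf2 y_eps2 Gu2 (DP2 Du) (min2 (DP2 Du))).
    rewrite (norm_scal (a := o2) (s := mu3 * KK) hm3 Js3 Do3 sf3 y_eps3 Gu3 (DP3 Du) (min3 (DP3 Du))).
      by rewrite -[in RHS](mul1r KK) -hmu; ring.
    by rewrite sc3//; exact: DP3.
  by rewrite sc2//; exact: DP2.
by rewrite sc1; [rewrite /kap /sel3 /= mulrN|exact: DP1].
Qed.

Lemma LS_nabla1 k i j u : D u ->
  nproj J (cone_frame Y Yc lam u) (d (i1 k) (block_form J Y Yc blk kap (i1 i) (i1 j)) u)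
  - \sum_l (gam J Y l (i1 k) (i1 i) u *: block_form J Y Yc blk kap l (i1 j) u
            + gam J Y l (i1 k) (i1 j) u *: block_form J Y Yc blk kap (i1 i) l u) =
  nabla_sff (mink R n1) f1 k i j (u *m P1) *m E1.
Proof.
move=> Du; apply: (nabla_factor Js Do sY sYc YE dYc0 kap0 ipYc Gu sum_kap sum_lam
  Js1 Do1 sf1 Gu1 y_eps1 DP1 (@pr1_io m1 m2 m3 R) (@blk_io1 m1 m2 m3) (@onto_io1 m1 m2 m3)
  (em11 R n1 N2 N3) (fun _ _ => erefl) _ _ _ _ Du).
apply: forall3 => w // _ _; rewrite /Yc /sel3 /= trmx_mul mulmxA.
  by rewrite em12 mul0mx.
by rewrite em13 mul0mx.
Qed.

Lemma LS_nabla2 k i j u : D u ->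
  nproj J (cone_frame Y Yc lam u) (d (i2 k) (block_form J Y Yc blk kap (i2 i) (i2 j)) u)
  - \sum_l (gam J Y l (i2 k) (i2 i) u *: block_form J Y Yc blk kap l (i2 j) u
            + gam J Y l (i2 k) (i2 j) u *: block_form J Y Yc blk kap (i2 i) l u) =
  nabla_sff (eucl R N2) f2 k i j (u *m P2) *m E2.
Proof.
move=> Du; apply: (nabla_factor Js Do sY sYc YE dYc0 kap0 ipYc Gu sum_kap sum_lam
  Js2 Do2 sf2 Gu2 y_eps2 DP2 (@pr2_io m1 m2 m3 R) (@blk_io2 m1 m2 m3) (@onto_io2 m1 m2 m3)
  (em22 R n1 N2 N3) (fun _ _ => erefl) _ _ _ _ Du).
apply: forall3 => w // _ _; rewrite /Yc /sel3 /= trmx_mul mulmxA.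
  by rewrite em21 mul0mx.
by rewrite em23 mul0mx.
Qed.

Lemma LS_nabla3 k i j u : D u ->
  nproj J (cone_frame Y Yc lam u) (d (i3 k) (block_form J Y Yc blk kap (i3 i) (i3 j)) u)
  - \sum_l (gam J Y l (i3 k) (i3 i) u *: block_form J Y Yc blk kap l (i3 j) u
            + gam J Y l (i3 k) (i3 j) u *: block_form J Y Yc blk kap (i3 i) l u) =
  nabla_sff (eucl R N3) f3 k i j (u *m P3) *m E3.
Proof.
move=> Du; apply: (nabla_factor Js Do sY sYc YE dYc0 kap0 ipYc Gu sum_kap sum_lam
  Js3 Do3 sf3 Gu3 y_eps3 DP3 (@pr3_io m1 m2 m3 R) (@blk_io3 m1 m2 m3) (@onto_io3 m1 m2 m3)
  (em33 R n1 N2 N3) (fun _ _ => erefl) _ _ _ _ Du).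
apply: forall3 => w // _ _; rewrite /Yc /sel3 /= trmx_mul mulmxA.
  by rewrite em31 mul0mx.
by rewrite em32 mul0mx.
Qed.

Lemma LS_nabla_mixed k i j u : D u -> ~~ ((blk i == blk j) && (blk k == blk i)) ->
  nproj J (cone_frame Y Yc lam u) (d k (block_form J Y Yc blk kap i j) u)
  - \sum_l (gam J Y l k i u *: block_form J Y Yc blk kap l j u
            + gam J Y l k j u *: block_form J Y Yc blk kap i l u) = 0.
Proof.
move=> Du h; apply: (nabla_mixed Js Do sY sYc YE dYc0 ipYc Gu lam Du h).
apply: forall3 => kb ib jb.
- have [[i' ->] [j' ->]] := (onto_io1 ib, onto_io1 jb).
  exact: (pd_block_form_off Js Do sY sYc YE dYc0 kap0 ipYc Gu Js1 Do1 sf1 Gu1 y_eps1 DP1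
    (@pr1_io m1 m2 m3 R) (@blk_io1 m1 m2 m3) (@onto_io1 m1 m2 m3) (em11 R n1 N2 N3)
    (fun _ _ => erefl) (@pr1_off m1 m2 m3 R)).
- have [[i' ->] [j' ->]] := (onto_io2 ib, onto_io2 jb).
  exact: (pd_block_form_off Js Do sY sYc YE dYc0 kap0 ipYc Gu Js2 Do2 sf2 Gu2 y_eps2 DP2
    (@pr2_io m1 m2 m3 R) (@blk_io2 m1 m2 m3) (@onto_io2 m1 m2 m3) (em22 R n1 N2 N3)
    (fun _ _ => erefl) (@pr2_off m1 m2 m3 R)).
- have [[i' ->] [j' ->]] := (onto_io3 ib, onto_io3 jb).
  exact: (pd_block_form_off Js Do sY sYc YE dYc0 kap0 ipYc Gu Js3 Do3 sf3 Gu3 y_eps3 DP3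
    (@pr3_io m1 m2 m3 R) (@blk_io3 m1 m2 m3) (@onto_io3 m1 m2 m3) (em33 R n1 N2 N3)
    (fun _ _ => erefl) (@pr3_off m1 m2 m3 R)).
Qed.

End AnyTotal.

Let Gu0 := LS_metric_unit sY0 (fun _ _ => erefl).
Let trace0 Y u (sY : smooth_on D Y) (YE : forall u, D u -> Y u = Y0 u)
  (_ : forall u, D u -> metric J Y u \in unitmx) (Du : D u) := LS_trace0 sY YE Du.
Let normS := LS_norm sY0 (fun _ _ => erefl).

Lemma LS_moebius_form0 i u : D u -> moebius_form x i u = 0.
Proof.
exact: (moebius_form0 Do sYc m_gt1 dYc0 kap0 ipYc sum_kap sum_lam sphi phi_gt0 xE Gu0
  trace0 normS S_eq lam_eq).
Qed.

Lemma LS_eigenvalues u a : D u -> blaschke_eigenvalue x u a <-> a \in [:: l1; l2; l3].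
Proof.
move=> Du; rewrite (blaschke_eigenvalueE Do sYc m_gt1 dYc0 kap0 ipYc sum_kap sphi phi_gt0
  xE Gu0 trace0 normS S_eq lam_eq a Du).
split=> [[i ->]|].
  by move: (blk i); apply: forall3; rewrite /lam /sel3 /= !in_cons ?eqxx ?orbT.
rewrite !inE => /or3P[] /eqP ->.
- by exists (i1 (Ordinal hm1)); rewrite /blk /i1 blk_io1.
- by exists (i2 (Ordinal hm2)); rewrite /blk /i2 blk_io2.
- by exists (i3 (Ordinal hm3)); rewrite /blk /i3 blk_io3.
Qed.

(** Components of the derivative of [B] with all indices in one factor are those of the factor,
    carried over by an injective embedding; all other components are zero. *)
Lemma LS_parallel u : D u ->
  (forall k i j, nabla_moebius_sff x k i j u = 0) <->
  [/\ forall k i j, nabla_sff (mink R n1) f1 k i j (u *m P1) = 0,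
      forall k i j, nabla_sff (eucl R N2) f2 k i j (u *m P2) = 0 &
      forall k i j, nabla_sff (eucl R N3) f3 k i j (u *m P3) = 0].
Proof.
move=> Du.
have nE k i j := nabla_moebius_sffE Do sYc m_gt1 dYc0 kap0 ipYc sum_kap sum_lam sphi phi_gt0
  xE Gu0 trace0 normS S_eq lam_eq k i j Du.
have [sZ ZE _] := moebius_Y_product Do sYc m_gt1 dYc0 kap0 ipYc sum_kap sphi phi_gt0
  xE Gu0 trace0 normS S_eq.
have um : mink R n1 \in unitmx by have [] := mulmx1_unit (minkK R n1).
split=> [h|[h1 h2 h3] k i j].
  split=> k i j.
  - apply: (mulmxr_inj (em11 R n1 N2 N3) um).
    by rewrite -(LS_nabla1 sZ ZE) // -nE.
  - apply: (mulmxr_inj (em22 R n1 N2 N3) (unitmx1 _ _)).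
    by rewrite -(LS_nabla2 sZ ZE) // -nE.
  - apply: (mulmxr_inj (em33 R n1 N2 N3) (unitmx1 _ _)).
    by rewrite -(LS_nabla3 sZ ZE) // -nE.
rewrite nE; have [/andP[/eqP ij /eqP ki]|] := boolP ((blk i == blk j) && (blk k == blk i)); last first.
  exact: (LS_nabla_mixed sZ ZE Du).
move: k i j ij ki; apply: blk3P => k.
- move=> i j ij; rewrite /blk blk_io1 => /esym ib; have [i' ->] := onto_io1 ib.
  have [j' ->] : exists j', j = i1 j' by apply: onto_io1; rewrite -ib.
  by rewrite (LS_nabla1 sZ ZE)// h1 mul0mx.
- move=> i j ij; rewrite /blk blk_io2 => /esym ib; have [i' ->] := onto_io2 ib.
  have [j' ->] : exists j', j = i2 j' by apply: onto_io2; rewrite -ib.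
  by rewrite (LS_nabla2 sZ ZE)// h2 mul0mx.
- move=> i j ij; rewrite /blk blk_io3 => /esym ib; have [i' ->] := onto_io3 ib.
  have [j' ->] : exists j', j = i3 j' by apply: onto_io3; rewrite -ib.
  by rewrite (LS_nabla3 sZ ZE)// h3 mul0mx.
Qed.

End LSProduct.

(** * Parallel minimal submanifolds of hyperbolic space *)

Section ParallelCommutation.
Variables (R : realType) (m N : nat) (J : 'M[R]_N) (D : set 'rV[R]_m).
Variables (f : 'rV[R]_m -> 'rV[R]_N) (eps : R).
Hypotheses (Js : J^T = J) (Do : open D) (sf : smooth_on D f).
Hypotheses (eps0 : eps != 0) (feps : forall u, D u -> ip J (f u) (f u) = eps).
Local Notation G := (metric J f).
Local Notation Gi := (imetric J f).
Hypothesis Gu : forall u, D u -> G u \in unitmx.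
Local Notation d := (@dpart R m _).
Local Notation Gam := (gam J f).
Local Notation h := (hsff J f).
Hypothesis par : forall k i j u, D u -> nabla_sff J f k i j u = 0.

Let coef q k i j u : R := \sum_n Gi u q n * ip J (h i j u) (h k n u).

Lemma ip_sff_dd i j k n u : D u -> ip J (h i j u) (d k (d n f) u) = ip J (h i j u) (h k n u).
Proof.
move=> Du; rewrite (sffE Js Do sf eps0 feps Gu k n Du) second_formE.
rewrite !(ipDr, ipNr, ipZr, ip_sumr) (sff_orth_pos Js Do sf eps0 feps Gu)//.
rewrite big1 ?subr0 ?mulr0 ?addr0// => l _.
by rewrite ipZr (sff_orth_d Js Do sf eps0 feps Gu)// mulr0.
Qed.

(** The normal part of the derivative is forced by [par]. The position part is zero because [h] is
    orthogonal to [f] and to its derivatives. The tangential part is given by the Weingarten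
    formula, with the shape operator coefficients [coef]. *)
Lemma pd_sff_parallel k i j u : D u ->
  d k (h i j) u = \sum_l (Gam l k i u *: h l j u + Gam l k j u *: h i l u)
                  - \sum_q coef q k i j u *: d q f u.
Proof.
move=> Du; have sh := smooth_sff Js Do sf eps0 feps Gu i j.
have := par k i j Du; rewrite /nabla_sff /nabla_normal induced_metricE gamE hsffE -dpartE.
move=> /eqP; rewrite subr_eq0 => /eqP <-; set V := d k _ u.
have uF := quadric_frame_unit Js Do sf eps0 feps Gu Du.
have [c VE] := nproj_def J (quadric_frame f u) V; have wF := nproj_orth V uF.
set w := nproj _ _ V in VE wF *; clearbody w.
have [wf wd] := (quadric_frame_orthP J sf w Du).1 wF.
move: VE; rewrite -(hsubmxK c) [lsubmx c]mx11_scalar /quadric_frame mul_row_col mul_scalar_mx.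
have -> : rsubmx c = \row_q rsubmx c 0 q by apply/rowP => q; rewrite mxE.
rewrite -(sum_row_jacobian sf)//; move: (lsubmx c 0 0) => c0 VE.
have c00 : c0 = 0.
  have : ip J V (f u) = 0.
    have := pd_ip Do J k sh sf Du.
    rewrite (eq_pd_on Do (g := fun=> (0 : R)))// ?pd_cst; last first.
      by move=> q Dq; exact: (sff_orth_pos Js Do sf eps0 feps Gu).
    by rewrite (sff_orth_d Js Do sf eps0 feps Gu)// addr0.
  rewrite VE !ipDl ipZl wf feps// ip_suml big1 ?addr0 ?add0r; last first.
    by move=> q _; rewrite ipZl ipC// (quadric_ip_d Js Do sf feps)// mulr0.
  by move=> /eqP; rewrite mulf_eq0 (negbTE eps0) orbF => /eqP.
rewrite c00 scale0r add0r in VE; rewrite {1}VE; congr (_ + _).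
rewrite -sumrN; apply: eq_bigr => q _; rewrite -scaleNr; congr (_ *: _).
have <- : \sum_n Gi u q n * ip J V (d n f u) = rsubmx c 0 q.
  apply: (tangent_coef Js sf Gu (c := fun q => rsubmx c 0 q) Du) => n.
  by rewrite VE addrK wd.
rewrite /coef -sumrN; apply: eq_bigr => n _; rewrite -mulrN; congr (_ * _).
have := pd_ip Do J k sh (smooth_pd n sf) Du.
rewrite (eq_pd_on Do (g := fun=> (0 : R)))// ?pd_cst; last first.
  by move=> q' Dq; exact: (sff_orth_d Js Do sf eps0 feps Gu).
by rewrite ip_sff_dd// => /esym/eqP; rewrite addr_eq0 => /eqP.
Qed.

Variables (u : 'rV[R]_m) (nu : 'rV[R]_N).
Hypotheses (Du : D u) (nuf : ip J (f u) nu = 0) (nud : forall l, ip J (d l f u) nu = 0).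
Let H i j : R := ip J (h i j u) nu.
Let a i j w : R := ip J (h i j w) nu.
Let tau q w : R := ip J (d q f w) nu.

Let sh i j : smooth_on D (h i j). Proof. exact: (smooth_sff Js Do sf eps0 feps Gu). Qed.
Let sa i j : smooth_on D (a i j).
Proof. exact: (smooth_ip Do J (sh i j) (smooth_cst Do nu)). Qed.
Let stau q : smooth_on D (tau q).
Proof. exact: (smooth_ip Do J (smooth_pd q sf) (smooth_cst Do nu)). Qed.
Let sG l i j : smooth_on D (Gam l i j). Proof. exact: smooth_christoffel. Qed.
Let scoef q k i j : smooth_on D (coef q k i j).
Proof.
apply: smooth_sum => // n _; apply: smooth_mul => //; first exact: smooth_invmetric.
exact: (smooth_ip Do J (sh i j) (sh k n)).
Qed.

Let da k i j w : D w -> d k (a i j) w =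
  (\sum_l (Gam l k i w * a l j w + Gam l k j w * a i l w)) - \sum_q coef q k i j w * tau q w.
Proof.
move=> Dw; rewrite (pd_ip Do J k (sh i j) (smooth_cst Do nu) Dw) pd_cst ip0r addr0.
rewrite pd_sff_parallel// ipBl !ip_suml; congr (_ - _); apply: eq_bigr => l _.
  by rewrite ipDl !ipZl.
by rewrite ipZl.
Qed.

Let tau0 q : tau q u = 0. Proof. exact: nud. Qed.

(** The constant vector [nu] is normal at [u] only: [tau q] vanishes there but its derivative does
    not. This is the source of the quadratic terms of the commutation identity that do not come from
    the intrinsic curvature. *)
Let dtau p q : d p (tau q) u = H p q.
Proof.
rewrite (pd_ip Do J p (smooth_pd q sf) (smooth_cst Do nu) Du) pd_cst ip0r addr0.
rewrite /H (sffE Js Do sf eps0 feps Gu p q Du) second_formE.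
rewrite !(ipDl, ipNl, ipZl, ip_suml) nuf mulr0 addr0 big1 ?subr0// => l _.
by rewrite ipZl nud mulr0.
Qed.

Let da0 k i j : d k (a i j) u = \sum_l (Gam l k i u * H l j + Gam l k j u * H i l).
Proof. by rewrite da// [X in _ - X]big1 ?subr0// => q _; rewrite tau0 mulr0. Qed.

Let dda p k i j : d p (d k (a i j)) u =
  \sum_l (d p (Gam l k i) u * H l j + d p (Gam l k j) u * H i l)
  + \sum_l (Gam l k i u * \sum_q (Gam q p l u * H q j + Gam q p j u * H l q)
          + Gam l k j u * \sum_q (Gam q p i u * H q l + Gam q p l u * H i q))
  - \sum_q coef q k i j u * H p q.
Proof.
rewrite (eq_pd_on Do (g := fun w => \sum_l (Gam l k i w * a l j w + Gam l k j w * a i l w)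
   + (-1) * \sum_q coef q k i j w * tau q w)); [|by []|by move=> w Dw; rewrite da// mulN1r].
have s1 l : smooth_on D (fun w => Gam l k i w * a l j w) by exact: smooth_mul.
have s2 l : smooth_on D (fun w => Gam l k j w * a i l w) by exact: smooth_mul.
have s3 q : smooth_on D (fun w => coef q k i j w * tau q w) by exact: smooth_mul.
have s12 l : smooth_on D (fun w => Gam l k i w * a l j w + Gam l k j w * a i l w).
  exact: smooth_add.
have s4 : smooth_on D (fun w => \sum_q coef q k i j w * tau q w) by exact: smooth_sum.
rewrite (pd_add p (smooth_sum Do _ (fun l _ => s12 l)) (smooth_mul Do (smooth_cst Do _) s4) Du).
rewrite (pd_mul p (smooth_cst Do _) s4 Du) pd_cst mul0r add0r mulN1r.
rewrite (pd_sum Do _ p (fun l _ => s12 l) Du) (pd_sum Do _ p (fun q _ => s3 q) Du).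
congr (_ - _); last first.
  apply: eq_bigr => q _; rewrite (pd_mul p (scoef q k i j) (stau q) Du).
  by rewrite tau0 mulr0 add0r dtau.
rewrite -big_split/=; apply: eq_bigr => l _.
rewrite (pd_add p (s1 l) (s2 l) Du) (pd_mul p (sG l k i) (sa l j) Du).
rewrite (pd_mul p (sG l k j) (sa i l) Du) !da0 /a -/(H l j) -/(H i l).
by ring.
Qed.

Let Rm l p k i := \sum_n Gi u l n *
  (ip J (second_form J f i k u) (second_form J f p n u)
   - ip J (second_form J f i p u) (second_form J f k n u)).

(** The products of two symbols acting on different slots of [H] are symmetric in [p] and [k], hence
    drop out of the commutator. *)
Let cross_sym p k i j :
  \sum_l \sum_q Gam l k i u * Gam q p j u * H l q + \sum_l \sum_q Gam l k j u * Gam q p i u * H q l =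
  \sum_l \sum_q Gam l p i u * Gam q k j u * H l q + \sum_l \sum_q Gam l p j u * Gam q k i u * H q l.
Proof.
rewrite addrC; congr (_ + _).
  by rewrite exchange_big; apply: eq_bigr => l _; apply: eq_bigr => q _; ring.
by rewrite exchange_big; apply: eq_bigr => l _; apply: eq_bigr => q _; ring.
Qed.

(* When [h] is parallel, the second partial derivatives of its component along the constant
   vector [nu] are algebraic in [h]; this is their symmetry. *)
Lemma parallel_commutation p k i j :
  \sum_l Rm l p k i * H l j + \sum_l Rm l p k j * H i l
  - (\sum_q coef q k i j u * H p q - \sum_q coef q p i j u * H k q) = 0.
Proof.
have RmE l i' : Rm l p k i' = d p (Gam l k i') u + \sum_q Gam l p q u * Gam q k i' u
    - (d k (Gam l p i') u + \sum_q Gam l k q u * Gam q p i' u).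
  rewrite /Rm -(gauss Js Do sf Gu l p i' k Du) sumrB.
  have -> : d p (Gam l i' k) u = d p (Gam l k i') u.
    by apply: (eq_pd_on Do) => // w Dw; exact: (christoffelC Js Do sf).
  have -> : d k (Gam l i' p) u = d k (Gam l p i') u.
    by apply: (eq_pd_on Do) => // w Dw; exact: (christoffelC Js Do sf).
  under eq_bigr do rewrite (christoffelC Js Do sf _ i' k Du).
  under [X in _ + (_ - X)]eq_bigr do rewrite (christoffelC Js Do sf _ i' p Du).
  by rewrite opprD addrACA.
have hh : d p (d k (a i j)) u - d k (d p (a i j)) u = 0.
  by rewrite (pd_comm p k Do (sa i j) Du) subrr.
rewrite -[RHS]hh !dda.
have split_ k' p' : \sum_l (Gam l k' i u * \sum_q (Gam q p' l u * H q j + Gam q p' j u * H l q)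
          + Gam l k' j u * \sum_q (Gam q p' i u * H q l + Gam q p' l u * H i q)) =
    \sum_l (\sum_q Gam l p' q u * Gam q k' i u) * H l j
    + \sum_l (\sum_q Gam l p' q u * Gam q k' j u) * H i l
    + (\sum_l \sum_q Gam l k' i u * Gam q p' j u * H l q
       + \sum_l \sum_q Gam l k' j u * Gam q p' i u * H q l).
  have e1 i' (F : 'I_m -> R) : \sum_l (\sum_q Gam l p' q u * Gam q k' i' u) * F l =
      \sum_l \sum_q Gam l k' i' u * (Gam q p' l u * F q).
    rewrite [RHS]exchange_big; apply: eq_bigr => l _; rewrite mulr_suml.
    by apply: eq_bigr => q _; ring.
  rewrite !e1 -!big_split/=; apply: eq_bigr => l _.
  rewrite !mulr_sumr -!big_split/=; apply: eq_bigr => q _.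
  by ring.
rewrite !split_ (cross_sym p k).
under eq_bigr do rewrite RmE mulrBl !mulrDl.
under [X in _ + X - _ = _]eq_bigr do rewrite RmE mulrBl !mulrDl.
rewrite !(sumrB, big_split)/=; ring.
Qed.

End ParallelCommutation.

(** * Positive forms, Lorentz frames and a trace inequality *)

Section PositiveForms.
Variable R : realType.

Lemma cholesky (n : nat) (S : 'M[R]_n) : S^T = S ->
  (forall v : 'rV[R]_n, v != 0 -> 0 < (v *m S *m v^T) 0 0) ->
  exists C : 'M[R]_n, C *m S *m C^T = 1%:M.
Proof.
elim: n S => [|n IH] S Ssym Spos.
  by exists 0; apply/matrixP => -[].
move: S Ssym Spos; rewrite -[n.+1]/(1 + n)%N => S Ssym Spos.
pose a : R := ulsubmx S 0 0; pose b := ursubmx S; pose T := drsubmx S.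
have SE : S = block_mx a%:M b b^T T.
  rewrite -[LHS]submxK; congr block_mx; first exact: mx11_scalar.
  by rewrite /b trmx_ursub Ssym.
have Tsym : T^T = T by rewrite /T trmx_drsub Ssym.
have a0 : 0 < a.
  have := Spos (row_mx 1%:M 0); rewrite SE mul_row_block tr_row_mx mul_row_col.
  rewrite !mul0mx !addr0 !mul1mx trmx0 mulmx0 addr0 trmx1 mulmx1 !mxE mulr1n; apply.
  apply/eqP => /rowP/(_ (lshift n 0)); rewrite row_mxEl !mxE => /eqP.
  by rewrite oner_eq0.
have an0 : a != 0 by exact: lt0r_neq0.
pose T' := T - a^-1 *: (b^T *m b).
have [|w w0|C' CT] := IH T'.
- by rewrite /T' linearB linearZ/= trmx_mul trmxK Tsym.
- pose c := - a^-1 *: (w *m b^T).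
  have := Spos (row_mx c w).
  have -> : (row_mx c w *m S *m (row_mx c w)^T) = w *m T' *m w^T.
    rewrite SE mul_row_block tr_row_mx mul_row_col mul_mx_scalar.
    rewrite {1}/c scalerA mulrN mulfV// scaleN1r addNr mul0mx add0r /T' mulmxBr.
    by rewrite -scalemxAr /c scaleNr mulNmx -scalemxAl mulmxA addrC.
  by apply; apply: contraNneq w0; rewrite -[X in _ = X]row_mx0 => /eq_row_mx[_ ->].
pose s := Num.sqrt a.
have s0 : s != 0 by rewrite sqrtr_eq0 -ltNge.
have ss : s * s = a by rewrite -expr2 sqr_sqrtr// ltW.
exists (block_mx (s^-1)%:M 0 (- a^-1 *: (C' *m b^T)) C').
have -> : block_mx (s^-1)%:M 0 (- a^-1 *: (C' *m b^T)) C' *m S =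
    block_mx s%:M (s^-1 *: b) 0 (C' *m T').
  rewrite SE mulmx_block !mul0mx !addr0 mul_scalar_mx -scalemxAl -scalemxAl; congr block_mx.
  - by rewrite scale_scalar_mx -ss mulKf.
  - by rewrite mul_scalar_mx.
  - by rewrite mul_mx_scalar scaleNr scalerA mulVf// scale1r addNr.
  - by rewrite /T' mulmxBr scaleNr -scalemxAr mulmxA addrC.
rewrite tr_block_mx mulmx_block !mul0mx !add0r trmx0 mulmx0 addr0 CT.
rewrite !tr_scalar_mx -scalar_mxM mulfV//.
have -> : s%:M *m (- a^-1 *: (C' *m b^T))^T + s^-1 *: b *m C'^T = 0.
  rewrite linearZ/= trmx_mul trmxK mul_scalar_mx scalerA -scalemxAl -scalerDl.
  by rewrite -ss invfM mulrN mulrA mulfV// mul1r addNr scale0r.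
by rewrite mulmx0 -scalar_mx_block.
Qed.

Lemma eucl_ge0 (N : nat) (v : 'rV[R]_N) : 0 <= ip (eucl R N) v v.
Proof. by rewrite ip_eucl; apply: sumr_ge0 => k _; rewrite -expr2 sqr_ge0. Qed.

Lemma eucl_eq0 (N : nat) (v : 'rV[R]_N) : ip (eucl R N) v v = 0 -> v = 0.
Proof.
rewrite ip_eucl => /eqP; rewrite psumr_eq0; last by move=> k _; rewrite -expr2 sqr_ge0.
move=> /allP h; apply/rowP => k; rewrite mxE.
by have := h k (mem_index_enum k); rewrite /= -expr2 sqrf_eq0 => /eqP.
Qed.

Lemma eucl_cauchy (N : nat) (v w : 'rV[R]_N) :
  ip (eucl R N) v w ^+ 2 <= ip (eucl R N) v v * ip (eucl R N) w w.
Proof.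
have Es := eucl_sym R N.
have [w0|w0] := eqVneq (ip (eucl R N) w w) 0.
  by rewrite (eucl_eq0 w0) !ip0r expr2 !mulr0.
have wp : 0 < ip (eucl R N) w w by rewrite lt_def w0 eucl_ge0.
have := eucl_ge0 (ip (eucl R N) w w *: v - ip (eucl R N) v w *: w).
rewrite ipBl !ipBr !ipZl !ipZr (ipC w v Es) => h.
have : 0 <= ip (eucl R N) w w *
   (ip (eucl R N) v v * ip (eucl R N) w w - ip (eucl R N) v w ^+ 2).
  by apply: le_trans h _; rewrite le_eqVlt; apply/orP; left; apply/eqP; ring.
by rewrite pmulr_rge0// subr_ge0.
Qed.

(** Orthogonality says [t0 w0 = tw], so Cauchy's inequality for the space parts gives
    [t0^2 w0^2 <= tt ww < t0^2 ww]; the strict step uses that [t] is time-like and that [ww] is not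
    0. *)
Lemma mink_orth_pos (n : nat) (t w : 'rV[R]_(1 + n)) :
  ip (mink R n) t t < 0 -> ip (mink R n) t w = 0 -> w != 0 -> 0 < ip (mink R n) w w.
Proof.
rewrite !ip_mink; set t0 := t 0 ord0; set w0 := w 0 ord0.
set tt := ip _ (rsubmx t) (rsubmx t); set tw := ip _ (rsubmx t) (rsubmx w).
set ww := ip _ (rsubmx w) (rsubmx w).
move=> tneg twe wn0.
have cs : tw ^+ 2 <= tt * ww by exact: eucl_cauchy.
have tt0 : 0 <= tt by exact: eucl_ge0.
have t00 : t0 != 0 by apply/eqP => e; move: tneg; rewrite e mul0r oppr0 add0r ltNge tt0.
have twE : tw = t0 * w0 by apply/eqP; rewrite -subr_eq0 addrC twe.
have wwp : 0 < ww.
  rewrite lt_def eucl_ge0 andbT; apply: contraNneq wn0 => w00.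
  have w0z : w0 = 0.
    apply/eqP; have : tw ^+ 2 <= 0 by rewrite (le_trans cs)// w00 mulr0.
    by rewrite twE le_eqVlt ltNge sqr_ge0 orbF sqrf_eq0 mulf_eq0 (negbTE t00).
  rewrite -(hsubmxK w) (eucl_eq0 w00) [lsubmx w]mx11_scalar mxE.
  rewrite (_ : lshift n 0 = ord0); last exact: val_inj.
  by rewrite -/w0 w0z raddf0 row_mx0.
have t2 : 0 < t0 ^+ 2 by rewrite exprn_even_gt0.
rewrite -(pmulr_rgt0 _ t2) mulrDr mulrN -expr2 -exprMn -twE.
have : tt * ww < t0 ^+ 2 * ww by rewrite ltr_pM2r// expr2; move: tneg; lra.
by move: cs; lra.
Qed.

(** The orthogonal complement of [t] and [T] has dimension [p]. The form is positive there by
    [mink_orth_pos], because [t] is time-like, so [cholesky] turns any basis of it into an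
    orthonormal one. *)
Lemma lorentz_frame (n p : nat) (t : 'rV[R]_(1 + (n + p))) (T : 'M[R]_(n, 1 + (n + p))) :
  ip (mink R (n + p)) t t = -1 -> T *m mink R (n + p) *m T^T = 1%:M ->
  (forall i, ip (mink R (n + p)) t (row i T) = 0) ->
  exists B : 'M[R]_(p, 1 + (n + p)), [/\ B *m mink R (n + p) *m t^T = 0,
    B *m mink R (n + p) *m T^T = 0 &
    (col_mx t (col_mx T B) : 'M[R]_(1 + (n + p))) *m mink R (n + p)
      *m (col_mx t (col_mx T B))^T = mink R (n + p)].
Proof.
set J := mink R (n + p) => tt TT tT.
have Js : J^T = J := mink_sym R _.
have uJ : J \in unitmx by have [] := mulmx1_unit (minkK R (n + p)).
pose E : 'M[R]_(1 + n, 1 + (n + p)) := col_mx t T.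
have tJT : t *m J *m T^T = 0 by apply/orth_rowsP.
have TJt : T *m J *m t^T = 0.
  by rewrite -[RHS]trmx0 -tJT !trmx_mul trmxK Js mulmxA.
have tJt : t *m J *m t^T = (-1)%:M by rewrite [LHS]mx11_scalar -[X in X%:M]/(ip J t t) tt.
have EJE : E *m J *m E^T = mink R n.
  by rewrite /E tr_col_mx mul_col_mx mul_col_row tJt tJT TJt TT /mink raddfN.
have umn : mink R n \in unitmx by have [] := mulmx1_unit (minkK R n).
pose K := kermx (J *m E^T).
have rE : \rank (J *m E^T) = (1 + n)%N.
  apply/eqP; rewrite eqn_leq rank_leq_col /=.
  have := mulmx_max_rank E (J *m E^T); rewrite mulmxA EJE mxrank_unit// => _.
  by rewrite -{1}(mxrank_unit umn) -EJE -mulmxA mxrankM_maxr.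
have rK : \rank K = p.
  by rewrite mxrank_ker rE subnDl addKn.
have [B0 B0f B0K] : exists2 B0 : 'M[R]_(p, 1 + (n + p)), row_free B0 & B0 *m J *m E^T = 0.
  (* [row_base K] has [\rank K] rows; generalising this number first lets the equality [rK] change
     the type of the matrix. *)
  suff h q : \rank K = q ->
      exists2 B0 : 'M[R]_(q, 1 + (n + p)), row_free B0 & B0 *m J *m E^T = 0 by exact: h.
  move=> <-; exists (row_base K); first exact: row_base_free.
  by rewrite -mulmxA; apply/sub_kermxP; rewrite eq_row_base.
have pos (v : 'rV[R]_p) : v != 0 -> 0 < (v *m (B0 *m J *m B0^T) *m v^T) 0 0.
  move=> v0; have -> : (v *m (B0 *m J *m B0^T) *m v^T) 0 0 = ip J (v *m B0) (v *m B0).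
    by rewrite /ip trmx_mul !mulmxA.
  apply: (@mink_orth_pos _ t); first by rewrite tt ltrN10.
    rewrite ipC// /ip -!mulmxA (mulmxA B0).
    have : B0 *m J *m t^T = 0.
      move: B0K; rewrite /E tr_col_mx mul_mx_row -[X in _ = X]row_mx0.
      by move=> /eq_row_mx[].
    by move=> ->; rewrite mulmx0 mxE.
  by apply: contraNneq v0 => vB; apply/eqP/(row_free_inj B0f); rewrite vB mul0mx.
have [|C CC] := cholesky (S := B0 *m J *m B0^T) _ pos.
  by rewrite !trmx_mul trmxK Js mulmxA.
exists (C *m B0).
have BE : C *m B0 *m J *m E^T = 0 by rewrite -!mulmxA (mulmxA B0) B0K mulmx0.
have [Bt BT] : C *m B0 *m J *m t^T = 0 /\ C *m B0 *m J *m T^T = 0.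
  by move: BE; rewrite /E tr_col_mx mul_mx_row -[X in _ = X]row_mx0 => /eq_row_mx.
have BB : C *m B0 *m J *m (C *m B0)^T = 1%:M by rewrite trmx_mul !mulmxA in CC *.
have tB : t *m J *m (C *m B0)^T = 0 by rewrite -[RHS]trmx0 -Bt !trmx_mul !trmxK Js !mulmxA.
have TB : T *m J *m (C *m B0)^T = 0 by rewrite -[RHS]trmx0 -BT !trmx_mul !trmxK Js !mulmxA.
split=> //; rewrite !tr_col_mx !mul_col_mx !mul_mx_row tJt tJT TJt TT Bt BT BB tB TB row_mx0.
rewrite -[X in col_mx _ X]/(block_mx 0 (row_mx 1%:M 0) 0 (row_mx 0 1%:M)) block_mxEh col_mx0.
rewrite -[col_mx (row_mx 1%:M 0) _]/(block_mx 1%:M 0 0 1%:M) -scalar_mx_block.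
by rewrite /J /mink raddfN.
Qed.

Lemma lorentz_frame_expand (n p : nat) (t : 'rV[R]_(1 + (n + p))) (T : 'M[R]_(n, 1 + (n + p)))
    (B : 'M[R]_(p, 1 + (n + p))) (w : 'rV[R]_(1 + (n + p))) :
  (col_mx t (col_mx T B) : 'M[R]_(1 + (n + p))) *m mink R (n + p)
      *m (col_mx t (col_mx T B))^T = mink R (n + p) ->
  w *m mink R (n + p) *m t^T = 0 -> w *m mink R (n + p) *m T^T = 0 ->
  w = w *m mink R (n + p) *m B^T *m B.
Proof.
set J := mink R (n + p); set F := col_mx t _ => FF wt wT.
have : F *m (J *m F^T *m J) = 1%:M by rewrite !mulmxA FF minkK.
move=> /mulmx1C FK; rewrite -[LHS]mulmx1 -FK !mulmxA /F !tr_col_mx !mul_mx_row wt wT.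
by rewrite /J /mink mul_row_block !(mul0mx, mulmx0, add0r, addr0) mulmx1 !mul_row_col !mul0mx !add0r.
Qed.

Lemma mxtrace_tr_ge0 (n k : nat) (M : 'M[R]_(n, k)) : 0 <= \tr (M *m M^T).
Proof.
apply: sumr_ge0 => i _; rewrite mxE; apply: sumr_ge0 => j _.
by rewrite mxE -expr2 sqr_ge0.
Qed.

Lemma mxtrace_tr_eq0 (n k : nat) (M : 'M[R]_(n, k)) : \tr (M *m M^T) <= 0 -> M = 0.
Proof.
move=> h; have : \tr (M *m M^T) == 0 by rewrite eq_le h mxtrace_tr_ge0.
have p i j : 0 <= M i j * M i j by rewrite -expr2 sqr_ge0.
have e i : (M *m M^T) i i = \sum_j M i j * M i j.
  by rewrite mxE; apply: eq_bigr => j _; rewrite mxE.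
rewrite /mxtrace; under eq_bigr do rewrite e.
rewrite psumr_eq0; last by move=> i _; exact: sumr_ge0.
move=> /allP h1; apply/matrixP => i j; rewrite mxE.
have := h1 i (mem_index_enum i); rewrite /= psumr_eq0// => /allP/(_ j (mem_index_enum j)).
by rewrite /= -expr2 sqrf_eq0 => /eqP.
Qed.

(** For symmetric matrices the squared norm of the commutator is twice the difference of the two
    sides. *)
Lemma mxtrace_commutator_le (n : nat) (A B : 'M[R]_n) : A^T = A -> B^T = B ->
  \tr (A *m B *m A *m B) <= \tr (A *m B *m B *m A).
Proof.
move=> As Bs; have := mxtrace_tr_ge0 (A *m B - B *m A).
rewrite [(_ - _)^T]raddfB/= !trmx_mul As Bs mulmxBl !mulmxBr !mulmxA.
rewrite !raddfB/= (mxtrace_mulC (B *m A *m B)) !mulmxA.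
have -> : \tr (B *m A *m A *m B) = \tr (A *m B *m B *m A).
  by rewrite -mulmxA mxtrace_mulC !mulmxA.
move: (\tr (A *m B *m A *m B)) (\tr (A *m B *m B *m A)) => x y; lra.
Qed.

End PositiveForms.

(** * Trace identities for the Simons contraction *)

Section SimonsAlgebra.
Variables (R : realType) (m : nat).

Lemma mxtrace4 (A B C E : 'M[R]_m) :
  \tr (A *m B *m C *m E) = \sum_i \sum_j \sum_k \sum_l A i j * B j k * C k l * E l i.
Proof.
rewrite /mxtrace; apply: eq_bigr => i _; rewrite mxE.
transitivity (\sum_l \sum_k \sum_j A i j * B j k * C k l * E l i).
  apply: eq_bigr => l _; rewrite mxE mulr_suml; apply: eq_bigr => k _.
  by rewrite mxE !mulr_suml.
rewrite exchange_big/= [RHS]exchange_big/=; apply: eq_bigr => k _.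
by rewrite exchange_big.
Qed.

Lemma mxtrace2 (A B : 'M[R]_m) : \tr (A *m B) = \sum_i \sum_j A i j * B j i.
Proof. by apply: eq_bigr => i _; rewrite mxE. Qed.

Variables (S W : 'M[R]_m).
Hypotheses (Ss : S^T = S) (Ws : W^T = W).

(** To be used with [S] the inverse metric and [W] the form [H b] with both indices raised. Each
    following lemma converts one pairing pattern of the four indices into traces of matrix
    products. *)
Definition contract4 (F : 'I_m -> 'I_m -> 'I_m -> 'I_m -> R) : R :=
  \sum_p \sum_k \sum_i \sum_j S k i * W p j * F p k i j.

Lemma contract4D F1 F2 :
  contract4 (fun p k i j => F1 p k i j + F2 p k i j) = contract4 F1 + contract4 F2.
Proof.
rewrite /contract4 -big_split; apply: eq_bigr => p _; rewrite -big_split; apply: eq_bigr => k _.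
rewrite -big_split; apply: eq_bigr => i _; rewrite -big_split; apply: eq_bigr => j _.
by rewrite /= mulrDr.
Qed.

Lemma contract4Z c F : contract4 (fun p k i j => c * F p k i j) = c * contract4 F.
Proof.
rewrite /contract4 mulr_sumr; apply: eq_bigr => p _; rewrite mulr_sumr; apply: eq_bigr => k _.
rewrite mulr_sumr; apply: eq_bigr => i _; rewrite mulr_sumr; apply: eq_bigr => j _.
by rewrite mulrCA.
Qed.

Lemma contract4_sum (n : nat) (F : 'I_n -> 'I_m -> 'I_m -> 'I_m -> 'I_m -> R) :
  contract4 (fun p k i j => \sum_a F a p k i j) = \sum_a contract4 (F a).
Proof.
rewrite /contract4 [RHS]exchange_big/=; apply: eq_bigr => p _.
rewrite [RHS]exchange_big/=; apply: eq_bigr => k _.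
rewrite [RHS]exchange_big/=; apply: eq_bigr => i _.
by rewrite [RHS]exchange_big/=; apply: eq_bigr => j _; rewrite mulr_sumr.
Qed.

Let sE i j : S i j = S j i. Proof. by rewrite -[in LHS]Ss mxE. Qed.
Let wE i j : W i j = W j i. Proof. by rewrite -[in LHS]Ws mxE. Qed.

Lemma contract4_split (X Y : 'M[R]_m) :
  contract4 (fun p k i j => X k i * Y p j) = \tr (S *m X^T) * \tr (W *m Y^T).
Proof.
rewrite !mxtrace2 mulrC mulr_suml; apply: eq_bigr => p _.
rewrite mulrC mulr_suml; apply: eq_bigr => k _; rewrite mulr_suml; apply: eq_bigr => i _.
by rewrite mulr_sumr; apply: eq_bigr => j _; rewrite !mxE; ring.
Qed.

Lemma contract4_2 (X Y : 'M[R]_m) :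
  contract4 (fun p k i j => X i p * Y k j) = \tr (S *m X *m W *m Y^T).
Proof.
rewrite mxtrace4 /contract4 exchange_big/=; apply: eq_bigr => k _.
rewrite exchange_big/=; apply: eq_bigr => i _; apply: eq_bigr => p _.
by apply: eq_bigr => j _; rewrite mxE; ring.
Qed.

Lemma contract4_3 (X Y : 'M[R]_m) :
  contract4 (fun p k i j => X j k * Y p i) = \tr (W *m X *m S *m Y^T).
Proof.
rewrite mxtrace4; apply: eq_bigr => p _.
transitivity (\sum_k \sum_j \sum_i S k i * W p j * (X j k * Y p i)).
  by apply: eq_bigr => k _; rewrite exchange_big.
rewrite exchange_big/=; apply: eq_bigr => j _; apply: eq_bigr => k _.
by apply: eq_bigr => i _; rewrite mxE; ring.
Qed.

Lemma contract4_5 (X Y : 'M[R]_m) :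
  contract4 (fun p k i j => X i j * Y k p) = \tr (Y^T *m S *m X *m W).
Proof.
rewrite mxtrace4; apply: eq_bigr => p _; apply: eq_bigr => k _; apply: eq_bigr => i _.
by apply: eq_bigr => j _; rewrite mxE (wE j); ring.
Qed.

End SimonsAlgebra.

Section SimonsVanishing.
Variables (R : realType) (m n : nat) (c : R) (g S C : 'M[R]_m) (H : 'I_n -> 'M[R]_m).
Hypotheses (m0 : (0 < m)%N) (c0 : c < 0) (gs : g^T = g) (CgC : C *m g *m C^T = 1%:M)
  (SE : S = C^T *m C) (Hs : forall a, (H a)^T = H a) (trH : forall a, \tr (S *m H a) = 0).
Let B a b := H a *m S *m H b.
Hypothesis commutation : forall b p k i j,
  \sum_a (H a i k * B a b p j - H a i p * B a b k j + H a j k * B a b p i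
          - H a j p * B a b k i - H a i j * B a b k p + H a i j * B a b p k)
  + c * (g i k * H b p j - g i p * H b k j + g j k * H b p i - g j p * H b k i) = 0.

Let Ss : S^T = S. Proof. by rewrite SE trmx_mul trmxK. Qed.
Let K a := C *m H a *m C^T.
Let Ks a : (K a)^T = K a. Proof. by rewrite /K !trmx_mul trmxK Hs mulmxA. Qed.
Let Sg : S *m g = 1%:M.
Proof.
have := CgC; rewrite -mulmxA => /mulmx1C; rewrite -mulmxA -SE => gS.
exact: mulmx1C gS.
Qed.
Let W b := S *m H b *m S.
Let Ws b : (W b)^T = W b. Proof. by rewrite /W !trmx_mul Ss Hs mulmxA. Qed.

Let tr4 a1 a2 a3 a4 : \tr (S *m H a1 *m S *m H a2 *m S *m H a3 *m S *m H a4) =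
  \tr (K a1 *m K a2 *m K a3 *m K a4).
Proof. by rewrite SE /K -(mulmxA C^T) -!(mulmxA (C^T)) mxtrace_mulC !mulmxA. Qed.
Let tr2 a1 a2 : \tr (S *m H a1 *m S *m H a2) = \tr (K a1 *m K a2).
Proof. by rewrite SE /K -!(mulmxA C^T) mxtrace_mulC !mulmxA. Qed.

Let contracted b :
  \sum_a (2 * (\tr (K a *m K b *m K a *m K b) - \tr (K a *m K b *m K b *m K a))
          - \tr (K a *m K b) ^+ 2) + c * m%:R * \tr (K b *m K b) = 0.
Proof.
(* The summands of [commutation], with indices exchanged by the symmetry of [H a] and [g] until each
   matches one of the [contract4] patterns. *)
pose F a p k i j : R := 1 * (H a k i * B a b p j) + (-1) * (H a i p * B a b k j)
   + 1 * (H a j k * B a b p i) + (-1) * (B a b k i * H a p j)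
   + (-1) * (H a i j * B a b k p) + 1 * (H a i j * (B a b)^T k p).
pose F0 p k i j : R := 1 * (g k i * H b p j) + (-1) * (g i p * H b k j)
   + 1 * (g j k * H b p i) + (-1) * (H b k i * g p j).
have Hse a i j : H a i j = H a j i by rewrite -[in LHS]Hs mxE.
have gse i j : g i j = g j i by rewrite -[in LHS]gs mxE.
have FE p k i j : \sum_a F a p k i j + c * F0 p k i j = 0.
  rewrite -[RHS](commutation b p k i j); congr (_ + _ * _).
    apply: eq_bigr => a _; rewrite /F [_^T _ _]mxE (Hse a k i) (Hse a p j); ring.
  by rewrite /F0 (gse k i) (gse p j); ring.
have : contract4 S (W b) (fun p k i j => \sum_a F a p k i j + c * F0 p k i j) = 0.
  rewrite /contract4 big1// => p _; rewrite big1// => k _; rewrite big1// => i _.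
  by rewrite big1// => j _; rewrite FE mulr0.
rewrite contract4D contract4Z contract4_sum => {FE} e; rewrite -[RHS]e; congr (_ + _).
  apply: eq_bigr => a _.
  rewrite /F !(contract4D, contract4Z) !contract4_split contract4_2 contract4_3 !contract4_5//.
  have BT : (B a b)^T = H b *m S *m H a by rewrite /B !trmx_mul Ss !Hs mulmxA.
  clearbody K; rewrite trmxK BT !Hs trH mul0r /W /B.
  rewrite (mxtrace_mulC (H b *m S *m H a *m S *m H a)) (mxtrace_mulC (H a *m S *m H b *m S *m H a)).
  rewrite !mulmxA (tr4 a b b a) (tr4 b a b a) (tr2 b a).
  rewrite (tr4 b b a a) (mxtrace_mulC (K b) (K a)).
  have -> : \tr (K b *m K a *m K b *m K a) = \tr (K a *m K b *m K a *m K b).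
    by rewrite mxtrace_mulC !mulmxA.
  have -> : \tr (K b *m K b *m K a *m K a) = \tr (K a *m K b *m K b *m K a).
    by rewrite mxtrace_mulC !mulmxA.
  move: (\tr (K a *m K b *m K a *m K b)) (\tr (K a *m K b *m K b *m K a)) (\tr (K a *m K b)).
  by move=> x1 x2 x3; ring.
rewrite /F0 !(contract4D, contract4Z) !contract4_split contract4_2 contract4_3.
clearbody K; rewrite gs Hs trH mul0r Sg mxtrace1 mul1mx /W -!(mulmxA _ S g).
rewrite Sg mulmx1 tr2; move: (\tr _) => x; ring.
Qed.

(* With [K a = C (H a) C^T], contraction of [commutation] with [S_ki (S (H b) S)_pj] reads
   [c m |K b|^2 = \sum_a (|[K a, K b]|^2 + tr (K a K b)^2)], where [c < 0]. *)
Lemma simons_vanishing b : H b = 0.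
Proof.
suff Kb : K b = 0.
  have uC : C \in unitmx by move: CgC; rewrite -mulmxA => /mulmx1_unit[].
  apply: (can_inj (mulKmx uC)); apply: (can_inj (mulmxK (_ : C^T \in unitmx))).
    by rewrite unitmx_tr.
  by rewrite mulmx0 mul0mx -[RHS]Kb.
apply: mxtrace_tr_eq0; rewrite Ks.
have cm : c * m%:R < 0 by rewrite nmulr_rlt0// ltr0n.
have := contracted b; set s := \sum_a _ => e.
have : s <= 0.
  apply: sumr_le0 => a _; rewrite subr_le0.
  have := mxtrace_commutator_le (Ks a) (Ks b); have := sqr_ge0 (\tr (K a *m K b)).
  move: (\tr (K a *m K b *m K a *m K b)) (\tr (K a *m K b *m K b *m K a)) (_ ^+ 2) => x y z; lra.
move=> s0; rewrite -(nmulr_rge0 _ cm).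
by move: e => /eqP; rewrite addrC addr_eq0 => /eqP ->; rewrite oppr_ge0.
Qed.
End SimonsVanishing.

(** * Vanishing of h for parallel minimal submanifolds of hyperbolic space *)

Section MinimalParallelHyperbolic.
Variables (R : realType) (m p : nat) (D : set 'rV[R]_m).
Variables (f : 'rV[R]_m -> 'rV[R]_(1 + (m + p))) (r : R).
Local Notation J := (mink R (m + p)).
Hypotheses (m0 : (0 < m)%N) (r0 : 0 < r) (Do : open D) (sf : smooth_on D f).
Hypothesis feps : forall u, D u -> ip J (f u) (f u) = - r ^+ 2.
Local Notation G := (metric J f).
Local Notation Gi := (imetric J f).
Hypothesis Gu : forall u, D u -> G u \in unitmx.
Local Notation d := (@dpart R m _).
Local Notation h := (hsff J f).

Let eps0 : - r ^+ 2 != 0. Proof. by rewrite oppr_eq0 expf_neq0// lt0r_neq0. Qed.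
Let Js : J^T = J. Proof. exact: mink_sym. Qed.

(** Tangent vectors are orthogonal to the time-like position vector, so the metric is positive and
    [cholesky] orthonormalises the rows of the Jacobian; [lorentz_frame] adds orthonormal normal
    vectors [B]. *)
Lemma hyperbolic_frame u : D u ->
  exists (C : 'M[R]_m) (B : 'M[R]_(p, 1 + (m + p))),
    [/\ C *m G u *m C^T = 1%:M, B *m J *m (f u)^T = 0, B *m J *m (jacobian f u)^T = 0 &
     (col_mx (r^-1 *: f u) (col_mx (C *m jacobian f u) B) : 'M[R]_(1 + (m + p))) *m J
      *m (col_mx (r^-1 *: f u) (col_mx (C *m jacobian f u) B))^T = J].
Proof.
move=> Du; have rn0 : r != 0 by exact: lt0r_neq0.
have GE : G u = jacobian f u *m J *m (jacobian f u)^T by rewrite -induced_metricE.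
have orth (v : 'rV[R]_m) : ip J (r^-1 *: f u) (v *m jacobian f u) = 0.
  have -> : v = \row_l v 0 l by apply/rowP => l; rewrite mxE.
  rewrite -(sum_row_jacobian sf)// ip_sumr big1// => l _.
  by rewrite ipZr ipZl (quadric_ip_d Js Do sf feps)// !mulr0.
have tt : ip J (r^-1 *: f u) (r^-1 *: f u) = -1.
  by rewrite ipZl ipZr feps// mulrN mulrN expr2 mulrA -mulrA mulKf// mulVf.
have [v v0|C CC] := cholesky (S := G u) (trmx_metric f Js u).
  have -> : (v *m G u *m v^T) 0 0 = ip J (v *m jacobian f u) (v *m jacobian f u).
    by rewrite /ip GE trmx_mul !mulmxA.
  apply: (mink_orth_pos (t := r^-1 *: f u)); rewrite ?tt ?ltrN10//.
  apply: contraNneq v0 => vj; apply/eqP; apply: (can_inj (mulmxK (Gu Du))).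
  by rewrite GE !mulmxA vj !mul0mx.
have TT : (C *m jacobian f u) *m J *m (C *m jacobian f u)^T = 1%:M.
  by rewrite -CC GE trmx_mul !mulmxA.
have [|B [Bt BT FF]] := lorentz_frame tt TT; first by move=> i; rewrite row_mul.
exists C, B; split=> //.
  by move: Bt; rewrite linearZ/= -scalemxAr => /(congr1 ( *:%R r)); rewrite scalerA mulfV// scale1r scaler0.
have uC : C^T \in unitmx by have /mulmx1_unit[] := CC.
by apply: (can_inj (mulmxK uC)); rewrite mul0mx -BT trmx_mul !mulmxA.
Qed.

Hypothesis min : forall u, D u -> mean_curvature J f u = 0.
Hypothesis par : forall k i j u, D u -> nabla_sff J f k i j u = 0.

Lemma minimal_parallel_hyperbolic i j u : D u -> h i j u = 0.
Proof.
move=> Du; have [C [B [CC Bf Bd FF]]] := hyperbolic_frame Du.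
have Gs := trmx_metric f Js u.
have SE : Gi u = C^T *m C.
  rewrite -imetricE; move: CC; rewrite -mulmxA => /mulmx1C; rewrite -mulmxA => GC.
  by rewrite -[LHS]mulmx1 -[X in _ *m X]GC mulKmx// Gu.
(* [h k l u] is orthogonal to the position row and to the tangent rows of the Lorentz frame. It
   therefore expands along the space-like rows of [B], and its scalar products are sums over [a]
   without signs. *)
have hB k l : h k l u = h k l u *m J *m B^T *m B.
  apply: (lorentz_frame_expand FF).
    rewrite linearZ/= -scalemxAr; have /orth_rowsP -> : forall i, ip J (h k l u) (row i (f u)) = 0.
      by move=> i'; rewrite ord1 row_id (sff_orth_pos Js Do sf eps0 feps Gu).
    by rewrite scaler0.
  rewrite trmx_mul mulmxA; have /orth_rowsP -> : forall i, ip J (h k l u) (row i (jacobian f u)) = 0.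
    by move=> i'; rewrite (row_jacobian _ sf)// (sff_orth_d Js Do sf eps0 feps Gu).
  by rewrite mul0mx.
pose H a : 'M[R]_m := \matrix_(k, l) ip J (h k l u) (row a B).
have HE a k l : H a k l = (h k l u *m J *m B^T) 0 a.
  rewrite /H [LHS]mxE /ip [LHS]mxE [RHS]mxE; apply: eq_bigr => q _.
  by rewrite !mxE.
suff H0 b0 : H b0 = 0.
  rewrite hB; have -> : h i j u *m J *m B^T = 0.
    by apply/rowP => a; rewrite -HE H0 !mxE.
  by rewrite mul0mx.
have A i1 j1 i2 j2 : ip J (h i1 j1 u) (h i2 j2 u) = \sum_a H a i1 j1 * H a i2 j2.
  rewrite [in LHS](hB i2 j2) /ip [in LHS]trmx_mul mulmxA mxE.
  by apply: eq_bigr => b _; rewrite !HE; congr (_ * _); rewrite mxE.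
have Hs a' : (H a')^T = H a'.
  by apply/matrixP => k l; rewrite !mxE (sffC Js Do sf eps0 feps Gu).
have trH a' : \tr (Gi u *m H a') = 0.
  have := min Du; rewrite /mean_curvature induced_metricE imetricE hsffE => /eqP.
  rewrite scaler_eq0 invr_eq0 pnatr_eq0 -leqn0 leqNgt m0 /= => /eqP/(congr1 (ip J ^~ (row a' B))).
  rewrite ip0l ip_suml => e; rewrite -[RHS]e mxtrace2; apply: eq_bigr => k _.
  rewrite ip_suml; apply: eq_bigr => l _.
  by rewrite ipZl mxE (sffC Js Do sf eps0 feps Gu).
apply: (simons_vanishing (c := (- r ^+ 2)^-1) m0 _ Gs CC SE Hs trH).
  by rewrite invr_lt0 oppr_lt0 exprn_gt0.
move=> b p' k i' j'.
have nuf : ip J (f u) (row b B) = 0.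
  by rewrite ipC// -(row_id 0 (f u)) -gramE Bf mxE.
have nud l : ip J (d l f u) (row b B) = 0.
  by rewrite ipC// -(row_jacobian l sf Du) -gramE Bd mxE.
(* By the Gauss equation each product of second forms is a sum of products of the [H a] plus a
   multiple of the metric. Contracted with the inverse metric and with [H b], the former give
   [H a * Gi * H b] and the latter collapses to [H b]. *)
have key (X : 'I_m -> R) (v : 'I_p -> R) (c : R) q j1 :
    (forall n, X n = \sum_a v a * H a q n + c * G u q n) ->
    \sum_l (\sum_n Gi u l n * X n) * H b l j1 =
    \sum_a v a * (H a *m Gi u *m H b) q j1 + c * H b q j1.
  move=> XE; pose x := \sum_a v a *: row q (H a) + c *: row q (G u).
  transitivity ((x *m Gi u *m H b) 0 j1).
    rewrite mxE; apply: eq_bigr => l _; congr (_ * _); rewrite mxE.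
    apply: eq_bigr => n _; rewrite mulrC invmetricC//; congr (_ * _).
    rewrite XE /x mxE summxE !mxE; congr (_ + _).
    by apply: eq_bigr => a _; rewrite !mxE.
  rewrite /x !mulmxDl mxE !mulmx_suml summxE; congr (_ + _).
    by apply: eq_bigr => a _; rewrite -!scalemxAl mxE -!row_mul mxE.
  rewrite -!scalemxAl mxE -!row_mul -imetricE mulmxV ?Gu// mul1mx mxE //.
have key2 i1 k1 k2 j1 :
    \sum_l (\sum_n Gi u l n *
      (ip J (second_form J f i1 k1 u) (second_form J f k2 n u)
       - ip J (second_form J f i1 k2 u) (second_form J f k1 n u))) * H b l j1 =
    (\sum_a H a i1 k1 * (H a *m Gi u *m H b) k2 j1 + (- r ^+ 2)^-1 * G u i1 k1 * H b k2 j1)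
    - (\sum_a H a i1 k2 * (H a *m Gi u *m H b) k1 j1 + (- r ^+ 2)^-1 * G u i1 k2 * H b k1 j1).
  have X k3 k4 n : ip J (second_form J f i1 k3 u) (second_form J f k4 n u) =
      \sum_a H a i1 k3 * H a k4 n + (- r ^+ 2)^-1 * G u i1 k3 * G u k4 n.
    rewrite (ip_second_form Js Do sf eps0 feps Gu)// A; congr (_ + _).
    by rewrite mulrC mulrA.
  rewrite -(key _ _ _ _ _ (X k1 k2)) -(key _ _ _ _ _ (X k2 k1)) -sumrB; apply: eq_bigr => l _.
  rewrite -mulrBl -sumrB; congr (_ * _); apply: eq_bigr => n _; exact: mulrBr.
have key3 k1 k2 : \sum_q (\sum_n Gi u q n * ip J (h i' j' u) (h k1 n u)) * H b k2 q =
    \sum_a H a i' j' * (H a *m Gi u *m H b) k1 k2.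
  have X n : ip J (h i' j' u) (h k1 n u) = \sum_a H a i' j' * H a k1 n + 0 * G u k1 n.
    by rewrite A mul0r addr0.
  rewrite -[RHS]addr0 -[X in _ + X](mul0r (H b k1 k2)) -(key _ _ _ _ _ X).
  by apply: eq_bigr => q _; rewrite -[in LHS](Hs b) [_^T _ _]mxE.
have Hbs k1 k2 : H b k1 k2 = H b k2 k1 by rewrite -[in LHS](Hs b) mxE.
have HbE k1 k2 : ip J (h k1 k2 u) (row b B) = H b k1 k2 by rewrite mxE.
have := parallel_commutation Js Do sf eps0 feps Gu par Du nuf nud p' k i' j'.
under eq_bigr do rewrite HbE.
under [X in _ + X - _ = _]eq_bigr do rewrite HbE (Hbs i').
under [X in _ - (X - _) = _]eq_bigr do rewrite HbE.
under [X in _ - (_ - X) = _]eq_bigr do rewrite HbE.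
rewrite !key2 !key3 => e; rewrite -[RHS]e !(sumrB, big_split)/=; ring.
Qed.

End MinimalParallelHyperbolic.

(** * Local diffeomorphisms and lifts of rays *)

Lemma smooth_id (R : realType) (m : nat) (D : set 'rV[R]_m) : open D -> smooth_on D id.
Proof.
move=> Do s u Du; case/lastP: s => [|s i]; first exact: ex_diff.
rewrite foldr_rcons (_ : pd i id = cst (delta_mx 0 i)); last first.
  by apply/funext => w; rewrite /pd derive_id.
exact: (smooth_cst Do).
Qed.

Lemma pd_id (R : realType) (m : nat) i (u : 'rV[R]_m) : dpart i id u = delta_mx 0 i.
Proof. by rewrite dpartE /pd derive_id. Qed.

Lemma ball_segment (R : realType) (m : nat) (u0 a b : 'rV[R]_m) (r s : R) :
  ball u0 r a -> ball u0 r b -> 0 <= s <= 1 -> ball u0 r (b + s *: (a - b)).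
Proof.
rewrite -!ball_normE /= => ra rb /andP[s0 s1].
have -> : u0 - (b + s *: (a - b)) = s *: (u0 - a) + (1 - s) *: (u0 - b).
  by apply/rowP => k; rewrite !mxE; ring.
rewrite (le_lt_trans (ler_normD _ _))// !normrZ ger0_norm// (ger0_norm (_ : 0 <= 1 - s)) ?subr_ge0//.
have [->|sn0] := eqVneq s 0; first by rewrite mul0r add0r subr0 mul1r.
have sp : 0 < s by rewrite lt_def sn0.
have : s * `|u0 - a| < s * r by rewrite ltr_pM2l.
have : (1 - s) * `|u0 - b| <= (1 - s) * r by rewrite ler_wpM2l ?subr_ge0// ltW.
move: (s * `|_|) ((1 - s) * `|_|) => x y; lra.
Qed.

(** * Local injectivity and openness from an invertible Jacobian *)

Section InverseFunction.
Variables (R : realType) (m : nat) (D : set 'rV[R]_m) (F : 'rV[R]_m -> 'rV[R]_m).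
Hypotheses (Do : open D) (sF : smooth_on D F).
Variable u0 : 'rV[R]_m.
Hypotheses (Du0 : D u0) (Ju : jacobian F u0 \in unitmx).
Let A := invmx (jacobian F u0).
(** Newton's map for [F] with the inverse Jacobian frozen at [u0]. Its derivative at [u0] is zero,
    so it contracts by one half on a small ball. *)
Let Phi u := u + F u *m (- A).

Let smooth_Phi : smooth_on D Phi.
Proof.
apply: smooth_add => //; last exact: smooth_mulmxr.
exact: smooth_id.
Qed.

Let pd_Phi i j : dpart i (fun u => Phi u 0 j) u0 = 0.
Proof.
have sFA : smooth_on D (fun u => F u *m (- A)) by exact: smooth_mulmxr.
rewrite -(pd_coord i j smooth_Phi Du0) (pd_add i (smooth_id Do) sFA Du0) pd_id.
rewrite (pd_mulmxr Do (- A) i sF Du0) -(row_jacobian i sF Du0) mulmxN -row_mul mulmxV//.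
by rewrite row1 subrr mxE.
Qed.

Lemma near_contraction : exists2 r : R, 0 < r & ball u0 r `<=` D /\
  forall a b, ball u0 r a -> ball u0 r b -> `|Phi a - Phi b| <= 2^-1 * `|a - b|.
Proof.
have m0 : 0 < (m.+1%:R : R) by rewrite ltr0n.
(* In the sup norm, [m] partial derivatives add up to at most one half; [m.+1] keeps the divisor
   positive when [m = 0]. *)
pose d : R := 2^-1 / m.+1%:R.
have d0 : 0 < d by rewrite divr_gt0// invr_gt0.
have nb i j : \forall u \near u0, `|dpart i (fun u => Phi u 0 j) u| < d.
  have c : {for u0, continuous (dpart i (fun u => Phi u 0 j))}.
    apply: differentiable_continuous; apply: (smooth_diff (smooth_pd _ _) Du0).
    exact: smooth_coord.
  move/cvgrPdist_lt : c => /(_ _ d0); apply: filterS => u.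
  by rewrite pd_Phi sub0r normrN.
have nb2 : \forall u \near u0, forall i j, `|dpart i (fun u => Phi u 0 j) u| < d.
  pose P i j := [set u | `|dpart i (fun u => Phi u 0 j) u| < d].
  have h i : \forall u \near u0, forall j, P i j u by exact: (filter_forall (f := P i) _ (nb i)).
  exact: (filter_forall (f := fun i u => forall j, P i j u) _ h).
have /nbhs_ballP[r /= r0 br] : nbhs u0 (D `&` [set u | forall i j,
    `|dpart i (fun u => Phi u 0 j) u| < d]).
  by apply: filterI => //; exact: open_nbhs_nbhs.
exists r => //; split=> [u /br[]//|a b ra rb].
have seg s := ball_segment (s := s) ra rb.
apply: rV_norm_le => [|j]; first by rewrite mulr_ge0// invr_ge0.
have sPj : smooth_on D (fun u => Phi u 0 j) by exact: smooth_coord.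
have [s s01] := MVT_line (F := fun u => Phi u 0 j) (w := b) (v := a - b)
  (fun s s01 => smooth_diff sPj (br _ (seg s s01)).1).
rewrite subrKC !mxE => ->; rewrite diff_sum_pd; last exact: (smooth_diff sPj (br _ (seg s s01)).1).
rewrite (le_trans (ler_norm_sum _ _ _))//.
have -> : 2^-1 * `|a - b| = m.+1%:R * (`|a - b| * d).
  rewrite /d [RHS]mulrCA [LHS]mulrC; congr (_ * _).
  by rewrite mulrCA mulfV ?mulr1// lt0r_neq0.
apply: (@le_trans _ _ (\sum_(i < m) `|a - b| * d)).
  apply: ler_sum => i _; rewrite normrM ler_pM//; first exact: rV_coord_le.
  exact/ltW/(br _ (seg s s01)).2.
rewrite sumr_const card_ord -[leLHS]mulr_natl ler_wpM2r ?ler_nat//.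
by rewrite mulr_ge0// ltW.
Qed.

Let uA : A \in unitmx. Proof. by rewrite unitmx_inv. Qed.

Lemma locally_injective : exists2 r : R, 0 < r & ball u0 r `<=` D /\
  forall a b, ball u0 r a -> ball u0 r b -> F a = F b -> a = b.
Proof.
have [r r0 [rD c]] := near_contraction; exists r => //; split=> // a b ra rb ab.
have := c a b ra rb; rewrite /Phi ab opprD addrACA subrr addr0 => h.
apply/eqP; rewrite -subr_eq0 -normr_le0; move: h; move: (`|a - b|) => x; lra.
Qed.

(** For [y] near [F u0], the residual [|(y - F u) A|] attains a minimum at some [c] of a closed
    ball. A Newton step from [c] stays in the ball and at least halves the residual, so the minimum
    is 0. *)
Lemma open_at N : nbhs u0 N -> nbhs (F u0) (F @` N).
Proof.
move=> Nu; have [r r0 [rD ctr]] := near_contraction.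
have /nbhs_ballP[s0 /= s00 sN] : nbhs u0 (N `&` ball u0 r).
  by apply: filterI => //; exact: nbhsx_ballx.
pose s := s0 / 2; have sp : 0 < s by rewrite divr_gt0.
pose B := closed_ball u0 s.
have BE u : B u <-> `|u0 - u| <= s by rewrite /B closed_ballE.
have Bs u : B u -> ball u0 s0 u.
  rewrite BE -ball_normE /= => /le_lt_trans; apply; rewrite /s ltr_pdivrMr//.
  by rewrite ltr_pMr// ltr1n.
have BN u : B u -> N u by move=> /Bs/sN[].
have Br u : B u -> ball u0 r u by move=> /Bs/sN[].
have B0 : B u0 by rewrite BE subrr normr0 ltW.
have cB : compact B.
  apply: bounded_closed_compact; last exact: closed_ball_closed.
  exists (`|u0| + s); split; first by rewrite num_real.
  move=> M hM u /BE us /=; rewrite (le_trans _ (ltW hM))//.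
  rewrite -[u](subKr u0) (le_trans (ler_normB _ _))// lerD2l.
  by [].
(* Half of the radius [s] absorbs the displacement of [y]; the other half is left for the
   contraction. *)
have nA : \forall y \near F u0, `|(y - F u0) *m A| <= s / 2.
  have s20 : 0 < s / 2 by rewrite divr_gt0.
  have /cvgrPdist_lt/(_ _ s20) := @continuous_mulmxr R m m A (F u0); apply: filterS => y.
  by rewrite distrC -mulmxBl => /ltW.
apply: filterS nA => y yA.
pose g u := `|(y - F u) *m A|.
have cg : {within B, continuous g}.
  apply: continuous_in_subspaceT => u; rewrite inE => /Br/rD Du.
  have sg : smooth_on D (fun w => y *m A + F w *m (- A)).
    by apply: smooth_add => //; [exact: (smooth_cst Do)|exact: smooth_mulmxr].
  rewrite /g (_ : (fun w => _) = (fun w => `|y *m A + F w *m (- A)|)); last first.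
    by apply/funext => w; rewrite mulmxBl mulmxN.
  have cs := differentiable_continuous (smooth_diff sg Du).
  exact: (continuous_comp cs (@norm_continuous _ _ _)).
have [c] := compact_EVT_min (ex_intro _ _ B0) cB cg; rewrite inE => Bc cmin.
have TE u : u + (y - F u) *m A = Phi u + y *m A.
  by rewrite /Phi mulmxBl mulmxN; rewrite addrAC addrA.
have BT : B (c + (y - F c) *m A).
  rewrite BE TE -normrN opprB.
  have -> : Phi c + y *m A - u0 = (Phi c - Phi u0) + (y - F u0) *m A.
    rewrite mulmxBl [Phi u0]/Phi mulmxN; move: (Phi c) (y *m A) (F u0 *m A) => a b e.
    by apply/rowP => k; rewrite !mxE; ring.
  rewrite (le_trans (ler_normD _ _))// [leRHS](splitr s) lerD//.
  rewrite (le_trans (ctr _ _ _ _))//; [exact: Br|exact: Br|].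
  by rewrite mulrC ler_pM2r ?invr_gt0// -normrN opprB; apply/BE.
have := cmin _ (mem_set BT); rewrite {2}/g.
(* For [x = c + (y - F c) A], the identity [TE] gives [x + (y - F x) A = Phi x + y A] and
   [x = Phi c + y A]; the difference of the two is the claim. *)
have -> : (y - F (c + (y - F c) *m A)) *m A = Phi (c + (y - F c) *m A) - Phi c.
  set x := c + _; apply: (addrI x); rewrite TE; move: (Phi x) => a; rewrite /x TE.
  by move: (Phi c) (y *m A) => b e; apply/rowP => k; rewrite !mxE; ring.
move=> /le_trans/(_ (ctr _ _ (Br _ BT) (Br _ Bc))).
rewrite addrAC subrr add0r -/(g c) => h.
exists c; first exact: BN.
have : (y - F c) *m A = 0.
  by apply/eqP; rewrite -normr_le0 -/(g c); move: h; move: (g c) => x; lra.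
rewrite -[X in _ = X](mul0mx _ A) => /(can_inj (mulmxK uA))/eqP.
by rewrite subr_eq0 => /eqP.
Qed.

End InverseFunction.

(** The local hypothesis applies to [y], [z] in either order, so both [P] and its complement are
    open relative to [A]. *)
Lemma connected_ind (T : topologicalType) (A P : set T) (a : T) :
  connected A -> A a -> P a ->
  (forall x, A x -> exists2 U : set T, nbhs x U &
     forall y z, A y -> A z -> U y -> U z -> P y -> P z) ->
  A `<=` P.
Proof.
move=> cA Aa Pa loc x Ax.
suff e : A = A `&` P by move: Ax; rewrite e => -[].
have op y : A y -> P y -> nbhs y [set z | A z -> P z].
  move=> Ay Py; have [U Uy UP] := loc y Ay.
  apply: (filterS _ Uy) => z Uz Az; apply: (UP y) => //; exact: (nbhs_singleton Uy).
have opN y : A y -> ~ P y -> nbhs y [set z | A z -> ~ P z].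
  move=> Ay Py; have [U Uy UP] := loc y Ay.
  apply: (filterS _ Uy) => z Uz Az Pz; apply: Py; apply: (UP z) => //; exact: (nbhs_singleton Uy).
symmetry; apply: cA; first by exists a.
  exists [set z | A z -> P z]°; first exact: open_interior.
  apply/seteqP; split=> [y [Ay Py]|y [Ay /interior_subset]]; last by move=> /(_ Ay).
  by split=> //; exact: op.
exists (~` [set z | A z -> ~ P z]°); first by apply: open_closedC; exact: open_interior.
apply/seteqP; split=> [y [Ay Py]|y [Ay nPy]].
  by split=> // /interior_subset/(_ Ay).
by split=> //; apply: contrapT => Py; apply: nPy; exact: opN.
Qed.

(** * Local homeomorphisms along which every ray lifts *)

Section RadialLifts.
Variables (R : realType) (V : normedModType R) (M : topologicalType) (zeta : M -> V).
Hypotheses (hM : hausdorff_space M) (cM : connected [set: M]) (cz : continuous zeta).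
Hypothesis inj : forall q : M, exists2 U : set M, nbhs q U &
  forall a b, U a -> U b -> zeta a = zeta b -> a = b.
Hypothesis op : forall (q : M) (N : set M), nbhs q N -> nbhs (zeta q) (zeta @` N).
Variables (q0 : M) (sigma : V -> R -> M).
Hypotheses (cs : forall p, continuous (sigma p : R -> M)) (s0 : forall p, sigma p 0 = q0).
Hypothesis zs : forall p t, zeta (sigma p t) = t *: p.

(** The times at which the lift lies in [U] form an open set. It is closed in [I] as well: over a
    limit time [s] there is a point [g] of [U], nearby values of the lift are the points of [U]
    close to [g] by injectivity on [U], and the Hausdorff property identifies [g] with
    [sigma p s]. *)
Let lift_stays (U : set M) (I : set R) p t : open U -> connected I ->
  (forall a b, U a -> U b -> zeta a = zeta b -> a = b) ->
  (forall s, I s -> (zeta @` U) (s *: p)) -> I t -> U (sigma p t) ->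
  forall s, I s -> U (sigma p s).
Proof.
move=> oU cI Ui IU It Ut.
have closed_at s : I s -> closure [set s | U (sigma p s)] s -> U (sigma p s).
  move=> Is cl; have [g Ug gE] := IU s Is.
  suff <- : g = sigma p s by [].
  apply: hM => N1 N2 N1g N2s.
  have zn : nbhs (s *: p) (zeta @` (N1 `&` U)).
    by rewrite -gE; apply: op; apply: filterI => //; exact: open_nbhs_nbhs.
  have n1 : nbhs s [set s' | (zeta @` (N1 `&` U)) (s' *: p)].
    exact: (@scalel_continuous _ _ p s).
  have n2 : nbhs s [set s' | N2 (sigma p s')] by exact: cs.
  have [s' [Us' [[a [N1a Ua] aE] N2s']]] := cl _ (filterI n1 n2).
  exists a; split=> //; suff -> : a = sigma p s' by [].
  by apply: Ui => //; rewrite aE zs.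
apply: (connected_ind cI It) => // s Is.
have [Us|nUs] := pselect (U (sigma p s)).
  exists [set s' | U (sigma p s')]; last by [].
  by apply: cs; exact: open_nbhs_nbhs.
exists (~` closure [set s | U (sigma p s)]).
  apply: open_nbhs_nbhs; split; last by move=> /(closed_at _ Is).
  by apply: closed_openC; exact: closed_closure.
by move=> y z _ _ ny _ Uy; exfalso; apply: ny; exact: subset_closure.
Qed.

(** Continuity of [sigma ^~ t] at [p] propagates in [t], starting from the constant map at [t = 0].
    Near [(t, p)] all rays run inside the image of an open set [U] on which [zeta] is injective; by
    [lift_stays] the lifts of nearby directions remain in [U], where they are determined by
    [zeta]. *)
Let section_continuous p : {for p, continuous (sigma ^~ 1)}.
Proof.
suff : [set: R] `<=` [set t | {for p, continuous (sigma ^~ t)}] by exact.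
apply: (connected_ind (a := 0)) => //.
- exact/connected_intervalP.
- by move=> N; rewrite s0 => N0; apply: nearW => p'; rewrite /= s0; exact: nbhs_singleton.
move=> t _.
have [U' U'q U'i] := inj (sigma p t).
have [U [oU Uq UU']] : exists U, [/\ open U, U (sigma p t) & U `<=` U'].
  by move: U'q; rewrite nbhsE => -[U [oU Uq] UU']; exists U.
have Ui a b : U a -> U b -> zeta a = zeta b -> a = b.
  by move=> /UU' Ua /UU' Ub; exact: U'i.
have nz : \forall x \near (t, p), (zeta @` U) (x.1 *: x.2).
  have zn : nbhs (t *: p) (zeta @` U) by rewrite -zs; apply: op; exact: open_nbhs_nbhs.
  exact: (@scale_continuous R V (t, p)).
have [d [e [d0 e0 de]]] : exists d e : R, [/\ 0 < d, 0 < e &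
    forall s p', ball t d s -> ball p e p' -> (zeta @` U) (s *: p')].
  case: nz => -[A B] /= [/nbhs_ballP[d /= d0 dA] /nbhs_ballP[e /= e0 eB]] AB.
  by exists d, e; split=> // s p' /dA As /eB Bp; exact: (AB (s, p')).
have cI : connected (ball t d).
  apply/connected_intervalP; rewrite ball_itv; exact: interval_is_interval.
exists (ball t d `&` [set s | U (sigma p s)]).
  apply: filterI; first exact: nbhsx_ballx.
  by apply: cs; exact: open_nbhs_nbhs.
move=> a b _ _ [ta Ua] [tb Ub] ca N Nb.
have n1 : nbhs p [set p' | U (sigma p' a)] by apply: ca; exact: open_nbhs_nbhs.
have n2 : nbhs p [set p' | (zeta @` (N `&` U)) (b *: p')].
  have zn : nbhs (b *: p) (zeta @` (N `&` U)).
    by rewrite -zs; apply: op; apply: filterI => //; exact: open_nbhs_nbhs.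
  exact: (@scaler_continuous _ _ b p).
apply: filterS (filterI (filterI n1 n2) (nbhsx_ballx p e e0)).
move=> p' [[Up' [x [Nx Ux] xE]] ep']; rewrite /=.
suff <- : x = sigma p' b by [].
apply: (Ui) => //; last by rewrite xE zs.
by apply: (lift_stays oU cI Ui _ ta Up') => // s ts; exact: de.
Qed.

(** The map [q |-> sigma (zeta q) 1] and the identity are two continuous lifts of [zeta]. They agree
    at [sigma 0 1], and their coincidence set is open by local injectivity and closed because [M] is
    Hausdorff. *)
Lemma radial_lift_inverse q : sigma (zeta q) 1 = q.
Proof.
suff : [set: M] `<=` [set q | sigma (zeta q) 1 = q] by exact.
apply: (connected_ind (a := sigma 0 1)) => //; first by rewrite /= zs scale1r.
move=> {}q _.
have cq : {for q, continuous (fun q' => sigma (zeta q') 1)}.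
  move=> N Nq; have h := @section_continuous (zeta q) N Nq.
  exact: (@cz q _ h).
have [e|ne] := pselect (sigma (zeta q) 1 = q).
  have [U Uq Ui] := inj q.
  exists (U `&` [set q' | U (sigma (zeta q') 1)]).
    by apply: filterI => //; apply: cq; rewrite /= e.
  by move=> y z _ _ _ [Uz Usz] _; apply: Ui => //; rewrite zs scale1r.
have [N1 [N2 [N1s N2q N12]]] : exists N1 N2, [/\ nbhs (sigma (zeta q) 1) N1, nbhs q N2 &
    forall x, N1 x -> ~ N2 x].
  apply: contrapT => h; apply: ne; apply: hM => N1 N2 n1 n2.
  apply: contrapT => h'; apply: h; exists N1, N2; split=> // x x1 x2.
  by apply: h'; exists x.
exists (N2 `&` [set q' | N1 (sigma (zeta q') 1)]); first by apply: filterI => //; exact: cq.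
by move=> y z _ _ [y2 /=] + _ ye; rewrite ye => y1; case: (N12 y y1 y2).
Qed.

End RadialLifts.

(** * Geodesics of totally geodesic submanifolds *)

Section Derivatives.
Variable R : realType.

Lemma is_derive_sumE (n : nat) (h : 'I_n -> R -> R) (dh : 'I_n -> R) (t : R) :
  (forall i, is_derive t 1 (h i) (dh i)) ->
  is_derive t 1 (fun s => \sum_i h i s) (\sum_i dh i).
Proof. by move=> dh'; rewrite -fct_sumE; exact: is_derive_sum. Qed.

Lemma is_derive_mulE (a b : R -> R) (da db t : R) :
  is_derive t 1 a da -> is_derive t 1 b db ->
  is_derive t 1 (fun s => a s * b s) (da * b t + a t * db).
Proof.
move=> ha hb; apply: is_derive_eq (is_deriveM ha hb) _.
by rewrite /GRing.scale /= addrC mulrC.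
Qed.

Lemma is_derive_mulcE (c : R) (b : R -> R) (db t : R) :
  is_derive t 1 b db -> is_derive t 1 (fun s => c * b s) (c * db).
Proof.
move=> hb; apply: is_derive_eq (is_derive_mulE (is_derive_cst c t 1) hb) _.
by rewrite mul0r add0r.
Qed.

Lemma ip_sumE (N : nat) (J : 'M[R]_N) u v :
  ip J u v = \sum_j (\sum_i u 0 i * J i j) * v 0 j.
Proof. by rewrite /ip mxE; apply: eq_bigr => j _; rewrite !mxE. Qed.

Lemma is_derive_ip (N : nat) (J : 'M[R]_N) (U V : R -> 'rV[R]_N) (U' V' : 'rV[R]_N) (t : R) :
  (forall a, is_derive t 1 (fun s => U s 0 a) (U' 0 a)) ->
  (forall a, is_derive t 1 (fun s => V s 0 a) (V' 0 a)) ->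
  is_derive t 1 (fun s => ip J (U s) (V s)) (ip J U' (V t) + ip J (U t) V').
Proof.
move=> hU hV; rewrite (_ : (fun s => _) =
  (fun s => \sum_j (\sum_i U s 0 i * J i j) * V s 0 j)); last first.
  by apply/funext => s; rewrite ip_sumE.
rewrite !ip_sumE -big_split; apply: is_derive_sumE => j; apply: is_derive_mulE => //.
apply: is_derive_sumE => i.
by apply: is_derive_eq (is_derive_mulE (hU i) (is_derive_cst _ _ _)) _; rewrite mulr0 addr0.
Qed.

Lemma is_derive_mulmxr (N n : nat) (K : 'M[R]_(N, n)) (U : R -> 'rV[R]_N) (U' : 'rV[R]_N)
    (t : R) (j : 'I_n) :
  (forall a, is_derive t 1 (fun s => U s 0 a) (U' 0 a)) ->
  is_derive t 1 (fun s => (U s *m K) 0 j) ((U' *m K) 0 j).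
Proof.
move=> hU; rewrite (_ : (fun s => _) = (fun s => \sum_a K a j * U s 0 a)); last first.
  by apply/funext => s; rewrite mxE; apply: eq_bigr => a _; rewrite mulrC.
rewrite mxE; under [X in is_derive _ _ _ X]eq_bigr do rewrite mulrC.
by apply: is_derive_sumE => a; exact: is_derive_mulcE.
Qed.

(* [x + sqrt (x ^ 2 + 1)] is the exponential of the inverse hyperbolic sine of [x]. *)
Lemma asinh_continuous (k : R) : 0 < k ->
  exists2 a : R -> R, continuous a & a 0 = 0 /\
    forall x, (expR (k * a x) - expR (- (k * a x))) / (2 * k) = x.
Proof.
move=> k0; pose X x := k * x + Num.sqrt ((k * x) ^+ 2 + 1).
have h x : 0 < (k * x) ^+ 2 + 1 by rewrite ltr_wpDl ?sqr_ge0.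
have Xpos x : 0 < X x.
  rewrite /X -ltrBlDl sub0r; have [kx|kx] := leP 0 (k * x).
    by rewrite (le_lt_trans _ (_ : 0 < _))// ?oppr_le0// sqrtr_gt0.
  by rewrite -[ltLHS]ger0_norm ?oppr_ge0 ?ltW// normrN -sqrtr_sqr ltr_sqrt// ltrDl.
exists (fun x => ln (X x) / k); last first.
  have kn0 : k != 0 by exact: lt0r_neq0.
  split; first by rewrite /X mulr0 expr0n add0r add0r sqrtr1 ln1 mul0r.
  move=> x; rewrite mulrCA mulfV// mulr1 expRN lnK ?posrE//.
  have -> : (X x)^-1 = Num.sqrt ((k * x) ^+ 2 + 1) - k * x.
    apply: (mulfI (lt0r_neq0 (Xpos x))); rewrite mulfV ?lt0r_neq0// /X.
    have := sqr_sqrtr (ltW (h x)); move: (Num.sqrt _) => q qq.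
    by transitivity (q ^+ 2 - (k * x) ^+ 2); [rewrite qq|]; ring.
  rewrite /X opprB [X in X / _](_ : _ = 2 * k * x); last by ring.
  by rewrite [LHS]mulrC mulKf// mulf_neq0// pnatr_eq0.
move=> x; have c1 : {for x, continuous ( *%R k)} by exact: mulrl_continuous.
have c2 : {for x, continuous (fun x => (k * x) ^+ 2 + 1)}.
  by apply: cvgD; [exact: (continuous_comp c1 (@exprn_continuous _ 2 _))|exact: cvg_cst].
have c3 : {for x, continuous X}.
  by apply: cvgD c1 _; exact: (continuous_comp c2 (@sqrt_continuous _ _)).
have c4 := continuous_comp c3 (continuous_ln (Xpos x)).
exact: (continuous_comp c4 (@mulrr_continuous _ k^-1 _)).
Qed.

Lemma is_derive_along (n : nat) (F : 'rV[R]_n -> R) (w : R -> 'rV[R]_n) (t : R) :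
  differentiable F (w t) -> derivable w t 1 ->
  is_derive t 1 (fun s => F (w s)) (\sum_i derive1 w t 0 i * dpart i F (w t)).
Proof.
move=> dF /derivable1_diffP dw.
have dFw : differentiable (F \o w) t by exact: differentiable_comp.
split; first by apply/derivable1_diffP.
rewrite -[fun s => _]/(F \o w) deriveE// diff_comp//= diff_sum_pd//.
by apply: eq_bigr => i _; rewrite derive1E deriveE.
Qed.

(* The factors [phi' + k phi] and [phi' - k phi] are exponentials. *)
Lemma sinh_ode (phi dphi : R -> R) (k a : R) : k != 0 ->
  (forall t : R, is_derive t (1 : R) phi (dphi t)) -> (forall t : R, is_derive t (1 : R) dphi (k ^+ 2 * phi t)) ->
  phi 0 = 0 -> dphi 0 = a ->
  forall t, phi t = a * (expR (k * t) - expR (- (k * t))) / (2 * k).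
Proof.
move=> k0 d1 d2 p0 dp0 t.
have key (e : R) s : (dphi s + e * k * phi s) * expR (- (e * k * s)) = a -> 
    dphi s + e * k * phi s = a * expR (e * k * s).
  by move=> <-; rewrite expRN mulfVK// gt_eqF// expR_gt0.
have cst (e : R) : e ^+ 2 = 1 ->
    (dphi t + e * k * phi t) * expR (- (e * k * t)) = a.
  move=> e1; pose F s := (dphi s + e * k * phi s) * expR (- (e * k * s)).
  have dF s : is_derive s (1 : R) F 0.
    have da : is_derive s (1 : R) (fun s => dphi s + e * k * phi s) (k ^+ 2 * phi s + e * k * dphi s).
      by apply: is_deriveD => //; exact: is_derive_mulcE.
    have db : is_derive s (1 : R) (fun s => expR (- (e * k * s))) (expR (- (e * k * s)) * - (e * k)).
      apply: (is_derive1_comp (f := expR) (g := fun s => - (e * k * s))).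
      apply: is_deriveN; rewrite -[X in is_derive _ _ _ X]mulr1.
      exact: (is_derive_mulcE (b := fun s => s) _ (is_derive_id _ _)).
    apply: is_derive_eq (is_derive_mulE da db) _.
    rewrite [RHS](_ : _ = (1 - e ^+ 2) * (k ^+ 2 * phi s * expR (- (e * k * s)))); first by ring.
    by rewrite e1 subrr mul0r.
  have := is_derive_0_is_cst t 0 dF; rewrite /F => ->.
  by rewrite p0 !mulr0 oppr0 expR0 mulr1 addr0.
have h1 := key _ _ (cst 1 (expr1n _ _)).
have h2 := key _ _ (cst (-1) (etrans (sqrrN 1) (expr1n _ _))).
have k2 : 2 * k != 0 by rewrite mulf_neq0// pnatr_eq0.
rewrite -[LHS](mulfK k2); congr (_ / _); rewrite mulrBr.
by rewrite mul1r in h1; rewrite mulN1r !mulNr in h2; rewrite -h1 -h2; ring.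
Qed.

(** The acceleration is a multiple of the position vector, which is orthogonal to the velocity
    because its squared norm is constant. *)
Lemma curve_speed_cst (N : nat) (J : 'M[R]_N) (Y Y' : R -> 'rV[R]_N) (c : R) (kap : R -> R) :
  J^T = J ->
  (forall (t : R) a, is_derive t (1 : R) (fun s => Y s 0 a) (Y' t 0 a)) ->
  (forall (t : R) a, is_derive t (1 : R) (fun s => Y' s 0 a) (kap t * Y t 0 a)) ->
  (forall t, ip J (Y t) (Y t) = c) ->
  forall t, ip J (Y' t) (Y' t) = ip J (Y' 0) (Y' 0).
Proof.
move=> Js d1 d2 q t.
have orth s : ip J (Y' s) (Y s) = 0.
  have [_ e] := is_derive_ip J (d1 s) (d1 s).
  have : (fun s => ip J (Y s) (Y s)) = cst c by apply/funext.
  move=> qE; move: e; rewrite qE derive_cst (ipC (Y s) _ Js) => e.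
  by move: e; lra.
apply: (@is_derive_0_is_cst _ (fun s => ip J (Y' s) (Y' s)) t 0) => s.
have d2' a : is_derive s 1 (fun s => Y' s 0 a) ((kap s *: Y s) 0 a).
  by rewrite mxE; exact: d2.
apply: is_derive_eq (is_derive_ip J d2' d2') _.
by rewrite ipZl ipZr (ipC (Y s) _ Js) orth mulr0 addr0.
Qed.

End Derivatives.

(** * Geodesics of a totally geodesic piece as curves in the ambient space *)

Section GeodesicCurve.
Variables (R : realType) (m N : nat) (J : 'M[R]_N) (D : set 'rV[R]_m).
Variables (f : 'rV[R]_m -> 'rV[R]_N) (eps : R).
Hypotheses (Js : J^T = J) (Do : open D) (sf : smooth_on D f).
Hypotheses (eps0 : eps != 0) (feps : forall u, D u -> ip J (f u) (f u) = eps).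
Hypothesis Gu : forall u, D u -> metric J f u \in unitmx.
Hypothesis h0 : forall i j u, D u -> hsff J f i j u = 0.
Variables (w : R -> 'rV[R]_m) (t : R).
Hypotheses (Dw : D (w t)) (dw : derivable w t 1).

Let vel s : 'rV[R]_N := \sum_i derive1 w s 0 i *: dpart i f (w s).

Lemma curve_velocity a : is_derive t 1 (fun s => f (w s) 0 a) (vel t 0 a).
Proof.
have sfa := smooth_coord Do a sf.
apply: is_derive_eq (is_derive_along (smooth_diff sfa Dw) dw) _.
by rewrite /vel summxE; apply: eq_bigr => i _; rewrite mxE (pd_coord i a sf Dw).
Qed.

Hypothesis d2w : derivable (derive1 w) t 1.
Hypothesis geo : derive1 (derive1 w) t + \row_k (\sum_i \sum_j
  gam J f k i j (w t) * derive1 w t 0 i * derive1 w t 0 j) = 0.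

Lemma ip_velocity :
  ip J (vel t) (vel t) = \sum_i \sum_j metric J f (w t) i j * derive1 w t 0 i * derive1 w t 0 j.
Proof.
rewrite /vel ip_suml; apply: eq_bigr => i _; rewrite ip_sumr; apply: eq_bigr => j _.
by rewrite ipZl ipZr -(metricE J sf) //; ring.
Qed.

(** With [h = 0] the Gauss formula writes each second derivative of [f] as a tangential part and a
    multiple of [f]. The geodesic equation cancels the tangential part of the acceleration, which
    leaves the position component. *)
Lemma curve_acceleration a :
  is_derive t 1 (fun s => vel s 0 a) (- (ip J (vel t) (vel t) / eps) * f (w t) 0 a).
Proof.
rewrite (_ : (fun s => _) = (fun s => \sum_i derive1 w s 0 i * dpart i f (w s) 0 a)); last first.
  by apply/funext => s; rewrite /vel summxE; apply: eq_bigr => i _; rewrite mxE.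
have d1 i : is_derive t 1 (fun s => derive1 w s 0 i) (derive1 (derive1 w) t 0 i).
  split; first by move/derivable_mxP : d2w; exact.
  by rewrite [in RHS]derive1E (derive_mx d2w) mxE.
have d2 i : is_derive t 1 (fun s => dpart i f (w s) 0 a)
    (\sum_j derive1 w t 0 j * dpart j (dpart i f) (w t) 0 a).
  have sdf := smooth_pd i sf; have sdfa := smooth_coord Do a sdf.
  apply: is_derive_eq (is_derive_along (smooth_diff sdfa Dw) dw) _.
  by apply: eq_bigr => j _; rewrite (pd_coord j a sdf Dw).
apply: is_derive_eq (is_derive_sumE (fun i => is_derive_mulE (d1 i) (d2 i))) _.
have ddf i j : dpart j (dpart i f) (w t) = \sum_k gam J f k j i (w t) *: dpart k f (w t)
    - (metric J f (w t) j i / eps) *: f (w t).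
  have := sffE Js Do sf eps0 feps Gu j i Dw; rewrite h0// second_formE => /esym/eqP.
  by rewrite addr_eq0 subr_eq => /eqP ->; rewrite addrC.
have w2 k : derive1 (derive1 w) t 0 k = - \sum_i \sum_j
    gam J f k i j (w t) * derive1 w t 0 i * derive1 w t 0 j.
  by move/rowP/(_ k) : geo; rewrite !mxE => /eqP; rewrite addr_eq0 => /eqP.
rewrite ip_velocity.
under eq_bigr do rewrite w2.
transitivity (\sum_i (derive1 w t 0 i * \sum_j derive1 w t 0 j * (dpart j (dpart i f) (w t) 0 a))
    - \sum_k (\sum_i \sum_j gam J f k i j (w t) * derive1 w t 0 i * derive1 w t 0 j)
        * dpart k f (w t) 0 a).
  by rewrite -sumrN -big_split/=; apply: eq_bigr => i _; rewrite mulNr addrC.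
under eq_bigr do under eq_bigr do rewrite ddf 2!mxE summxE mxE.
move: (derive1 w t) (gam J f) (metric J f (w t)) => v Gam G.
have -> : \sum_k (\sum_i \sum_j Gam k i j (w t) * v 0 i * v 0 j) * dpart k f (w t) 0 a =
    \sum_i v 0 i * \sum_j v 0 j * \sum_k (Gam k j i (w t) *: dpart k f (w t)) 0 a.
  transitivity (\sum_k \sum_i \sum_j Gam k i j (w t) * v 0 i * v 0 j * dpart k f (w t) 0 a).
    by apply: eq_bigr => k _; rewrite mulr_suml; apply: eq_bigr => i _; rewrite mulr_suml.
  rewrite exchange_big/=; under eq_bigr do rewrite exchange_big/=.
  rewrite exchange_big/=; apply: eq_bigr => i _; rewrite mulr_sumr; apply: eq_bigr => j _.
  by rewrite !mulr_sumr; apply: eq_bigr => k _; rewrite mxE; ring.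
rewrite -sumrB mulr_suml mulNr mulr_suml -sumrN [RHS](eq_bigr (fun i => \sum_j
    - (G i j * v 0 i * v 0 j / eps * f (w t) 0 a))); last first.
  by move=> i _; rewrite !mulr_suml -sumrN.
rewrite [RHS]exchange_big/=; apply: eq_bigr => i _.
rewrite -mulrBr -sumrB mulr_sumr; apply: eq_bigr => j _; ring.
Qed.

End GeodesicCurve.

(** * Constancy of the osculating space *)

Section TotallyGeodesic.
Variables (R : realType) (m N : nat) (J : 'M[R]_N) (D : set 'rV[R]_m).
Variables (f : 'rV[R]_m -> 'rV[R]_N) (eps : R).
Hypotheses (Js : J^T = J) (Do : open D) (sf : smooth_on D f).
Hypotheses (eps0 : eps != 0) (feps : forall u, D u -> ip J (f u) (f u) = eps).
Hypothesis Gu : forall u, D u -> metric J f u \in unitmx.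
Hypothesis h0 : forall i j u, D u -> hsff J f i j u = 0.
Local Notation d := (@dpart R m _).
Local Notation Gi := (imetric J f).
Variable n : 'rV[R]_N.

Let al l u : R := \sum_k Gi u l k * ip J (d k f u) n.
Let be u : R := ip J (f u) n / eps.
(* The component of [n] orthogonal to the position vector and to the tangent space. *)
Let wn u : 'rV[R]_N := n - (\sum_l al l u *: d l f u + be u *: f u).

Let sal l : smooth_on D (al l).
Proof.
apply: smooth_sum => // k _; apply: smooth_mul => //; first exact: smooth_invmetric.
exact: (smooth_ip Do J (smooth_pd k sf) (smooth_cst Do n)).
Qed.
Let sbe : smooth_on D be.
Proof.
apply: smooth_mul => //; last exact: smooth_cst.
exact: (smooth_ip Do J sf (smooth_cst Do n)).
Qed.
Let swn : smooth_on D wn.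
Proof.
apply: eq_smooth_on (_ : smooth_on D (fun u => n + (-1) *: (\sum_l al l u *: d l f u + be u *: f u))) => //.
  by move=> u _; rewrite scaleN1r.
apply: smooth_add; [by []|exact: smooth_cst|apply: smooth_scale => //; first exact: smooth_cst].
apply: smooth_add => //; last exact: smooth_scale.
apply: smooth_sum => // l _; apply: smooth_scale => //; exact: smooth_pd.
Qed.

Let wn_pos u : D u -> ip J (wn u) (f u) = 0.
Proof.
move=> Du; rewrite /wn ipBl ipDl ipZl ip_suml big1 => [|l _]; last first.
  by rewrite ipZl ipC// (quadric_ip_d Js Do sf feps)// mulr0.
by rewrite feps// /be mulfVK// add0r ipC// subrr.
Qed.

Let wn_d u q : D u -> ip J (wn u) (d q f u) = 0.
Proof.
move=> Du; rewrite /wn ipBl ipDl ipZl ip_suml (quadric_ip_d Js Do sf feps)// mulr0 addr0.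
rewrite (_ : \sum_l _ = ip J (d q f u) n); first by rewrite ipC// subrr.
transitivity (\sum_k (\sum_l metric J f u q l * Gi u l k) * ip J (d k f u) n).
  under [RHS]eq_bigr do rewrite mulr_suml.
  rewrite [RHS]exchange_big; apply: eq_bigr => l _; rewrite ipZl -(metricE J sf)// /al mulr_suml.
  by apply: eq_bigr => k _; rewrite (metricC f Js u l); ring.
under eq_bigr do rewrite (metricVK Gu)//.
rewrite (bigD1 q)//= eqxx mul1r big1 ?addr0// => k kq.
by rewrite eq_sym (negbTE kq) mul0r.
Qed.

Let ddf i j u : D u -> d i (d j f) u = \sum_k gam J f k i j u *: d k f u
    - (metric J f u i j / eps) *: f u.
Proof.
move=> Du; have := sffE Js Do sf eps0 feps Gu i j Du; rewrite h0// second_formE => /esym/eqP.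
by rewrite addr_eq0 subr_eq => /eqP ->; rewrite addrC.
Qed.

(** Since [h = 0], the span of the position and tangent vectors is closed under differentiation, so
    [d k wn] lies in it. Differentiating the orthogonality relations of [wn] shows that it is also
    orthogonal to this span, whose Gram matrix is invertible. *)
Let d_wn k u : D u -> d k wn u = 0.
Proof.
move=> Du.
have sub_f : (f u <= quadric_frame f u)%MS by rewrite -addsmxE addsmxSl.
have sub_d l : (d l f u <= quadric_frame f u)%MS.
  by rewrite -(row_jacobian l sf Du) -addsmxE (submx_trans (row_sub _ _)) ?addsmxSr.
have sub_dd i j : (d i (d j f) u <= quadric_frame f u)%MS.
  rewrite ddf// addmx_sub ?eqmx_opp ?scalemx_sub// summx_sub// => l _; exact: scalemx_sub.
have spd l := smooth_pd l sf.
have sl l : smooth_on D (fun u => al l u *: d l f u) by exact: smooth_scale.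
have ssum : smooth_on D (fun u => \sum_l al l u *: d l f u) by exact: smooth_sum.
have sb : smooth_on D (fun u => be u *: f u) by exact: smooth_scale.
have sS := smooth_add Do ssum sb.
have wE : d k wn u = - (d k (fun u => \sum_l al l u *: d l f u + be u *: f u) u).
  rewrite (eq_pd_on Do (g := fun u => n + (-1) *: (\sum_l al l u *: d l f u + be u *: f u)))//; last first.
    by move=> v _; rewrite scaleN1r.
  have s1 := smooth_scale Do (smooth_cst Do (-1 : R)) sS.
  rewrite (pd_add k (smooth_cst Do n) s1 Du) pd_cst add0r.
  by rewrite (pd_scale Do k (smooth_cst Do (-1 : R)) sS Du) pd_cst scale0r add0r scaleN1r.
have sub : (d k wn u <= quadric_frame f u)%MS.
  rewrite wE eqmx_opp (pd_add k ssum sb Du) (pd_sum Do _ k (fun l _ => sl l) Du).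
  rewrite (pd_scale Do k sbe sf Du) !addmx_sub ?scalemx_sub// summx_sub// => l _.
  by rewrite (pd_scale Do k (sal l) (spd l) Du) addmx_sub ?scalemx_sub.
have o1 : ip J (d k wn u) (f u) = 0.
  have := pd_ip Do J k swn sf Du; rewrite (eq_pd_on Do (g := fun=> (0 : R)))// ?pd_cst.
  by rewrite wn_d// addr0.
have o2 q : ip J (d k wn u) (d q f u) = 0.
  have := pd_ip Do J k swn (smooth_pd q sf) Du.
  rewrite (eq_pd_on Do (g := fun=> (0 : R)))// ?pd_cst; last by move=> v Dv; exact: wn_d.
  rewrite ddf// ipBr ipZr wn_pos// mulr0 subr0 ip_sumr big1 ?addr0// => l _.
  by rewrite ipZr wn_d// mulr0.
have o : d k wn u *m J *m (quadric_frame f u)^T = 0.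
  by apply/(quadric_frame_orthP J sf _ Du).
move/submxP : sub => [x xE]; rewrite xE in o *.
have uF := quadric_frame_unit Js Do sf eps0 feps Gu Du.
have -> : x = 0; last by rewrite mul0mx.
by apply: (can_inj (mulmxK uF)); rewrite mul0mx -[RHS]o !mulmxA.
Qed.

(** If [n] is normal at [a] then [wn a = n]; [wn] is constant on the ball, so [n = wn b] is
    orthogonal to [f b]. *)
Lemma totally_geodesic_normal (u a b : 'rV[R]_m) (e : R) :
  ball u e `<=` D -> ball u e a -> ball u e b ->
  ip J (f a) n = 0 -> (forall l, ip J (d l f a) n = 0) -> ip J (f b) n = 0.
Proof.
move=> eD ea eb fa da.
have wa : wn a = n.
  rewrite /wn /be fa mul0r scale0r addr0 big1 ?subr0// => l _.
  by rewrite /al big1 ?scale0r// => k _; rewrite da mulr0.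
suff wb : wn b = n by rewrite ipC// -[X in ip J X _]wb wn_pos//; exact: eD.
rewrite -[RHS]wa; apply/rowP => j; apply/eqP; rewrite -subr_eq0; apply/eqP.
have swj := smooth_coord Do j swn.
have seg s (s01 : 0 <= s <= 1) := eD _ (ball_segment eb ea s01).
have [s s01] := MVT_line (fun s s01 => smooth_diff swj (seg s s01)).
rewrite subrKC => ->; rewrite (diff_sum_pd _ (smooth_diff swj (seg s s01))).
rewrite big1// => i _; rewrite -(pd_coord i j swn (seg s s01)) d_wn; last exact: seg.
by rewrite [(0 : 'rV[R]_N) _ _]mxE scaler0.
Qed.

End TotallyGeodesic.

(** * Rigidity *)

Lemma unitmx_inj (F : fieldType) (n : nat) (G : 'M[F]_n) :
  (forall v : 'rV[F]_n, v *m G = 0 -> v = 0) -> G \in unitmx.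
Proof.
move=> inj; rewrite -row_free_unit -kermx_eq0; apply/eqP/eqP; apply/rowV0P => v /sub_kermxP.
exact: inj.
Qed.

Lemma row_free_inj0 (F : fieldType) (n k : nat) (G : 'M[F]_(n, k)) :
  (forall v : 'rV[F]_n, v *m G = 0 -> v = 0) -> row_free G.
Proof.
by move=> inj; rewrite -kermx_eq0; apply/rowV0P => v /sub_kermxP; exact: inj.
Qed.

(** * Coordinates in a Lorentz frame *)

Section LorentzCoordinates.
Variables (R : realType) (m p : nat).
Local Notation J := (mink R (m + p)).

Lemma mink_row (a a' : 'rV[R]_1) (b b' : 'rV[R]_(m + p)) :
  ip J (row_mx a b) (row_mx a' b') = - (a 0 0 * a' 0 0) + ip (eucl R (m + p)) b b'.
Proof.
by rewrite ip_mink !row_mxKr !row_mx_ord0.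
Qed.

Lemma eucl_row (b b' : 'rV[R]_m) (c c' : 'rV[R]_p) :
  ip (eucl R (m + p)) (row_mx b c) (row_mx b' c') = ip (eucl R m) b b' + ip (eucl R p) c c'.
Proof.
by rewrite /ip /eucl !mulmx1 tr_row_mx mul_row_col mxE.
Qed.

Lemma hyperbolic_inclE (a : 'rV[R]_1) (b : 'rV[R]_m) :
  hyperbolic_incl p (row_mx a b) = row_mx a (row_mx b 0).
Proof. by rewrite row_mxA; symmetry; exact: castmx_id. Qed.

Variables (t : 'rV[R]_(1 + (m + p))) (T : 'M[R]_(m, 1 + (m + p))) (B : 'M[R]_(p, 1 + (m + p))).
Let F : 'M[R]_(1 + (m + p)) := col_mx t (col_mx T B).
Hypothesis FF : F *m J *m F^T = J.
(** The inverse of the frame matrix [F], as [F J F^T = J] and [J J = 1]: multiplication by it on the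
    right yields the coordinates of a vector in the frame. *)
Definition lorentz_map : 'M[R]_(1 + (m + p)) := J *m F^T *m J.
Let Js : J^T = J. Proof. exact: mink_sym. Qed.

Lemma lorentz_mapE (v : 'rV[R]_(1 + (m + p))) : v *m lorentz_map =
  row_mx (- (v *m J *m t^T)) (row_mx (v *m J *m T^T) (v *m J *m B^T)).
Proof.
rewrite /lorentz_map !mulmxA /F !tr_col_mx !mul_mx_row {3}/mink mul_row_block.
by rewrite !mulmx0 addr0 add0r mulmxN !mulmx1.
Qed.

Let FJF : F^T *m J *m F = J.
Proof.
have : F *m (J *m F^T *m J) = 1%:M by rewrite !mulmxA FF minkK.
move=> /mulmx1C FK; apply: (can_inj (mulKmx (_ : J \in unitmx))).
  by have [] := mulmx1_unit (minkK R (m + p)).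
by rewrite !mulmxA minkK.
Qed.

Lemma lorentz_map_form : lorentz_map *m J *m lorentz_map^T = J.
Proof.
rewrite /lorentz_map !trmx_mul trmxK Js; clearbody F.
transitivity (J *m (F^T *m (J *m J) *m J *m F) *m J); first by rewrite !mulmxA.
by rewrite minkK mulmx1 FJF minkK mul1mx.
Qed.

Lemma ip_lorentz_map (v w : 'rV[R]_(1 + (m + p))) : ip J (v *m lorentz_map) (w *m lorentz_map) = ip J v w.
Proof.
have := lorentz_map_form; move: lorentz_map => L LL.
transitivity ((v *m (L *m J *m L^T) *m w^T) 0 0); last by rewrite LL.
by rewrite /ip trmx_mul !mulmxA.
Qed.

Lemma lorentz_map_inj (v : 'rV[R]_(1 + (m + p))) : v *m lorentz_map = 0 -> v = 0.
Proof.
have := lorentz_map_form; move: lorentz_map => L LL v0.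
apply: (can_inj (mulmxK (_ : J \in unitmx))).
  by have [] := mulmx1_unit (minkK R (m + p)).
by rewrite mul0mx -LL !mulmxA v0 !mul0mx.
Qed.

(** Otherwise [a0 b0 <= ab], while Cauchy's inequality gives [ab^2 <= aa bb < a0^2 b0^2] for
    time-like vectors. *)
Lemma mink_timelike_lt0 (a b : 'rV[R]_(1 + (m + p))) : ip J a a < 0 -> ip J b b < 0 ->
  0 < a 0 ord0 -> 0 < b 0 ord0 -> ip J a b < 0.
Proof.
rewrite !ip_mink; set a0 := a 0 ord0; set b0 := b 0 ord0.
set aa := ip _ (rsubmx a) (rsubmx a); set ab := ip _ (rsubmx a) (rsubmx b).
set bb := ip _ (rsubmx b) (rsubmx b) => ha hb a0p b0p.
have cs : ab ^+ 2 <= aa * bb by exact: eucl_cauchy.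
have aa0 : 0 <= aa by exact: eucl_ge0.
have bb0 : 0 <= bb by exact: eucl_ge0.
rewrite addrC subr_lt0 ltNge; apply/negP => h.
have : (a0 * b0) ^+ 2 <= ab ^+ 2 by rewrite ler_sqr ?nnegrE// ?(le_trans _ h)// mulr_ge0// ltW.
have : aa * bb < (a0 * a0) * (b0 * b0).
  rewrite addrC subr_lt0 in ha; rewrite addrC subr_lt0 in hb.
  by rewrite ltr_pM.
rewrite exprMn !expr2; move: cs; rewrite expr2.
move: (ab * ab) (aa * bb) (a0 * a0 * (b0 * b0)) => x1 x2 x3; lra.
Qed.

Lemma hyperbolic_lorentz_map : ip J t t < 0 -> 0 < t 0 ord0 -> hyperbolic_isometry lorentz_map.
Proof.
move=> tt t0; split; first exact: lorentz_map_form.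
move=> c v c0 [vv v0]; split; first by rewrite ip_lorentz_map.
rewrite lorentz_mapE row_mx_ord0 mxE oppr_gt0; apply: mink_timelike_lt0 => //.
by rewrite vv invr_lt0.
Qed.

End LorentzCoordinates.

(** * Transfer of neighbourhoods between a manifold and its charts *)

Section Charts.
Variables (R : realType) (T : topologicalType) (m : nat) (A : set (chart R T m)).
Hypothesis hM : smooth_manifold A.

Lemma chart_im_open c : A c -> open (chart_im c).
Proof. by case: hM => _ _ + _ _ => /[apply] -[]. Qed.

Lemma chart_at q : exists c, [/\ A c, cdom c q, chart_im c (cmap c q) & cinv c (cmap c q) = q].
Proof.
case: hM => _ _ ax cov _; have [c Ac cq] := cov q.
by have [_ _ inv _ _] := ax c Ac; exists c; split=> //; [exists q|exact: inv].
Qed.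

Lemma cinv_cmap c q : A c -> cdom c q -> cinv c (cmap c q) = q.
Proof. by case: hM => _ _ + _ _ => /[apply] -[_ _ + _ _]; exact. Qed.

Lemma nbhs_cmap c q N : A c -> cdom c q -> nbhs (cmap c q) N ->
  nbhs q [set q' | cdom c q' /\ N (cmap c q')].
Proof.
case: hM => _ _ ax _ _ Ac cq Nq; have [od _ _ cm _] := ax c Ac.
by apply: filterI; [exact: open_nbhs_nbhs|exact: cm].
Qed.

Lemma nbhs_cinv c q N : A c -> cdom c q -> nbhs q N ->
  nbhs (cmap c q) [set u | chart_im c u /\ N (cinv c u)].
Proof.
case: hM => _ _ ax _ _ Ac cq Nq; have [_ oi inv _ ci] := ax c Ac.
have iq : chart_im c (cmap c q) by exists q.
apply: filterI; first exact: open_nbhs_nbhs.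
by apply: ci => //; rewrite inv.
Qed.

End Charts.

(** A kernel vector of the metric gives a tangent vector of squared norm 0 orthogonal to the
    time-like position vector, so [mink_orth_pos] forces it to be zero. *)
Lemma hyperbolic_metric_unit (R : realType) (m p : nat) (D : set 'rV[R]_m)
    (f : 'rV[R]_m -> 'rV[R]_(1 + (m + p))) (eps : R) (u : 'rV[R]_m) :
  open D -> smooth_on D f -> eps < 0 ->
  (forall u, D u -> ip (mink R (m + p)) (f u) (f u) = eps) ->
  D u -> row_free (jacobian f u) -> metric (mink R (m + p)) f u \in unitmx.
Proof.
move=> Do sf eps0 feps Du rf; apply: unitmx_inj => v vG.
have Js : (mink R (m + p))^T = mink R (m + p) := mink_sym R _.
apply: (row_free_inj rf); rewrite mul0mx; apply: contrapT => /eqP w0.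
have o : ip (mink R (m + p)) (f u) (v *m jacobian f u) = 0.
  have -> : v = \row_l v 0 l by apply/rowP => l; rewrite mxE.
  rewrite -(sum_row_jacobian sf)// ip_sumr big1// => l _.
  by rewrite ipZr (quadric_ip_d Js Do sf feps)// mulr0.
have := mink_orth_pos (t := f u) _ o w0; rewrite feps// => /(_ eps0).
by rewrite /ip trmx_mul !mulmxA -(mulmxA v) -(mulmxA v) -/(induced_metric _ _ _) induced_metricE
  vG mul0mx mxE ltxx.
Qed.

(** * Totally geodesic submanifolds of hyperbolic space *)

Section HyperbolicRigidity.
Variables (R : realType) (m p : nat) (M : topologicalType) (A : set (chart R M m)).
Variables (y : M -> 'rV[R]_(1 + (m + p))) (r : R).
Local Notation J := (mink R (m + p)).
Hypotheses (r0 : 0 < r) (hM : smooth_manifold A) (hy : immersion A y).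
Hypothesis yH : forall q, hyperbolic (m + p) (- (r ^+ 2)^-1) (y q).
Hypothesis h0 : forall c i j u, A c -> chart_im c u -> hsff J (y \o cinv c) i j u = 0.
Hypothesis cM : connected [set: M].

Let Js : J^T = J. Proof. exact: mink_sym. Qed.
Let r2 : 0 < r ^+ 2. Proof. exact: exprn_gt0. Qed.
Let feps q : ip J (y q) (y q) = - r ^+ 2.
Proof. by have [-> _] := yH q; rewrite invrN invrK. Qed.
Let eps_lt0 : - r ^+ 2 < 0. Proof. by rewrite oppr_lt0. Qed.
Let eps0 : - r ^+ 2 != 0. Proof. exact: ltr0_neq0. Qed.

Let sf c : A c -> smooth_on (chart_im c) (y \o cinv c). Proof. exact: hy.1. Qed.
Let Gu c u : A c -> chart_im c u -> metric J (y \o cinv c) u \in unitmx.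
Proof.
move=> Ac cu; have rf := hy.2 c u Ac cu.
exact: (hyperbolic_metric_unit (chart_im_open hM Ac) (sf Ac) eps_lt0 (fun u _ => feps _) cu rf).
Qed.

Variables (c0 : chart R M m) (q0 : M).
Hypotheses (Ac0 : A c0) (cq0 : cdom c0 q0).
Let u0 := cmap c0 q0.
Let f0 := y \o cinv c0.
Variables (C : 'M[R]_m) (B : 'M[R]_(p, 1 + (m + p))).
Let t := r^-1 *: f0 u0.
Let T := C *m jacobian f0 u0.
Hypotheses (Bf : B *m J *m (f0 u0)^T = 0)
  (Bd : B *m J *m (jacobian f0 u0)^T = 0).
Hypothesis FF : (col_mx t (col_mx T B) : 'M[R]_(1 + (m + p))) *m J *m (col_mx t (col_mx T B))^T = J.

Let im0 : chart_im c0 u0. Proof. by exists q0. Qed.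
Let f0u0 : f0 u0 = y q0. Proof. by rewrite /f0 /= (cinv_cmap hM). Qed.

Let normal_at (n : 'rV[R]_(1 + (m + p))) c u : A c -> chart_im c u ->
  nbhs u [set v | ip J (y (cinv c v)) n = 0] ->
  forall l, ip J (dpart l (y \o cinv c) u) n = 0.
Proof.
move=> Ac cu; rewrite nbhsE => -[V [oV Vu] Vn] l.
have sO : smooth_on V (fun v => ip J (y (cinv c v)) n).
  by apply: eq_smooth_on (smooth_cst oV (0 : R)) => // v Vv; rewrite (Vn v Vv).
have := pd_ip (chart_im_open hM Ac) J l (sf Ac) (smooth_cst (chart_im_open hM Ac) n) cu.
rewrite pd_cst ip0r addr0 => <-.
by rewrite (eq_pd_on oV (g := fun=> (0 : R)))// pd_cst.
Qed.

(** The property propagated over [M] is the vanishing of [<y, n>] on a neighbourhood, not at a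
    point: it includes the vanishing of the first derivatives, needed to restart
    [totally_geodesic_normal] in the next chart. *)
Let normal_global (n : 'rV[R]_(1 + (m + p))) : ip J (f0 u0) n = 0 ->
  (forall l, ip J (dpart l f0 u0) n = 0) -> forall q, ip J (y q) n = 0.
Proof.
move=> n0 nd q.
have spread c q1 q2 e u : A c -> ball u e `<=` chart_im c ->
    cdom c q1 -> ball u e (cmap c q1) -> cdom c q2 -> ball u e (cmap c q2) ->
    ip J ((y \o cinv c) (cmap c q1)) n = 0 ->
    (forall l, ip J (dpart l (y \o cinv c) (cmap c q1)) n = 0) ->
    nbhs q2 [set q' | ip J (y q') n = 0].
  move=> Ac eD d1 b1 d2 b2 n1 n1d.
  have : nbhs (cmap c q2) (ball u e) by apply: open_nbhs_nbhs; split=> //; exact: ball_open.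
  move=> /(nbhs_cmap hM Ac d2); apply: filterS => q' [d' b'] /=.
  rewrite -(cinv_cmap hM Ac d').
  exact: (totally_geodesic_normal Js (chart_im_open hM Ac) (sf Ac) eps0 (fun u _ => feps _)
    (fun u => Gu Ac) (fun i j u => h0 i j Ac) eD b1 b' n1 n1d).
suff : [set: M] `<=` [set q | nbhs q [set q' | ip J (y q') n = 0]].
  by move=> /(_ q I)/nbhs_singleton.
apply: (connected_ind (a := q0) cM) => //.
  have /nbhs_ballP[e /= e0 eD] := open_nbhs_nbhs (conj (chart_im_open hM Ac0) im0).
  by apply: (spread c0 q0 q0 e u0) => //; exact: ballxx.
move=> x _; have [c [Ac dx ix xE]] := chart_at hM x.
have /nbhs_ballP[e /= e0 eD] := open_nbhs_nbhs (conj (chart_im_open hM Ac) ix).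
exists [set q' | cdom c q' /\ ball (cmap c x) e (cmap c q')].
  by apply: (nbhs_cmap hM Ac dx); exact: nbhsx_ballx.
move=> a b _ _ [da ba] [db bb] na.
have ca := nbhs_cinv hM Ac da na.
apply: (spread c a b e (cmap c x)) => //.
  by rewrite /= (cinv_cmap hM)//; exact: (nbhs_singleton na).
by apply: normal_at => //; [exists a|apply: filterS ca => v []].
Qed.

Lemma normal_coord0 q : y q *m J *m B^T = 0.
Proof.
apply/orth_rowsP => a; apply: normal_global => [|l].
  by rewrite ipC// -(row_id 0 (f0 u0)) -gramE Bf mxE.
by rewrite ipC// -(row_jacobian l (sf Ac0) im0) -gramE Bd mxE.
Qed.

Local Notation L := (lorentz_map t T B).
(** The columns of [lorentz_map] that belong to [t] and [T]. The columns that belong to [B] give 0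
    on the image of [y], by [normal_coord0]. *)
Let Q : 'M[R]_(1 + (m + p), 1 + m) := row_mx (- (J *m t^T)) (J *m T^T).
Let z q : 'rV[R]_(1 + m) := y q *m Q.
Let K := J *m T^T.
Let zeta q : 'rV[R]_m := y q *m K.

Let zE q : z q = row_mx (- (y q *m J *m t^T)) (zeta q).
Proof. by rewrite /z /Q mul_mx_row mulmxN !mulmxA /zeta mulmxA. Qed.

Let yL q : y q *m L = hyperbolic_incl p (z q).
Proof. by rewrite lorentz_mapE normal_coord0 zE hyperbolic_inclE /zeta mulmxA. Qed.

Let tt : ip J t t < 0.
Proof. by rewrite /t ipZl ipZr f0u0 feps mulrA nmulr_llt0 // mulr_gt0 // invr_gt0. Qed.
Let t0 : 0 < t 0 ord0.
Proof. by rewrite /t f0u0 mxE mulr_gt0 ?invr_gt0//; have [] := yH q0. Qed.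

Let isoL : hyperbolic_isometry L. Proof. exact: hyperbolic_lorentz_map. Qed.

Let zH q : hyperbolic m (- (r ^+ 2)^-1) (z q).
Proof.
have [] := isoL.2 (- (r ^+ 2)^-1) (y q) _ (yH q); first by rewrite oppr_lt0 invr_gt0.
rewrite yL zE hyperbolic_inclE mink_row eucl_row ip0l addr0 row_mx_ord0 => h1 h2.
by split; [rewrite -h1 ip_mink !row_mxKr !row_mx_ord0|rewrite row_mx_ord0].
Qed.

Lemma hyperbolic_rsubmx (n : nat) (c : R) (v w : 'rV[R]_(1 + n)) :
  hyperbolic n c v -> hyperbolic n c w -> rsubmx v = rsubmx w -> v = w.
Proof.
move=> [vv v0] [ww w0] vw.
suff e : v 0 ord0 = w 0 ord0.
  rewrite -(hsubmxK v) -(hsubmxK w) vw; congr row_mx; apply/rowP => i.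
  by rewrite ord1 !mxE (_ : lshift n 0 = ord0) //; exact: val_inj.
move: vv; rewrite -ww !ip_mink vw => /addIr/oppr_inj e.
by apply/eqP; rewrite -(eqrXn2 (n := 2)) ?ltW// !expr2 e.
Qed.

(** A tangent vector [w] has no coordinates along [B], since those of [y] vanish identically. If its
    [T]-coordinates vanish too, only the time coordinate is left, and orthogonality to [y], whose
    time coordinate is positive, makes it 0. *)
Let tangent c u (v : 'rV[R]_m) : A c -> chart_im c u ->
  v *m jacobian (y \o cinv c) u *m K = 0 -> v = 0.
Proof.
move=> Ac cu; set f := y \o cinv c; set w := v *m jacobian f u => wK.
have oc := chart_im_open hM Ac.
have wE : w = \sum_l v 0 l *: dpart l f u.
  rewrite (sum_row_jacobian (sf Ac))//; congr (_ *m _).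
  by apply/rowP => l; rewrite mxE.
have wB : w *m J *m B^T = 0.
  apply/orth_rowsP => a; rewrite wE ip_suml big1// => l _; rewrite ipZl normal_at ?mulr0//.
  apply: filterS filterT => v' _ /=; by move/orth_rowsP: (normal_coord0 (cinv c v')); exact.
have wf : ip J w (f u) = 0.
  rewrite wE ip_suml big1// => l _.
  by rewrite ipZl ipC// (quadric_ip_d Js oc (sf Ac) (fun u _ => feps _))// mulr0.
have wT : w *m J *m T^T = 0 by rewrite -mulmxA; exact: wK.
have wL : w *m L = row_mx (- (w *m J *m t^T)) (row_mx 0 0).
  by rewrite lorentz_mapE wB wT.
suff w0 : w = 0.
  by apply: (row_free_inj (hy.2 c u Ac cu)); rewrite mul0mx.
apply: (lorentz_map_inj FF); rewrite wL.
suff -> : - (w *m J *m t^T) = 0 by rewrite !row_mx0.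
have := wf; rewrite -(ip_lorentz_map FF) wL /f /= yL zE hyperbolic_inclE mink_row eucl_row !ip0l !addr0.
have [_] := zH (cinv c u); rewrite zE row_mx_ord0 => z0 /eqP.
rewrite oppr_eq0 mulf_eq0 (gt_eqF z0) orbF => /eqP e.
by apply/matrixP => i j; rewrite !ord1 e mxE.
Qed.

Lemma hyperbolic_image_immersion : immersion A z.
Proof.
split=> [c Ac|c u Ac cu]; first exact: (smooth_mulmxr (chart_im_open hM Ac) Q (sf Ac)).
have oc := chart_im_open hM Ac.
apply: row_free_inj0 => v vj; apply: (tangent Ac cu).
have jE : jacobian (z \o cinv c) u = jacobian (y \o cinv c) u *m Q.
  apply/row_matrixP => i; rewrite row_mul.
  by rewrite (row_jacobian i (smooth_mulmxr oc Q (sf Ac)) cu) (row_jacobian i (sf Ac) cu) -(pd_mulmxr oc Q i (sf Ac) cu).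
by move: vj; rewrite jE mulmxA /Q mul_mx_row -[X in _ = X]row_mx0 => /eq_row_mx[_].
Qed.

Let F c (u : 'rV[R]_m) : 'rV[R]_m := y (cinv c u) *m K.
Let sF c : A c -> smooth_on (chart_im c) (F c).
Proof. by move=> Ac; exact: (smooth_mulmxr (chart_im_open hM Ac) K (sf Ac)). Qed.
Let jF c u : A c -> chart_im c u -> jacobian (F c) u = jacobian (y \o cinv c) u *m K.
Proof.
move=> Ac cu; have oc := chart_im_open hM Ac; apply/row_matrixP => i; rewrite row_mul.
by rewrite (row_jacobian i (sF Ac) cu) (row_jacobian i (sf Ac) cu) -(pd_mulmxr oc K i (sf Ac) cu).
Qed.
Let uF c u : A c -> chart_im c u -> jacobian (F c) u \in unitmx.
Proof. by move=> Ac cu; apply: unitmx_inj => v; rewrite jF// mulmxA; exact: tangent. Qed.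

Let zeta_inj (q : M) : exists2 U : set M, nbhs q U & forall a b, U a -> U b -> zeta a = zeta b -> a = b.
Proof.
have [c [Ac dq iq qE]] := chart_at hM q.
have [e e0 [eD inj]] := locally_injective (chart_im_open hM Ac) (sF Ac) iq (uF Ac iq).
exists [set q' | cdom c q' /\ ball (cmap c q) e (cmap c q')].
  by apply: (nbhs_cmap hM Ac dq); exact: nbhsx_ballx.
move=> a b [da ba] [db bb] ab; rewrite -(cinv_cmap hM Ac da) -(cinv_cmap hM Ac db).
by congr cinv; apply: inj => //; rewrite /F !(cinv_cmap hM).
Qed.

Let zeta_open (q : M) (N : set M) : nbhs q N -> nbhs (zeta q) (zeta @` N).
Proof.
move=> Nq; have [c [Ac dq iq qE]] := chart_at hM q.
have := open_at (chart_im_open hM Ac) (sF Ac) iq (uF Ac iq) (nbhs_cinv hM Ac dq Nq).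
rewrite /F qE; apply: filterS => _ [u [_ Nu] <-]; by exists (cinv c u).
Qed.

Let zeta_continuous : continuous zeta.
Proof.
move=> q N Nq; have [c [Ac dq iq qE]] := chart_at hM q.
have cF := differentiable_continuous (smooth_diff (sF Ac) iq).
have : nbhs (cmap c q) [set u | N (F c u)] by apply: cF; rewrite /F qE.
by move=> /(nbhs_cmap hM Ac dq); apply: filterS => q' [d']; rewrite /= /F (cinv_cmap hM).
Qed.

(** The hyperbolic space is a graph over its space coordinates, so its relatively open subset
    [range z] is cut out by the preimage of the open set [range zeta]. *)
Lemma hyperbolic_image_open :
  exists2 W : set 'rV[R]_(1 + m), open W & range z = W `&` hyperbolic m (- (r ^+ 2)^-1).
Proof.
have oz : open (range zeta).
  rewrite openE => _ [q _ <-]; apply: zeta_open; exact: filterT.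
pose P : 'M[R]_(1 + m, m) := col_mx 0 1%:M.
have PE (w : 'rV[R]_(1 + m)) : w *m P = rsubmx w.
  by rewrite -{1}(hsubmxK w) mul_row_col mulmx0 mulmx1 add0r.
exists [set w : 'rV[R]_(1 + m) | range zeta (w *m P)]; first exact: open_pullback.
apply/seteqP; split=> [_ [q _ <-]|w [[q _ qw] Hw]].
  by split=> //; exists q => //; rewrite PE zE row_mxKr.
exists q => //; apply: hyperbolic_rsubmx (zH q) Hw _.
by rewrite -[RHS]PE -qw zE row_mxKr.
Qed.

Section Complete.
Hypothesis comp : complete_metric A J y.

Let zeta_q0 : zeta q0 = 0.
Proof.
have Do := chart_im_open hM Ac0.
have o : f0 u0 *m J *m (jacobian f0 u0)^T = 0.
  apply/orth_rowsP => l; rewrite (row_jacobian l (sf Ac0) im0).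
  exact: (quadric_ip_d Js Do (sf Ac0) (fun u _ => feps _)).
by rewrite /zeta /K /T trmx_mul !mulmxA -f0u0 o mul0mx.
Qed.

Section Geodesic.
Variable gamma : R -> M.
Hypothesis geo : geodesic A J y gamma.
Let Y (s : R) := y (gamma s).
Let Y' s : 'rV[R]_(1 + (m + p)) := \row_a derive1 (fun s => Y s 0 a) s.
Let vel (c : chart R M m) (s : R) : 'rV[R]_(1 + (m + p)) :=
  \sum_i derive1 (cmap c \o gamma) s 0 i *: dpart i (y \o cinv c) (cmap c (gamma s)).

Let near_chart c s : A c -> cdom c (gamma s) -> nbhs s [set s' | cdom c (gamma s')].
Proof.
move=> Ac ds; apply: (geo.1 s); apply: open_nbhs_nbhs; split=> //.
by case: hM => _ _ /(_ c Ac)[].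
Qed.

Let velocity c s a : A c -> cdom c (gamma s) -> is_derive s 1 (fun s => Y s 0 a) (vel c s 0 a).
Proof.
move=> Ac ds; have Do := chart_im_open hM Ac.
have [dw _ _] := geo.2 c s Ac ds.
have is_ : chart_im c (cmap c (gamma s)) by exists (gamma s).
apply: near_eq_is_derive (curve_velocity Do (sf Ac) (w := cmap c \o gamma) is_ dw a).
apply: filterS (near_chart Ac ds) => s' ds'.
by rewrite /= (cinv_cmap hM Ac ds').
Qed.

Let velE c s : A c -> cdom c (gamma s) -> Y' s = vel c s.
Proof.
move=> Ac ds; apply/rowP => a; rewrite mxE derive1E.
by have [_ ->] := velocity a Ac ds.
Qed.

Let d1 (s : R) a : is_derive s (1 : R) (fun s => Y s 0 a) (Y' s 0 a).
Proof.
by have [c [Ac ds _ _]] := chart_at hM (gamma s); rewrite (velE Ac ds); exact: velocity.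
Qed.

Let kap s := ip J (Y' s) (Y' s) / r ^+ 2.

Let d2 (s : R) a : is_derive s (1 : R) (fun s => Y' s 0 a) (kap s * Y s 0 a).
Proof.
have [c [Ac ds is_ cE]] := chart_at hM (gamma s); have Do := chart_im_open hM Ac.
have [dw d2w] := geo.2 c s Ac ds; rewrite induced_metricE gamE => ge.
have := curve_acceleration Js Do (sf Ac) eps0 (fun u _ => feps _) (fun u => Gu Ac)
  (fun i j u => h0 i j Ac) (w := cmap c \o gamma) is_ dw d2w ge a.
rewrite /= cE -/(vel c s) -(velE Ac ds) invrN mulrN opprK.
apply: near_eq_is_derive; apply: filterS (near_chart Ac ds) => s' ds'.
by rewrite (velE Ac ds').
Qed.

Lemma zeta_geodesic (v : 'rV[R]_m) : gamma 0 = q0 ->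
  derive1 (cmap c0 \o gamma) 0 = v -> v != 0 ->
  exists2 k, 0 < k & forall s, zeta (gamma s) =
    ((expR (k * s) - expR (- (k * s))) / (2 * k)) *: (v *m jacobian (F c0) u0).
Proof.
move=> g0 gv v0; have Do := chart_im_open hM Ac0.
have Y0 : Y' 0 = v *m jacobian f0 u0.
  have d0 : cdom c0 (gamma 0) by rewrite g0.
  rewrite (velE Ac0 d0) /vel gv g0 (sum_row_jacobian (sf Ac0))//; congr (_ *m _).
  by apply/rowP => l; rewrite mxE.
(* The velocity is nonzero and orthogonal to the time-like position vector, hence space-like; this
   makes the constant [kap 0] positive. *)
have pos : 0 < ip J (Y' 0) (Y' 0).
  apply: (mink_orth_pos (t := y q0)); first by rewrite feps.
    have := is_derive_ip J (d1 0) (d1 0) => -[_].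
    rewrite (_ : (fun s => _) = cst (- r ^+ 2)); last by apply/funext => s; exact: feps.
    by rewrite derive_cst /Y g0 (ipC (Y' 0) _ Js); lra.
  by apply: contraNneq v0 => Y00; apply/eqP/(tangent Ac0 im0); rewrite -Y0 Y00 mul0mx.
have kE s : kap s = kap 0 by rewrite /kap (curve_speed_cst Js d1 d2 (fun s => feps _)).
have kp : 0 < kap 0 by rewrite divr_gt0.
exists (Num.sqrt (kap 0)); first by rewrite sqrtr_gt0.
move=> s; apply/rowP => j; rewrite [RHS]mxE [RHS]mulrC mulrA.
pose phi s := (Y s *m K) 0 j; pose dphi s := (Y' s *m K) 0 j.
apply: (sinh_ode (phi := phi) (dphi := dphi)).
- by rewrite sqrtr_eq0 -ltNge.
- by move=> x; exact: is_derive_mulmxr.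
- move=> x; rewrite sqr_sqrtr ?ltW// -(kE x).
  have -> : kap x * phi x = ((kap x *: Y x) *m K) 0 j by rewrite -scalemxAl mxE.
  by apply: is_derive_mulmxr => a; rewrite mxE; exact: d2.
- by rewrite /phi /Y g0 -[_ *m K]/(zeta q0) zeta_q0 mxE.
- by rewrite /dphi Y0 (jF Ac0 im0) (mulmxA v).
Qed.

End Geodesic.

(** The initial velocity is the preimage of [e] under the differential of [zeta] at [q0], and the
    inverse hyperbolic sine reparametrises the projected geodesic to unit rate along [e]. For
    [e = 0] a constant lift serves. *)
Let radial_lift (e : 'rV[R]_m) : exists sigma : R -> M,
  [/\ continuous sigma, sigma 0 = q0 & forall s, zeta (sigma s) = s *: e].
Proof.
have [->|e0] := eqVneq e 0.
  exists (fun=> q0); split=> //; first by move=> x; exact: cvg_cst.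
  by move=> s; rewrite scaler0.
have u := uF Ac0 im0; pose v := e *m invmx (jacobian (F c0) u0).
have [gamma [geo g0 gv]] := comp v Ac0 cq0.
have [|k k0 gE] := zeta_geodesic geo g0 gv.
  by apply: contraNneq e0 => v0; rewrite -(mulmxKV u e) -/v v0 mul0mx.
have [a ca [a0 aE]] := asinh_continuous k0.
exists (gamma \o a); split=> /=; last by move=> s; rewrite gE aE /v mulmxKV.
  by move=> x; apply: (continuous_comp (ca x)); exact: geo.1.
by rewrite a0.
Qed.

Lemma hyperbolic_image_bij : set_bij [set: M] (hyperbolic m (- (r ^+ 2)^-1)) z.
Proof.
have [sigma sE] := choice radial_lift.
have hausdorff : hausdorff_space M by case: hM.
have cs e : continuous (sigma e) by case: (sE e).
have s0 e : sigma e 0 = q0 by case: (sE e).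
have zs e s : zeta (sigma e s) = s *: e by case: (sE e).
have inv := radial_lift_inverse hausdorff cM zeta_continuous zeta_inj zeta_open cs s0 zs.
have zr q : rsubmx (z q) = zeta q by rewrite zE row_mxKr.
split.
- by move=> q _; exact: zH.
- by move=> a b _ _ ab; rewrite -(inv a) -(inv b) -!zr ab.
move=> w Hw; exists (sigma (rsubmx w) 1) => //.
apply: hyperbolic_rsubmx (zH _) Hw _.
by rewrite zr zs scale1r.
Qed.

End Complete.

Lemma hyperbolic_rigidity_frame : exists (L : 'M[R]_(1 + (m + p))) (z : M -> 'rV[R]_(1 + m)),
  [/\ hyperbolic_isometry L, (forall q, y q *m L = hyperbolic_incl p (z q)), immersion A z,
      (exists2 W : set 'rV[R]_(1 + m), open W &
         range z = W `&` hyperbolic m (- (r ^+ 2)^-1)) &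
      complete_metric A J y -> set_bij [set: M] (hyperbolic m (- (r ^+ 2)^-1)) z].
Proof.
exists L, z; split.
- exact: isoL.
- exact: yL.
- exact: hyperbolic_image_immersion.
- exact: hyperbolic_image_open.
- exact: hyperbolic_image_bij.
Qed.

End HyperbolicRigidity.

Lemma hyperbolic_rigidity (R : realType) (m p : nat) (M : topologicalType) (A : set (chart R M m))
    (y : M -> 'rV[R]_(1 + (m + p))) (r : R) :
  0 < r -> smooth_manifold A -> immersion A y ->
  (forall q, hyperbolic (m + p) (- (r ^+ 2)^-1) (y q)) ->
  (forall c i j u, A c -> chart_im c u -> hsff (mink R (m + p)) (y \o cinv c) i j u = 0) ->
  connected [set: M] -> [set: M] !=set0 ->
  exists (L : 'M[R]_(1 + (m + p))) (z : M -> 'rV[R]_(1 + m)),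
  [/\ hyperbolic_isometry L, (forall q, y q *m L = hyperbolic_incl p (z q)), immersion A z,
      (exists2 W : set 'rV[R]_(1 + m), open W &
         range z = W `&` hyperbolic m (- (r ^+ 2)^-1)) &
      complete_metric A (mink R (m + p)) y ->
      set_bij [set: M] (hyperbolic m (- (r ^+ 2)^-1)) z].
Proof.
move=> r0 hM hy yH h0 cM [q0 _]; have [c [Ac dq iq qE]] := chart_at hM q0.
have Do := chart_im_open hM Ac.
have sf : smooth_on (chart_im c) (y \o cinv c) by exact: hy.1.
have feps u : chart_im c u -> ip (mink R (m + p)) ((y \o cinv c) u) ((y \o cinv c) u) = - r ^+ 2.
  by move=> _; have [-> _] := yH (cinv c u); rewrite invrN invrK.
have eps0 : - r ^+ 2 < 0 by rewrite oppr_lt0 exprn_gt0.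
have Gu u (cu : chart_im c u) := hyperbolic_metric_unit Do sf eps0 feps cu (hy.2 c u Ac cu).
have [C [B [_ Bf Bd FF]]] := hyperbolic_frame r0 Do sf feps Gu iq.
exact: (hyperbolic_rigidity_frame r0 hM hy yH h0 cM Ac dq Bf Bd FF).
Qed.


(** * Blaschke eigenvalues and passage from product charts to the manifold *)

Lemma eucl_metric_unit (R : realType) (m N : nat) (f : 'rV[R]_m -> 'rV[R]_N) (u : 'rV[R]_m) :
  row_free (jacobian f u) -> metric (eucl R N) f u \in unitmx.
Proof.
move=> rf; apply: unitmx_inj => v vG; apply: (row_free_inj rf); rewrite mul0mx.
apply: eucl_eq0; rewrite /ip trmx_mul !mulmxA -(mulmxA v) -(mulmxA v).
by rewrite -/(induced_metric _ _ _) induced_metricE vG mul0mx mxE.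
Qed.

(** Subtracting equations gives [M (l_a - l_b) = m_a kap_a - m_b kap_b]. Only the hyperbolic factor
    has negative curvature, so [l1] always differs from the other two, and the condition concerns
    [l2] and [l3] alone. *)
Lemma LS_lambda_uniq (R : realType) (m1 m2 m3 : nat) (r1 r2 r3 l1 l2 l3 : R) :
  (0 < m1)%N -> (0 < m2)%N -> (0 < m3)%N -> 0 < r1 -> 0 < r2 -> 0 < r3 ->
  LS_lambda m1 m2 m3 r1 r2 r3 l1 l2 l3 ->
  uniq [:: l1; l2; l3] <-> m3%:R * r2 ^+ 2 <> m2%:R * r3 ^+ 2.
Proof.
move=> hm1 hm2 hm3 hr1 hr2 hr3 []; rewrite !natrD.
have M1 : 0 < (m1%:R : R) by rewrite ltr0n.
have M2 : 0 < (m2%:R : R) by rewrite ltr0n.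
have M3 : 0 < (m3%:R : R) by rewrite ltr0n.
have d1 : 0 < m1%:R / r1 ^+ 2 by rewrite divr_gt0// exprn_gt0.
have d2 : 0 < m2%:R / r2 ^+ 2 by rewrite divr_gt0// exprn_gt0.
have d3 : 0 < m3%:R / r3 ^+ 2 by rewrite divr_gt0// exprn_gt0.
have d23 : (m2%:R / r2 ^+ 2 == m3%:R / r3 ^+ 2) = (m3%:R * r2 ^+ 2 == m2%:R * r3 ^+ 2).
  by rewrite eqr_div ?expf_neq0 ?lt0r_neq0// eq_sym.
set M := (m1%:R + m2%:R + m3%:R : R) => e1 e2 e3.
have M0 : 0 < M by rewrite !addr_gt0.
have e12 : M * (l2 - l1) = m2%:R / r2 ^+ 2 + m1%:R / r1 ^+ 2.
  by rewrite -e2 -[X in _ = _ + X]opprK -e1; ring.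
have e13 : M * (l3 - l1) = m3%:R / r3 ^+ 2 + m1%:R / r1 ^+ 2.
  by rewrite -e3 -[X in _ = _ + X]opprK -e1; ring.
have e23 : M * (l2 - l3) = m2%:R / r2 ^+ 2 - m3%:R / r3 ^+ 2.
  by rewrite -e2 -e3; ring.
have l12 : l1 != l2.
  by rewrite eq_sym -subr_eq0 -(mulrI_eq0 _ (lregP (lt0r_neq0 M0))) e12 gt_eqF// addr_gt0.
have l13 : l1 != l3.
  by rewrite eq_sym -subr_eq0 -(mulrI_eq0 _ (lregP (lt0r_neq0 M0))) e13 gt_eqF// addr_gt0.
have l23 : (l2 == l3) = (m3%:R * r2 ^+ 2 == m2%:R * r3 ^+ 2).
  by rewrite -d23 -subr_eq0 -(mulrI_eq0 _ (lregP (lt0r_neq0 M0))) e23 subr_eq0.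
rewrite /= !inE negb_or l12 l13 l23 /= andbT.
by split=> [/eqP|h]; last exact/eqP.
Qed.

Lemma prod_chart_im (R : realType) (T T' : Type) (m m' : nat) (c : chart R T m) (c' : chart R T' m')
    (u : 'rV[R]_m) (u' : 'rV[R]_m') :
  chart_im (prod_chart c c') (row_mx u u') <-> chart_im c u /\ chart_im c' u'.
Proof.
split=> [[[q q'] [/= dq dq'] /eq_row_mx[<- <-]]|[[q dq <-] [q' dq' <-]]].
  by split; [exists q|exists q'].
by exists (q, q').
Qed.

Theorem proposition3p2 (R : realType)
  (m1 m2 m3 p1 p2 p3 : nat) (r1 r2 r3 mu1 mu2 mu3 : R)
  (l1 l2 l3 b1 b2 b3 : R)
  (M1 M2 M3 : topologicalType)
  (A1 : set (chart R M1 m1)) (A2 : set (chart R M2 m2))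
  (A3 : set (chart R M3 m3))
  (y : M1 -> 'rV[R]_(1 + (m1 + p1)))
  (y2 : M2 -> 'rV[R]_(1 + (m2 + p2)))
  (y3 : M3 -> 'rV[R]_(1 + (m3 + p3)))
  (hm1 : (0 < m1)%N) (hm2 : (0 < m2)%N) (hm3 : (0 < m3)%N)
  (hr1 : 0 < r1) (hr2 : 0 < r2) (hr3 : 0 < r3)
  (hr : r1 ^+ 2 = r2 ^+ 2 + r3 ^+ 2)
  (hmu1 : 0 <= mu1) (hmu2 : 0 <= mu2) (hmu3 : 0 <= mu3)
  (hmu : mu1 + mu2 + mu3 = 1)
  (hl : LS_lambda m1 m2 m3 r1 r2 r3 l1 l2 l3)
  (hb : LS_B0 m1 m2 m3 l1 l2 l3 b1 b2 b3)
  (hM1 : smooth_manifold A1) (hM2 : smooth_manifold A2)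
  (hM3 : smooth_manifold A3)
  (hM1ne : [set: M1] !=set0) (hM2ne : [set: M2] !=set0)
  (hM3ne : [set: M3] !=set0)
  (hy : immersion A1 y) (hy2 : immersion A2 y2) (hy3 : immersion A3 y3)
  (hyH : forall q, hyperbolic (m1 + p1) (- (r1 ^+ 2)^-1) (y q))
  (hy2S : forall q, sphere (m2 + p2) r2 (y2 q)) (hy3S : forall q, sphere (m3 + p3) r3 (y3 q))
  (hymin : minimal A1 (mink R (m1 + p1)) y)
  (hy2min : minimal A2 (eucl R (1 + (m2 + p2))) y2)
  (hy3min : minimal A3 (eucl R (1 + (m3 + p3))) y3)
  (hscal1 : has_scalar_curvature A1 (mink R (m1 + p1)) y
     (- (m1%:R * (m1%:R - 1) / r1 ^+ 2) + mu1 * LS_K m1 m2 m3 b1 b2 b3))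
  (hscal2 : has_scalar_curvature A2 (eucl R (1 + (m2 + p2))) y2
     (m2%:R * (m2%:R - 1) / r2 ^+ 2 + mu2 * LS_K m1 m2 m3 b1 b2 b3))
  (hscal3 : has_scalar_curvature A3 (eucl R (1 + (m3 + p3))) y3
     (m3%:R * (m3%:R - 1) / r3 ^+ 2 + mu3 * LS_K m1 m2 m3 b1 b2 b3)) :
  let A := prod_atlas (prod_atlas A1 A2) A3 in
  let x := LS_immersion y y2 y3 in
  moebius_form_vanishes A x /\
  (in_charts A x (fun f u =>
     forall a, blaschke_eigenvalue f u a <-> a \in [:: l1; l2; l3]) /\
   (uniq [:: l1; l2; l3] <-> m3%:R * r2 ^+ 2 <> m2%:R * r3 ^+ 2)) /\
  (moebius_sff_parallel A x <->
     [/\ parallel A1 (mink R (m1 + p1)) y,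
         parallel A2 (eucl R (1 + (m2 + p2))) y2 &
         parallel A3 (eucl R (1 + (m3 + p3))) y3]) /\
  (moebius_sff_parallel A x -> connected [set: M1] ->
     exists (L : 'M[R]_(1 + (m1 + p1))) (z : M1 -> 'rV[R]_(1 + m1)),
       [/\ hyperbolic_isometry L,
           (forall q, y q *m L = hyperbolic_incl p1 (z q)),
           immersion A1 z,
           (exists2 W : set 'rV[R]_(1 + m1), open W &
              range z = W `&` hyperbolic m1 (- (r1 ^+ 2)^-1)) &
           complete_metric A1 (mink R (m1 + p1)) y ->
           set_bij [set: M1] (hyperbolic m1 (- (r1 ^+ 2)^-1)) z]).
Proof.
move=> A x.
have q1 q : ip (mink R (m1 + p1)) (y q) (y q) = - r1 ^+ 2.
  by have [-> _] := hyH q; rewrite invrN invrK.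
have eps0 : - r1 ^+ 2 < 0 by rewrite oppr_lt0 exprn_gt0.
have Do1 c (Ac : A1 c) := chart_im_open hM1 Ac.
have Do2 c (Ac : A2 c) := chart_im_open hM2 Ac.
have Do3 c (Ac : A3 c) := chart_im_open hM3 Ac.
have Gu1 c u (Ac : A1 c) (cu : chart_im c u) :
    metric (mink R (m1 + p1)) (y \o cinv c) u \in unitmx.
  exact: (hyperbolic_metric_unit (Do1 c Ac) (hy.1 c Ac) eps0 (fun _ _ => q1 _) cu (hy.2 c u Ac cu)).
have main c1 c2 c3 u1 u2 u3 : A1 c1 -> A2 c2 -> A3 c3 ->
    chart_im c1 u1 -> chart_im c2 u2 -> chart_im c3 u3 ->
    let f := x \o cinv (prod_chart (prod_chart c1 c2) c3) in
    let u := row_mx (row_mx u1 u2) u3 in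
    [/\ forall i, moebius_form f i u = 0,
        forall a, blaschke_eigenvalue f u a <-> a \in [:: l1; l2; l3] &
        (forall k i j, nabla_moebius_sff f k i j u = 0) <->
        [/\ forall k i j, nabla_sff (mink R (m1 + p1)) (y \o cinv c1) k i j u1 = 0,
            forall k i j, nabla_sff (eucl R (1 + (m2 + p2))) (y2 \o cinv c2) k i j u2 = 0 &
            forall k i j, nabla_sff (eucl R (1 + (m3 + p3))) (y3 \o cinv c3) k i j u3 = 0]].
  move=> a1 a2 a3 i1 i2 i3 f u.
  have uP1 : u *m pr1 m1 m2 m3 R = u1 by rewrite mul_pr1 !row_mxKl.
  have uP2 : u *m pr2 m1 m2 m3 R = u2 by rewrite mul_pr2 row_mxKl row_mxKr.
  have uP3 : u *m pr3 m1 m2 m3 R = u3 by rewrite mul_pr3 row_mxKr.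
  have Du : chart_im c1 (u *m pr1 m1 m2 m3 R) /\ chart_im c2 (u *m pr2 m1 m2 m3 R) /\
      chart_im c3 (u *m pr3 m1 m2 m3 R) by rewrite uP1 uP2 uP3.
  have fE : f = fun u => ((y \o cinv c1) (u *m pr1 m1 m2 m3 R) 0 ord0)^-1 *:
      row_mx (row_mx (rsubmx ((y \o cinv c1) (u *m pr1 m1 m2 m3 R)))
        ((y2 \o cinv c2) (u *m pr2 m1 m2 m3 R))) ((y3 \o cinv c3) (u *m pr3 m1 m2 m3 R)).
    by apply/funext => w; rewrite mul_pr1 mul_pr2 mul_pr3.
  have Gu2 v (cv : chart_im c2 v) := eucl_metric_unit (hy2.2 c2 v a2 cv).
  have Gu3 v (cv : chart_im c3 v) := eucl_metric_unit (hy3.2 c3 v a3 cv).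
  have pos v (_ : chart_im c1 v) := (hyH (cinv c1 v)).2.
  rewrite fE; split.
  - move=> i; exact: (LS_moebius_form0 hm1 hm2 hm3 hr1 hr2 hr3 hr hmu hl hb (Do1 _ a1) (Do2 _ a2)
      (Do3 _ a3) (hy.1 c1 a1) (hy2.1 c2 a2) (hy3.1 c3 a3) (fun v => Gu1 c1 v a1) Gu2 Gu3
      (fun v _ => q1 _) (fun v _ => hy2S _) (fun v _ => hy3S _) pos
      (fun v => hymin c1 v a1) (fun v => hy2min c2 v a2) (fun v => hy3min c3 v a3)
      (fun v => hscal1 c1 v a1) (fun v => hscal2 c2 v a2) (fun v => hscal3 c3 v a3) i Du).
  - move=> a; exact: (LS_eigenvalues hm1 hm2 hm3 hr1 hr2 hr3 hr hmu hl hb (Do1 _ a1) (Do2 _ a2)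
      (Do3 _ a3) (hy.1 c1 a1) (hy2.1 c2 a2) (hy3.1 c3 a3) (fun v => Gu1 c1 v a1) Gu2 Gu3
      (fun v _ => q1 _) (fun v _ => hy2S _) (fun v _ => hy3S _) pos
      (fun v => hymin c1 v a1) (fun v => hy2min c2 v a2) (fun v => hy3min c3 v a3)
      (fun v => hscal1 c1 v a1) (fun v => hscal2 c2 v a2) (fun v => hscal3 c3 v a3) a Du).
  - have := (LS_parallel hm1 hm2 hm3 hr1 hr2 hr3 hr hmu hl hb (Do1 _ a1) (Do2 _ a2)
      (Do3 _ a3) (hy.1 c1 a1) (hy2.1 c2 a2) (hy3.1 c3 a3) (fun v => Gu1 c1 v a1) Gu2 Gu3
      (fun v _ => q1 _) (fun v _ => hy2S _) (fun v _ => hy3S _) pos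
      (fun v => hymin c1 v a1) (fun v => hy2min c2 v a2) (fun v => hy3min c3 v a3)
      (fun v => hscal1 c1 v a1) (fun v => hscal2 c2 v a2) (fun v => hscal3 c3 v a3) Du).
    by rewrite uP1 uP2 uP3.
have inA (P : (_ -> _) -> _ -> Prop) : in_charts A x P <->
    forall c1 c2 c3 u1 u2 u3, A1 c1 -> A2 c2 -> A3 c3 ->
    chart_im c1 u1 -> chart_im c2 u2 -> chart_im c3 u3 ->
    P (x \o cinv (prod_chart (prod_chart c1 c2) c3)) (row_mx (row_mx u1 u2) u3).
  split=> [h c1 c2 c3 u1 u2 u3 a1 a2 a3 i1 i2 i3|h _ u [_ [c3 [[c1 [c2 [a1 a2 ->]]] a3 ->]]]].
    apply: h; last by apply/prod_chart_im; split=> //; exact/prod_chart_im.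
    by exists (prod_chart c1 c2), c3; split=> //; exists c1, c2.
  rewrite -(hsubmxK u) -(hsubmxK (lsubmx u)) => /prod_chart_im[/prod_chart_im[i1 i2] i3].
  exact: h.
have parE : moebius_sff_parallel A x <-> [/\ parallel A1 (mink R (m1 + p1)) y,
    parallel A2 (eucl R (1 + (m2 + p2))) y2 & parallel A3 (eucl R (1 + (m3 + p3))) y3].
  split=> [/inA h|[h1 h2 h3]]; last first.
    apply/inA => c1 c2 c3 u1 u2 u3 a1 a2 a3 i1 i2 i3.
    have [_ _ [_ ]] := main c1 c2 c3 u1 u2 u3 a1 a2 a3 i1 i2 i3; apply.
    by split; [exact: h1|exact: h2|exact: h3].
  (* Parallelism of [B] is a statement at triples of points. To read off the condition at a point of
     one factor, base points in the other two are fixed; this is where the factors have to be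
     nonempty. *)
  have [t1 _] := hM1ne; have [c1 [a1 _ i1 _]] := chart_at hM1 t1.
  have [t2 _] := hM2ne; have [c2 [a2 _ i2 _]] := chart_at hM2 t2.
  have [t3 _] := hM3ne; have [c3 [a3 _ i3 _]] := chart_at hM3 t3.
  have par d1 d2 d3 v1 v2 v3 e1 e2 e3 j1 j2 j3 :=
    let: And3 _ _ m := main d1 d2 d3 v1 v2 v3 e1 e2 e3 j1 j2 j3 in
    m.1 (h d1 d2 d3 v1 v2 v3 e1 e2 e3 j1 j2 j3).
  split=> c u ac cu.
  - by have [] := par c c2 c3 u _ _ ac a2 a3 cu i2 i3.
  - by have [] := par c1 c c3 _ u _ a1 ac a3 i1 cu i3.
  - by have [] := par c1 c2 c _ _ u a1 a2 ac i1 i2 cu.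
split; first by apply/inA => c1 c2 c3 u1 u2 u3 a1 a2 a3 i1 i2 i3; case: (main c1 c2 c3 u1 u2 u3).
split.
  split; last exact: LS_lambda_uniq hl.
  by apply/inA => c1 c2 c3 u1 u2 u3 a1 a2 a3 i1 i2 i3; case: (main c1 c2 c3 u1 u2 u3).
split=> // /parE[par1 _ _] conn.
apply: (hyperbolic_rigidity hr1 hM1 hy hyH _ conn hM1ne) => c i j u Ac cu.
exact: (minimal_parallel_hyperbolic hm1 hr1 (Do1 c Ac) (hy.1 c Ac) (fun _ _ => q1 _)
  (fun v => Gu1 c v Ac) (fun v => hymin c v Ac) (fun k i j v cv => par1 c v Ac cv k i j) i j cu).
Qed.
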